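(* Let $n\ge2$ and let $L$ be an infinitely smooth origin-symmetric convex body in $\mathbb{R}^n$ with strictly positive curvature that is not an intersection body. Then there exists $\varepsilon_0>0$ such that for every $\varepsilon\in(0,\varepsilon_0)$ there exists an origin-symmetric convex body $K\subset L$ with $$|K\cap\xi^\perp|\ \le\ |L\cap\xi^\perp|-\varepsilon\qquad\text{for all }\xi\in S^{n-1},$$ but $$|K|^{\frac{n-1}{n}}\ >\ |L|^{\frac{n-1}{n}}-c_{n,1}\,\varepsilon .$$
   Context: $\xi^\perp$ is the hyperplane through the origin orthogonal to $\xi$; $|K\cap\xi^\perp|$ is $(n-1)$-dimensional volume and $|K|$ is $n$-dimensional volume. $B_2^m$ is the Euclidean unit ball in $\mathbb{R}^m$ and $c_{n,1}=|B_2^n|^{\frac{n-1}{n}}/|B_2^{n-1}|\in(e^{-1/2},1)$. $L$ is infinitely smooth if its Minkowski functional $\|x\|_L=\min\{a\ge0:x\in aL\}$ restricted to $S^{n-1}$ is $C^\infty$. For a finite Borel measure $\nu$ on $S^{n-1}$ its spherical Radon transform acts on $C(S^{n-1})$ by $(R\nu,f)=\int_{S^{n-1}}Rf\,d\nu$, where $Rf(\xi)=\int_{S^{n-1}\cap\xi^\perp}f(x)\,dx$. An origin-symmetric star body $K$ is an intersection body if there is a finite non-negative Borel measure $\nu$ on $S^{n-1}$ with $\int_{S^{n-1}}\|x\|_K^{-1}f(x)\,dx=\int_{S^{n-1}}Rf(x)\,d\nu(x)$ for all $f\in C(S^{n-1})$ (equivalently, $\|\cdot\|_K^{-1}$ is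 a positive definite distribution on $\mathbb{R}^n$). *)

(* Defs.v *)
From HB Require Import structures.
From mathcomp Require Import all_boot all_order all_algebra.
From mathcomp Require Import all_classical all_reals all_analysis.
Set Implicit Arguments. Unset Strict Implicit. Unset Printing Implicit Defensive.
Import Order.TTheory GRing.Theory Num.Theory.
Import numFieldNormedType.Exports.
Local Open Scope classical_set_scope.
Local Open Scope ring_scope.

Section ConvexGeometry.
Context {R : realType}.

(* Euclidean structure on R^n = 'rV[R]_n (the library norm on 'rV is the
   max-norm; it induces the same topology and derivatives, but volumes,
   spheres and balls below use the Euclidean norm). *)
Definition dotv {n} (x y : 'rV[R]_n) : R := \sum_(i < n) x ord0 i * y ord0 i.
Definition enorm {n} (x : 'rV[R]_n) : R := Num.sqrt (dotv x x).
Definition sphere (n : nat) : set 'rV[R]_n := [set x | enorm x = 1].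
Definition eball (n : nat) : set 'rV[R]_n := [set x | enorm x <= 1].
Arguments sphere n : clear implicits.
Arguments eball n : clear implicits.

Definition box {n} (a b : 'rV[R]_n) : set 'rV[R]_n :=
  [set x | forall i, a ord0 i <= x ord0 i <= b ord0 i].
Definition boxvol {n} (a b : 'rV[R]_n) : R :=
  \prod_(i < n) Num.max 0 (b ord0 i - a ord0 i).
Definition vol (n : nat) (A : set 'rV[R]_n) : \bar R :=
  ereal_inf [set s | exists a b : nat -> 'rV[R]_n,
     A `<=` \bigcup_k box (a k) (b k) /\
     s = (\sum_(0 <= k <oo) (boxvol (a k) (b k))%:E)%E].

(* Lebesgue integral on R^n (layer-cake formula for the positive and
   negative parts). *)
Definition nnintegral (n : nat) (g : 'rV[R]_n -> R) : \bar R :=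
  (\int[@lebesgue_measure R]_(t in `]0%R, +oo[%classic) vol [set x | (t < g x)%R])%E.
Definition rintegral (n : nat) (g : 'rV[R]_n -> R) : \bar R :=
  (nnintegral (fun x => Num.max (g x) 0)%R - nnintegral (fun x => Num.max (- g x) 0)%R)%E.

(* Integral over the sphere S^{n-1} w.r.t. its surface measure, defined via
   the cone measure: int_{S^{n-1}} f = n * int_{0<|x|<=1} f(x/|x|) dx. *)
Definition sphint (n : nat) (f : 'rV[R]_n -> R) : \bar R :=
  (n%:R%:E * rintegral (fun x : 'rV[R]_n =>
      (if 0 < enorm x <= 1 then f ((enorm x)^-1 *: x) else 0)%R))%E.

(* U is an isometric parametrization of xi^perp by R^{n-1}:
   y |-> y *m U, the rows of U being orthonormal and orthogonal to xi. *)
Definition hyperplane_param (n : nat) (xi : 'rV[R]_n) (U : 'M[R]_(n.-1, n)) :=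
  U *m U^T = 1%:M /\ U *m xi^T = 0.

Definition section_vol (n : nat) (K : set 'rV[R]_n) (U : 'M[R]_(n.-1, n)) : \bar R :=
  vol [set y : 'rV[R]_(n.-1) | K (y *m U)].

Definition radon (n : nat) (f : 'rV[R]_n -> R) (xi : 'rV[R]_n) : \bar R :=
  sphint (fun y : 'rV[R]_(n.-1) =>
     f (y *m xget 0 [set U | hyperplane_param xi U])).

Definition mink (n : nat) (K : set 'rV[R]_n) (x : 'rV[R]_n) : R :=
  inf [set a : R | 0 <= a /\ exists y, K y /\ x = a *: y].

Definition convex_set (n : nat) (K : set 'rV[R]_n) :=
  forall x y (t : R), K x -> K y -> 0 <= t <= 1 -> K (t *: x + (1 - t) *: y).
Definition convex_body (n : nat) (K : set 'rV[R]_n) :=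
  [/\ compact K, convex_set K & K° !=set0].
Definition origin_symmetric (n : nat) (K : set 'rV[R]_n) :=
  forall x, K x -> K (- x).

Fixpoint iderive (n : nat) (vs : seq 'rV[R]_n) (g : 'rV[R]_n -> R) : 'rV[R]_n -> R :=
  match vs with
  | [::] => g
  | v :: vs' => fun x => derive (iderive vs' g) x v
  end.
Definition smooth_on (n : nat) (O : set 'rV[R]_n) (g : 'rV[R]_n -> R) :=
  forall (vs : seq 'rV[R]_n) x, O x ->
    {for x, continuous (iderive vs g)} /\ forall v, derivable (iderive vs g) x v.

(* ||.||_K restricted to S^{n-1} is C^infinity; equivalently (by
   1-homogeneity) ||.||_K is C^infinity on R^n \ {0}. *)
Definition infinitely_smooth (n : nat) (K : set 'rV[R]_n) :=
  smooth_on [set x | x != 0] (mink K).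

(* Strictly positive curvature of the boundary {||x||_K = 1}: the second
   fundamental form D^2 ||.||_K (x)[v,v] (up to the positive factor
   1/|grad ||.||_K (x)|) is positive definite on the tangent space
   {v : <grad ||.||_K(x), v> = 0}, i.e. all principal curvatures are > 0. *)
Definition strictly_positive_curvature (n : nat) (K : set 'rV[R]_n) :=
  forall x, mink K x = 1 -> forall v : 'rV[R]_n, v != 0 ->
    derive (mink K) x v = 0 ->
    0 < derive (fun z => derive (mink K) z v) x v.

Definition borelRn (n : nat) := g_sigma_algebraType (@open 'rV[R]_n).

Definition intersection_body (n : nat) (K : set 'rV[R]_n) :=
  exists nu : {finite_measure set borelRn n -> \bar R},
    nu (~` (sphere n : set (borelRn n))) = 0%E /\
    forall f : 'rV[R]_n -> R, {within sphere n, continuous f} ->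
      sphint (fun x => (mink K x)^-1 * f x) =
      (\int[nu]_(x in (sphere n : set (borelRn n))) radon f x)%E.

Definition c_n1 (n : nat) : R :=
  powR (fine (vol (eball n))) (n.-1%:R / n%:R) / fine (vol (eball n.-1)).

End ConvexGeometry.
Arguments sphere {R} n.
Arguments eball {R} n.

(* Main.v *)
(* Write [N] for the Minkowski functional of [L], [d] for the dimension and
   [om] for the area of the unit sphere in [xi^perp].  If every continuous [f]
   with [Rf >= 0] had [int f / N >= 0], then by Hahn-Banach and Riesz-Markov the
   functional [f |-> int f / N] would be [f |-> int Rf dnu] with [nu >= 0], so
   [L] would be an intersection body.  Hence some even positive continuous [f],
   close to [1], satisfies [Rf >= om] and [int f / N < int 1 / N].
   By positive curvature [N - c |.|] is still convex for some [c > 0], which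
   allows one to approximate [f N^d / om] from above by a homogeneous [w] such
   that [N + eps w] is again a norm for small [eps]; take for [K] its unit ball.
   To first order in [eps] the central sections decrease by
   [eps R(w N^-d) > eps], whereas the volume decreases by
   [eps int w N^-(d+1) < (eps / om) int 1 / N].  Hoelder's inequality, which is
   an equality for balls, bounds [int 1 / N] by
   [d |B^d|^((d-1)/d) |L|^(1/d)], and this is where [c_n1] comes from. *)
Require Import Defs.
From HB Require Import structures.
From mathcomp Require Import all_boot all_order all_algebra.
From mathcomp Require Import all_classical all_reals all_analysis.
From mathcomp Require Import measurable_realfun.
From mathcomp Require Import ring lra.
Set Implicit Arguments. Unset Strict Implicit. Unset Printing Implicit Defensive.
Import Order.TTheory GRing.Theory Num.Theory.
Import numFieldNormedType.Exports.
Local Open Scope classical_set_scope.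
Local Open Scope ring_scope.

(** * Outer measures and Borel sets *)

(** Three obstacles shape the details. [vol] is an infimum over box covers and all other integrals
    are built on it, so measurability, rotation invariance and polar coordinates are derived from
    covers; the same construction, with continuous functions in place of boxes, yields the
    Riesz-Markov measure. Rotation invariance matters because sections are measured in an arbitrary
    orthonormal frame while [radon] fixes one. The function [f] is merely continuous, so it cannot
    be added to a norm directly. However, [N + eps w] is convex for small [eps] as soon as
    [w + Lam N] is convex for some [Lam], and this property, with a common [Lam], is stable under
    suprema. Hence [w] is a supremum of explicit functions touching the target from above. Finally,
    the estimates must be uniform in [xi] and leave room for second-order terms. The gap between the
    integrals of [f / N] and [1 / N] pays for this: a part of it makes the first-order loss of every
    section exceed [eps] by a fixed proportion, another part covers the approximation error.
    Averaging [f] with its reflection makes it even, which gives the symmetry of [K]. *)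

Lemma nneseries_pair {R : realType} (a : nat -> nat -> \bar R) (f : nat -> nat * nat) g :
  (forall i j, (0 <= a i j)%E) -> cancel f g -> cancel g f ->
  (\sum_(0 <= k <oo) a (f k).1 (f k).2 = \sum_(0 <= i <oo) \sum_(0 <= j <oo) a i j)%E.
Proof.
move=> a0 fg gf; pose F := uncurry a.
have F0 x : (0 <= F x)%E by case: x => i j; exact: a0.
transitivity (\esum_(i in [set: nat * nat]) F i).
  have -> : [set: nat * nat] = f @` setT.
    by apply/seteqP; split => // x _; exists (g x).
  rewrite -fun_true esum_pred_image//; last by move=> x y _ _ /(can_inj fg).
  by apply: eq_eseriesr => k _; rewrite /F; case: (f k).
pose J : nat -> set (nat * nat) := fun i => [set (i, j) | j in setT].
rewrite (_ : setT = \bigcup_k J k); last first.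
  by rewrite predeqE => -[i j]; split => // _; exists i => //; exists j.
rewrite esum_bigcupT //=; last first.
  apply/trivIsetP => i j _ _ ij.
  rewrite predeqE => -[n m] /=; split => //= -[] [_] _ [<-{n} _].
  by move=> [m' _] [] /esym/eqP; rewrite (negbTE ij).
rewrite -(image_id [set: nat]) -fun_true esum_pred_image//; last first.
  by move=> n _; apply: esum_ge0.
apply: eq_eseriesr => /= j _.
rewrite -(esum_pred_image F (pair j) predT)//=.
  by congr esum; rewrite predeqE => -[i k]; split; move=> [l _ <-]; exists l.
by move=> ? ? _ _; exact: (@can_inj _ _ _ snd).
Qed.

Section cover_outer_measure.
Context {R : realType} {T I : Type}.
Variables (w : I -> \bar R) (Cov : set T -> (nat -> I) -> Prop).
Local Open Scope ereal_scope.

(** The common shape of two outer measures: [vol], where sets are covered by boxes, and the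
    Riesz-Markov outer measure, where they are covered by continuous functions. The notion of cover
    is kept abstract in [Cov], the price of a piece is [w]. *)
Definition cover_outer (A : set T) : \bar R :=
  ereal_inf [set s | exists c, Cov A c /\ s = \sum_(0 <= k <oo) w (c k)].

Hypothesis Cov_ge0 : forall A c k, Cov A c -> 0 <= w (c k).
Hypothesis Cov_sub : forall A B c, A `<=` B -> Cov B c -> Cov A c.
Hypothesis Cov0 : exists2 c, Cov set0 c & forall k, w (c k) = 0.
Hypothesis Cov_bigcup : forall (A : nat -> set T) (c : nat -> nat -> I)
    (f : nat -> nat * nat) (g : nat * nat -> nat), cancel f g -> cancel g f ->
  (forall j, Cov (A j) (c j)) ->
  Cov (\bigcup_j A j) (fun k => c (f k).1 (f k).2).

Lemma cover_outer_ge0 A : 0 <= cover_outer A.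
Proof.
apply: le_ereal_inf_tmp => _ [c [Ac ->]].
by apply: nneseries_ge0 => k _ _; exact: Cov_ge0 Ac.
Qed.

Lemma cover_outer0 : cover_outer set0 = 0.
Proof.
apply/eqP; rewrite eq_le cover_outer_ge0 andbT.
have [c c0 wc] := Cov0.
apply: ereal_inf_lbound; exists c; split => //.
by rewrite eseries0.
Qed.

Lemma le_cover_outer : {homo cover_outer : A B / A `<=` B >-> A <= B}.
Proof.
move=> A B AB; apply/ereal_inf_le_tmp => _ [c [Bc ->]].
by exists c; split => //; exact: Cov_sub Bc.
Qed.

(** Covers that are optimal up to [e / 2 ^ n.+1] for the [n]-th set are merged into a single cover
    along a bijection between [nat] and its square. *)
Lemma cover_outer_sigma_subadditive : sigma_subadditive cover_outer.
Proof.
move=> A; have [[i ioo]|] := pselect (exists i, cover_outer (A i) = +oo).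
  rewrite (eseries_pinfty _ _ ioo) ?leey// => n _.
  by rewrite -ltNye (lt_le_trans _ (cover_outer_ge0 _)).
rewrite -forallNE => Aoo.
suff add2e (e : {posnum R}) :
    cover_outer (\bigcup_n A n) <= \sum_(0 <= i <oo) cover_outer (A i) + e%:num%:E.
  by apply/lee_addgt0Pr => _/posnumP[].
rewrite (le_trans _ (epsilon_trick _ _ _))//; last first.
  by move=> n; exact: cover_outer_ge0.
pose P n c := Cov (A n) c /\
  \sum_(0 <= k <oo) w (c k) <= cover_outer (A n) + (e%:num / (2 ^ n.+1)%:R)%:E.
have [G PG] : {G : nat -> nat -> I & forall n, P n (G n)}.
  apply: (@choice _ _ P) => n; rewrite /P.
  have fA : cover_outer (A n) \is a fin_num.
    by rewrite ge0_fin_numE ?cover_outer_ge0// ltey; exact/eqP/Aoo.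
  have en1 : (0 < e%:num / (2 ^ n.+1)%:R)%R by [].
  have [x [c [Ac ->] xS]] := lb_ereal_inf_adherent en1 fA.
  by exists c; split => //; exact/ltW.
have wG_ge0 x : 0 <= (w \o uncurry G) x.
  by case: x => i j; exact: Cov_ge0 (PG i).1.
apply: (@le_trans _ _ (\sum_(0 <= i <oo) \sum_(0 <= j <oo ) w (G i j))).
  have /card_esym/ppcard_eqP[f0] := card_nat2.
  have [f [g [fg gf]]] : exists f g, cancel (f : nat -> nat * nat) g /\ cancel g f.
    exists f0, f0^-1%FUN; split => x.
      by rewrite funK ?inE.
    by rewrite invK ?inE.
  apply: ereal_inf_lbound => /=.
  exists (fun k => G (f k).1 (f k).2); split.
    by apply: (Cov_bigcup fg gf) => j; exact: (PG j).1.
  by rewrite (nneseries_pair (a := fun i j => w (G i j)) _ fg gf)// => i j; exact: (wG_ge0 (i, j)).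
apply: lee_nneseries => [i _ _|i _]; last exact: (PG i).2.
by apply: nneseries_ge0 => k _ _; exact: (wG_ge0 (i, k)).
Qed.

End cover_outer_measure.

(** Coordinate half-spaces generate the Borel sets, so the Caratheodory condition is checked on them
    alone. *)
Definition halfspace {R : realType} {n} (i : 'I_n) (c : R) : set 'rV[R]_n :=
  [set x | c < x ord0 i].

Section borel_halfspaces.
Context {R : realType} {n : nat}.
Let G := [set A : set 'rV[R]_n | exists i c, A = halfspace i c].

(** An open set is the union of the cubes with rational centre and radius [1 / (k + 1)] that it
    contains. The cubes are half-open so that they are intersections of half-spaces and complements
    of half-spaces; [F] replaces a cube that is not contained in [U] by the empty set. *)
Lemma open_sigma_halfspaces (U : set 'rV[R]_n) : open U -> <<s G >> U.
Proof.
have aux1 (a b d : R) : b - d < a -> a < b -> a - d < b <= a + d.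
  by move=> ? ?; apply/andP; split; lra.
have aux2 (a b d e c : R) : d < e / 2 -> 0 < d -> b - d < a -> a < b ->
    a - d < c -> c <= a + d -> - e < b - c < e.
  by move=> ? ? ? ? ? ?; apply/andP; split; lra.
move=> oU; pose T := g_sigma_algebraType G.
rewrite -[<<s G >> U]/(measurable (U : set T)).
pose cube (p : 'rV[rat]_n * nat) : set T :=
  [set x : 'rV[R]_n | forall i, ratr (p.1 ord0 i) - p.2.+1%:R^-1 < x ord0 i
                        <= ratr (p.1 ord0 i) + p.2.+1%:R^-1].
pose F p := if `[< cube p `<=` (U : set T) >] then cube p else set0.
have -> : (U : set T) = \bigcup_p F p.
  apply/seteqP; split => [x Ux|x [p _]]; last first.
    by rewrite /F; case: ifPn => [/asboolP/[apply]|//].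
  have /nbhs_ballP[e /= e0 xeU] := open_nbhs_nbhs (conj oU Ux).
  have [k ke] : exists k, 0 + k.+1%:R^-1 < e / 2 by apply: ltr_add_invr; rewrite divr_gt0.
  rewrite add0r in ke.
  have k0 : 0 < k.+1%:R^-1 :> R by rewrite invr_gt0.
  have /choice[q hq] : forall i, exists q, x ord0 i - k.+1%:R^-1 < ratr q < x ord0 i.
    move=> i.
    have [|q] := @rat_in_itvoo R (x ord0 i - k.+1%:R^-1) (x ord0 i).
      by rewrite ltrBlDr ltrDl.
    by rewrite in_itv/= => hq; exists q.
  have cx : cube (\row_i q i, k) x.
    move=> i; rewrite /= mxE; have /andP[] := hq i.
    exact: aux1.
  have cU : cube (\row_i q i, k) `<=` (U : set T).
    move=> y yc; apply: xeU; rewrite /ball/= /mx_ball/=; split => // i j.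
    rewrite ord1 /ball/=; have := yc j; rewrite /= mxE => /andP[].
    have /andP[] := hq j; rewrite ltr_norml; move: ke k0.
    exact: aux2.
  by exists (\row_i q i, k) => //; rewrite /F; case: asboolP.
apply: countable_bigcupT_measurable; first exact: countableP.
move=> p; rewrite /F; case: ifPn => // _.
pose A i : set T := (halfspace i (ratr (p.1 ord0 i) - p.2.+1%:R^-1) : set T) `&`
    ~` (halfspace i (ratr (p.1 ord0 i) + p.2.+1%:R^-1) : set T).
have -> : cube p = ~` \bigcup_i ~` A i.
  rewrite setC_bigcup; apply/seteqP; split => x.
    move=> xp i _; rewrite setCK; have /andP[? ?] := xp i; split => //.
    by rewrite /halfspace/=; apply/negP; rewrite -leNgt.
  move=> h i; have := h i Logic.I; rewrite setCK => -[h1].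
  by rewrite /halfspace/= => /negP; rewrite -leNgt => h2; exact/andP.
apply: measurableC; apply: countable_bigcupT_measurable => [|i]; first exact: countableP.
apply: measurableC.
apply: measurableI; last apply: measurableC.
  by apply: sub_sigma_algebra; exists i, (ratr (p.1 ord0 i) - p.2.+1%:R^-1).
by apply: sub_sigma_algebra; exists i, (ratr (p.1 ord0 i) + p.2.+1%:R^-1).
Qed.

Lemma borel_sub_sigma_algebra (M : set (set 'rV[R]_n)) :
  sigma_algebra setT M -> (forall i c, M (halfspace i c)) ->
  forall A : set (borelRn n), measurable A -> M A.
Proof.
move=> sM hM A; apply: smallest_sub => //= U /open_sigma_halfspaces; apply.
by split => //= _ [i [c ->]].
Qed.

End borel_halfspaces.

Section borel_restriction.
Context {R : realType} {n : nat} (mu : {outer_measure set 'rV[R]_n -> \bar R}).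
Hypothesis muH : forall i c, mu.-caratheodory (halfspace i c).

Lemma borel_caratheodory (A : set (borelRn n)) : measurable A -> mu.-caratheodory A.
Proof.
apply: borel_sub_sigma_algebra => //; split.
- exact: caratheodory_measurable_set0.
- by move=> B mB; rewrite setTD; exact: caratheodory_measurable_setC.
- exact: caratheodory_measurable_bigcup.
Qed.

Lemma borel_sigma_additive :
  semi_sigma_additive (mu : set (borelRn n) -> \bar R).
Proof.
move=> A mA tA mU.
apply: (@caratheodory_measure_sigma_additive R _ mu) => //.
  by move=> k; exact: borel_caratheodory (mA k).
exact: borel_caratheodory mU.
Qed.

End borel_restriction.

(** * Lebesgue measure on [R^n] *)

Section lebesgue_rV.
Context {R : realType}.
Implicit Types (n : nat).

Lemma boxvol_ge0 n (a b : 'rV[R]_n) : 0 <= boxvol a b.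
Proof. by apply: prodr_ge0 => i _; rewrite le_max lexx. Qed.

Definition box_cover n (A : set 'rV[R]_n) (c : nat -> 'rV[R]_n * 'rV[R]_n) :=
  A `<=` \bigcup_k box (c k).1 (c k).2.

Lemma vol_cover_outer n (A : set 'rV[R]_n) :
  vol A = cover_outer (fun p => (boxvol p.1 p.2)%:E) (@box_cover n) A.
Proof.
congr ereal_inf; apply/seteqP; split => [_ [a [b [Aab ->]]]|_ [c [Ac ->]]].
  by exists (fun k => (a k, b k)).
by exists (fun k => (c k).1), (fun k => (c k).2).
Qed.

Lemma vol_ge0 n (A : set 'rV[R]_n) : (0 <= vol A)%E.
Proof.
by rewrite vol_cover_outer; apply: cover_outer_ge0 => B c k _; rewrite lee_fin boxvol_ge0.
Qed.

Lemma le_vol n : {homo @vol R n : A B / A `<=` B >-> (A <= B)%E}.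
Proof.
by move=> A B AB; rewrite !vol_cover_outer; apply: le_cover_outer AB => A' B' c AB; apply: subset_trans.
Qed.

(** A degenerate box is free only when there is at least one coordinate: in dimension 0 every box
    has volume 1, being an empty product, and every sequence of boxes has total volume [+oo]. This
    is why the measure lives in dimension [n.+1]. *)
Lemma vol0 n : vol (set0 : set 'rV[R]_n.+1) = 0%E.
Proof.
rewrite vol_cover_outer; apply: cover_outer0.
  by move=> A c k _; rewrite lee_fin boxvol_ge0.
exists (fun=> (0, 0)) => // k /=; congr EFin; apply/eqP.
by rewrite /boxvol big_ord_recl mxE subrr maxxx mul0r.
Qed.

Lemma vol_sigma_subadditive n : sigma_subadditive (@vol R n).
Proof.
have -> : @vol R n = cover_outer (fun p => (boxvol p.1 p.2)%:E) (@box_cover n).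
  by apply/funext => A; rewrite vol_cover_outer.
apply: cover_outer_sigma_subadditive.
  by move=> A c k _; rewrite lee_fin boxvol_ge0.
move=> A c f g fg gf Ac x [j _ /Ac [i _ xb]]; exists (g (j, i)) => //=.
by rewrite gf.
Qed.

HB.instance Definition _ n := isOuterMeasure.Build R 'rV[R]_n.+1 (@vol R n.+1)
  (@vol0 n) (@vol_ge0 n.+1) (@le_vol n.+1) (@vol_sigma_subadditive n.+1).

Definition setc n (a : 'rV[R]_n) i v : 'rV[R]_n :=
  \row_j if j == i then v else a ord0 j.

(** The hyperplane where the [i]-th coordinate equals [c] cuts a box into two. The truncation at 0
    in [boxvol] makes this exact also when the hyperplane misses the box or the box is empty.
    Cutting every box of a cover in this way gives the Caratheodory condition for half-spaces. *)
Lemma boxvol_split n (a b : 'rV[R]_n) i c :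
  boxvol (setc a i (Num.max (a ord0 i) c)) b + boxvol a (setc b i (Num.min (b ord0 i) c))
  = boxvol a b.
Proof.
have aux (x y z : R) : Num.max 0 (y - Num.max x z) + Num.max 0 (Num.min y z - x)
    = Num.max 0 (y - x).
  by rewrite /Num.max /Num.min; repeat case: ifPn; rewrite -?leNgt => *; lra.
rewrite /boxvol (bigD1 i)//= [X in _ + X](bigD1 i)//= [RHS](bigD1 i)//=.
rewrite !mxE eqxx.
under eq_bigr => j ji do rewrite mxE (negbTE ji).
under [X in _ + _ * X]eq_bigr => j ji do rewrite mxE (negbTE ji).
rewrite -mulrDl; congr (_ * _).
exact: aux.
Qed.

Lemma halfspace_caratheodory n (i : 'I_n.+1) (c : R) :
  (@vol R n.+1).-caratheodory (halfspace i c).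
Proof.
apply: le_caratheodory_measurable => X.
rewrite [leRHS]vol_cover_outer; apply: le_ereal_inf_tmp => _ [p [Xp ->]].
pose p1 k := (setc (p k).1 i (Num.max ((p k).1 ord0 i) c), (p k).2).
pose p2 k := ((p k).1, setc (p k).2 i (Num.min ((p k).2 ord0 i) c)).
apply: (@le_trans _ _ (\sum_(0 <= k <oo) (boxvol (p1 k).1 (p1 k).2)%:E +
    \sum_(0 <= k <oo) (boxvol (p2 k).1 (p2 k).2)%:E)%E); last first.
  rewrite -nneseriesD//; last 2 first.
    by move=> *; rewrite lee_fin boxvol_ge0.
    by move=> *; rewrite lee_fin boxvol_ge0.
  apply: lee_nneseries => [k _ _|k _].
    by rewrite -EFinD lee_fin addr_ge0// boxvol_ge0.
  by rewrite -EFinD boxvol_split.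
apply: leeD; rewrite [leLHS]vol_cover_outer; apply: ereal_inf_lbound.
  exists p1; split => // x [/Xp[k _ xk] cx]; exists k => // j /=.
  rewrite mxE; case: eqP => [->|_]; last exact: xk.
  by rewrite ge_max; have /andP[-> ->] := xk i; rewrite (ltW cx).
exists p2; split => // x [/Xp[k _ xk] /negP cx]; exists k => // j /=.
rewrite mxE; case: eqP => [->|_]; last exact: xk.
by rewrite le_min; have /andP[-> ->] := xk i; rewrite /= leNgt.
Qed.

Definition leb n : set (borelRn n.+1) -> \bar R := @vol R n.+1.

HB.instance Definition _ n := isMeasure.Build _ (borelRn n.+1) R (@leb n)
  (@vol0 n) (@vol_ge0 n.+1) (borel_sigma_additive (@halfspace_caratheodory n)).

(** Induction on the dimension by integrating over the last coordinate [t]: the boxes whose last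
    side contains [t] cover the slice at [t]. The predicate [P] records which boxes are still in
    play, and coordinates are indexed by [nat] so that dropping the last one changes no type. The
    outcome is that [vol] of a box is not smaller than expected, hence that balls have positive
    volume. *)
Lemma slices_cover (n : nat) (c d : nat -> R) (a b : nat -> nat -> R) (P : nat -> bool) :
  (forall i, c i <= d i) ->
  (forall x : nat -> R, (forall i, (i < n)%N -> c i <= x i <= d i) ->
    exists2 k, P k & forall i, (i < n)%N -> a k i <= x i <= b k i) ->
  ((\prod_(i < n) (d i - c i))%:E <=
    \sum_(0 <= k <oo) ((P k)%:R * \prod_(i < n) Num.max 0 (b k i - a k i))%:E)%E.
Proof.
move=> cd; elim: n P => [|n IH] P H.
  rewrite big_ord0; have [k Pk _] := H c (fun i => ltac:(by [])).
  have F0 j : (0 <= ((P j)%:R * \prod_(i < 0) Num.max 0 (b j i - a j i))%:E :> \bar R)%E.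
    by rewrite big_ord0 mulr1 lee_fin.
  apply: le_trans (nneseries_lim_ge k.+1 _) => //.
  rewrite big_nat_recr//= Pk big_ord0 mulr1 leeDr//.
  by apply: sume_ge0 => j _; exact: F0.
pose v k : R := (P k)%:R * \prod_(i < n) Num.max 0 (b k i - a k i).
have v0 k : 0 <= v k.
  by rewrite mulr_ge0//; apply: prodr_ge0 => i _; rewrite le_max lexx.
pose f k (t : R) : \bar R := ((v k)%:E * (\1_(`[a k n, b k n]%classic) t)%:E)%E.
have f0 k t : (0 <= f k t)%E by rewrite mule_ge0// lee_fin.
have mf k (D : set R) : measurable D -> measurable_fun D (f k).
  move=> mD; apply: measurable_funeM; apply/measurable_EFinP.
  exact: measurable_indic.
have mI := @measurable_itv R `[c n, d n].
apply: (@le_trans _ _ (\int[@lebesgue_measure R]_(t in `[c n, d n]%classic)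
    (\prod_(i < n) (d i - c i))%:E)%E).
  rewrite integral_cst// big_ord_recr/= EFinM lebesgue_measure_itv/= lte_fin.
  have := cd n; rewrite le_eqVlt => /predU1P[->|->].
    by rewrite subrr ltxx !mule0.
  by [].
apply: (@le_trans _ _ (\int[@lebesgue_measure R]_(t in `[c n, d n]%classic)
    (\sum_(0 <= k <oo) f k t))%E).
  apply: ge0_le_integral => //.
  - move=> t _; rewrite lee_fin; apply: prodr_ge0 => i _.
    by rewrite subr_ge0.

  - by apply: ge0_emeasurable_sum => [k x _ _|k _]; [exact: f0|exact: mf].
  move=> t; rewrite /= in_itv/= => ct.
  have := IH (fun k => P k && (a k n <= t <= b k n)); apply: (fun A B C => le_trans (C A) B).
    move=> x hx; have [|k Pk hk] := H (fun i => if i == n then t else x i).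
      move=> i; rewrite ltnS leq_eqVlt; case: eqP => [->//|_ /=]; exact: hx.
    exists k; first by rewrite Pk; have := hk n (ltnSn _); rewrite eqxx.
    move=> i ni; have := hk i (ltnW ni); rewrite ifF//; apply/negbTE.
    by rewrite neq_ltn ni.
  apply: lee_nneseries => [k _ _|k _].
    by rewrite lee_fin mulr_ge0//; apply: prodr_ge0 => i _; rewrite le_max lexx.
  rewrite /f /v -EFinM lee_fin indicE mem_setE in_itv/= mulrAC -natrM mulnb.
  exact: lexx.
rewrite integral_nneseries//; last by move=> k; exact: mf.
apply: lee_nneseries => [k _ _|k _]; first exact: integral_ge0.
apply: (@le_trans _ _ (\int[@lebesgue_measure R]_t f k t)%E).
  by apply: ge0_subset_integral => //; exact: mf.
rewrite ge0_integralZl//; last 2 first.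
  by apply/measurable_EFinP; exact: measurable_indic.
  by rewrite lee_fin.
rewrite integral_indic// setIT [X in (_ * X)%E]lebesgue_measure_itv/= lte_fin.
rewrite big_ord_recr/= mulrA -/(v k).
case: ltP => ab.
  by rewrite -EFinM lee_fin ler_wpM2l// le_max lexx orbT.
by rewrite mule0 lee_fin mulr_ge0// le_max lexx.
Qed.

Lemma boxvol_le_vol n (a b : 'rV[R]_n.+1) : (forall i, a ord0 i <= b ord0 i) ->
  ((boxvol a b)%:E <= vol (box a b))%E.
Proof.
move=> ab; rewrite vol_cover_outer; apply: le_ereal_inf_tmp => _ [p [pc ->]].
pose ext (x : 'rV[R]_n.+1) (i : nat) := x ord0 (inord i).
have extE (x : 'rV[R]_n.+1) (i : 'I_n.+1) : ext x i = x ord0 i.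
  by rewrite /ext inord_val.
have := @slices_cover n.+1 (ext a) (ext b) (fun k => ext (p k).1)
   (fun k => ext (p k).2) xpredT.
have -> : \prod_(i < n.+1) (ext b i - ext a i) = boxvol a b.
  apply: eq_bigr => i _; rewrite !extE; apply/esym/max_idPr.
  by rewrite subr_ge0.
under eq_eseriesr => k _ do (rewrite mul1r; under eq_bigr do rewrite !extE).
apply => [i|x hx]; first exact: ab.
have [|k _ xk] := pc (\row_i x i).
  by move=> i; rewrite mxE; have := hx i (ltn_ord i); rewrite !extE.
exists k => // i ni; have := xk (Ordinal ni); rewrite mxE /=.
by rewrite -!extE.
Qed.

Lemma vol_box_le n (a b : 'rV[R]_n.+1) : (vol (box a b) <= (boxvol a b)%:E)%E.
Proof.
rewrite vol_cover_outer; apply: ereal_inf_lbound.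
exists (fun k => if k is 0%N then (a, b) else (0 : 'rV[R]_n.+1, 0 : 'rV[R]_n.+1)); split.
  by move=> x xab; exists 0%N.
rewrite nneseries_recl//; last first.
  by move=> [|k] _; rewrite lee_fin boxvol_ge0.
rewrite eseries0 ?adde0// => -[//|k] _ _ /=.
by rewrite /boxvol big_ord_recl mxE subrr maxxx mul0r.
Qed.

Lemma vol_homothety_le n (A : set 'rV[R]_n.+1) (s : R) (b : 'rV[R]_n.+1) : 0 < s ->
  ((s ^+ n.+1)%:E * vol [set x | A (s *: x + b)%R] <= vol A)%E.
Proof.
move=> s0; rewrite [leRHS]vol_cover_outer; apply: le_ereal_inf_tmp => _ [p [pc ->]].
pose q k := (s^-1 *: ((p k).1 - b), s^-1 *: ((p k).2 - b)).
have qc : box_cover [set x | A (s *: x + b)%R] q.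
  move=> x /pc[k _ xk]; exists k => // i /=; have := xk i; rewrite !mxE.
  by rewrite ler_pdivrMl// ler_pdivlMl// lerBlDr lerBrDr.
have -> : (\sum_(0 <= k <oo) (boxvol (p k).1 (p k).2)%:E =
    (s ^+ n.+1)%:E * \sum_(0 <= k <oo) (boxvol (q k).1 (q k).2)%:E)%E.
  rewrite -nneseriesZl; last by move=> *; rewrite lee_fin boxvol_ge0.
  apply: eq_eseriesr => k _; rewrite -EFinM; congr EFin.
  rewrite /boxvol -[X in s ^+ X]card_ord -prodr_const -big_split/=.
  apply: eq_bigr => i _; rewrite !mxE -mulrBr.
  rewrite maxr_pMr ?(ltW s0)// mulr0 mulrA mulfV ?gt_eqF// mul1r.
  by congr Num.max; ring.
rewrite lee_pmul2l ?lte_fin ?exprn_gt0//.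
by rewrite vol_cover_outer; apply: ereal_inf_lbound; exists q.
Qed.

Lemma vol_homothety n (A : set 'rV[R]_n.+1) (s : R) (b : 'rV[R]_n.+1) : 0 < s ->
  vol A = ((s ^+ n.+1)%:E * vol [set x | A (s *: x + b)%R])%E.
Proof.
move=> s0; apply/eqP; rewrite eq_le vol_homothety_le// andbT.
have s'0 : 0 < s^-1 by rewrite invr_gt0.
have := vol_homothety_le [set x | A (s *: x + b)%R] (- s^-1 *: b) s'0.
have -> : [set x | [set x | A (s *: x + b)%R] (s^-1 *: x + - s^-1 *: b)] = A.
  apply/seteqP; split => x /=; rewrite scalerDr !scalerA mulfV ?gt_eqF//;
  by rewrite mulrN mulfV ?gt_eqF// scale1r scaleN1r subrK.
move=> h; rewrite -(@lee_pmul2l _ ((s^-1) ^+ n.+1)%:E) ?lte_fin ?exprn_gt0//.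
rewrite muleA -EFinM -exprMn mulVf ?gt_eqF// expr1n mul1e.
exact: h.
Qed.

Lemma vol_translate n (A : set 'rV[R]_n.+1) (b : 'rV[R]_n.+1) :
  vol [set x | A (x + b)%R] = vol A.
Proof.
rewrite [RHS](@vol_homothety _ _ 1 b)// expr1n mul1e.
by congr vol; apply/seteqP; split => x /=; rewrite scale1r.
Qed.

Lemma vol_scale n (A : set 'rV[R]_n.+1) (s : R) : 0 < s ->
  vol [set x | A (s^-1 *: x)] = ((s ^+ n.+1)%:E * vol A)%E.
Proof.
move=> s0; rewrite [LHS](@vol_homothety _ _ s 0 s0); congr (_ * vol _)%E.
by apply/seteqP; split => x /=; rewrite addr0 scalerA mulVf ?gt_eqF// scale1r.
Qed.

Lemma vol_bounded n (A : set 'rV[R]_n.+1) (M : R) :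
  (forall x i, A x -> `|x ord0 i| <= M) -> (vol A < +oo)%E.
Proof.
move=> AM; apply: le_lt_trans (ltry (boxvol (const_mx (- M)) (const_mx M : 'rV[R]_n.+1))).
apply: le_trans (vol_box_le _ _); apply: le_vol => x Ax i.
by rewrite !mxE -ler_norml; exact: AM.
Qed.

Lemma continuous_borel_measurable n (D : set 'rV[R]_n) (f : 'rV[R]_n -> R) :
  open D -> (forall x, D x -> {for x, continuous f}) ->
  measurable_fun (D : set (borelRn n)) (f : borelRn n -> R).
Proof.
move=> oD cf mD; apply: (measurability _ (RGenOInfty.measurableE R)) => //.
move=> _ [_ [c ->] <-]; apply: sub_sigma_algebra.
rewrite /= openE => x [Dx]; rewrite /= in_itv/= andbT => cx.
rewrite /interior; apply: filterI; first exact: open_nbhs_nbhs.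
by near=> y; rewrite /= in_itv/= andbT; near: y; exact: (cvgr_gt _ (cf x Dx)).
Unshelve. all: by end_near. Qed.

Lemma measurable_coord n (i : 'I_n) :
  measurable_fun setT (fun x : borelRn n => (x : 'rV[R]_n) ord0 i).
Proof.
by apply: continuous_borel_measurable => [|x _]; [exact: openT|exact: coord_continuous].
Qed.

Lemma leb_sigma_finite n : sigma_finite setT (@leb n).
Proof.
exists (fun k => box (const_mx (- k%:R)) (const_mx (k%:R : R))).
  apply/esym; apply/seteqP; split => // x _.
  have [k hk] : exists k : nat, forall i, `|x ord0 i| <= k%:R.
    exists (\max_i Num.truncn (`|x ord0 i| + 1)) => i.
    apply: (@le_trans _ _ (Num.truncn (`|x ord0 i| + 1))%:R).
      rewrite -(lerD2r 1) natr1; exact/ltW/truncnS_gt.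
    by rewrite ler_nat; exact: leq_bigmax.
  by exists k => // i; rewrite !mxE -ler_norml.
move=> k; split.
  have -> : box (const_mx (- k%:R)) (const_mx k%:R) = ~` \bigcup_(i : 'I_n.+1)
     ~` [set x : @borelRn R n.+1 | - k%:R <= x ord0 i <= k%:R].
    rewrite setC_bigcup; apply/seteqP; split => x /=.
      by move=> h i _; rewrite setCK /=; have := h i; rewrite !mxE.
    by move=> h i; rewrite !mxE; have := h i Logic.I; rewrite setCK.
  apply: measurableC; apply: countable_bigcupT_measurable => [|i]; first exact: countableP.
  apply: measurableC.
  have -> : [set x : @borelRn R n.+1 | - k%:R <= x ord0 i <= k%:R] =
      setT `&` (fun x : @borelRn R n.+1 => (x : 'rV[R]_n.+1) ord0 i) @^-1` `[- k%:R, k%:R].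
    by apply/seteqP; split => x; rewrite /= in_itv/=; [|case].
  exact: measurable_coord.
apply: (@vol_bounded _ _ k%:R) => x i hx; have := hx i.
by rewrite !mxE -ler_norml.
Qed.

End lebesgue_rV.

(** * Euclidean geometry and rotation invariance *)

Section euclidean.
Context {R : realType} {n : nat}.
Implicit Types (x y z : 'rV[R]_n) (a : R).

Lemma dotvE x y : dotv x y = (x *m y^T) ord0 ord0.
Proof. by rewrite mxE; apply: eq_bigr => i _; rewrite mxE. Qed.

Lemma dotvC x y : dotv x y = dotv y x.
Proof. by apply: eq_bigr => i _; rewrite mulrC. Qed.

Lemma dotvDl x y z : dotv (x + y) z = dotv x z + dotv y z.
Proof. by rewrite !dotvE mulmxDl mxE. Qed.

Lemma dotvDr x y z : dotv x (y + z) = dotv x y + dotv x z.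
Proof. by rewrite dotvC dotvDl !(dotvC x). Qed.

Lemma dotvZl a x y : dotv (a *: x) y = a * dotv x y.
Proof. by rewrite !dotvE -scalemxAl mxE. Qed.

Lemma dotvZr a x y : dotv x (a *: y) = a * dotv x y.
Proof. by rewrite dotvC dotvZl dotvC. Qed.

Lemma dotvNl x y : dotv (- x) y = - dotv x y.
Proof. by rewrite -scaleN1r dotvZl mulN1r. Qed.

Lemma dotvNr x y : dotv x (- y) = - dotv x y.
Proof. by rewrite dotvC dotvNl dotvC. Qed.

Lemma dotv0l x : dotv 0 x = 0.
Proof. by rewrite -[0](scale0r x) dotvZl mul0r. Qed.

Lemma dotvv_ge0 x : 0 <= dotv x x.
Proof. by apply: sumr_ge0 => i _; rewrite -expr2 sqr_ge0. Qed.

Lemma dotvv_eq0 x : (dotv x x == 0) = (x == 0).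
Proof.
apply/eqP/eqP => [|->]; last by rewrite dotv0l.
move/eqP; rewrite psumr_eq0 => [/allP h|i _]; last by rewrite -expr2 sqr_ge0.
apply/rowP => i; rewrite mxE; have /implyP/(_ isT) := h i (mem_index_enum i).
by rewrite -expr2 sqrf_eq0 => /eqP.
Qed.

Lemma sqr_enorm x : enorm x ^+ 2 = dotv x x.
Proof. by rewrite sqr_sqrtr// dotvv_ge0. Qed.

Lemma enorm_ge0 x : 0 <= enorm x.
Proof. exact: sqrtr_ge0. Qed.

Lemma enorm_eq0 x : (enorm x == 0) = (x == 0).
Proof. by rewrite -[LHS]sqrf_eq0 sqr_enorm dotvv_eq0. Qed.

Lemma enorm0 : enorm (0 : 'rV[R]_n) = 0.
Proof. by apply/eqP; rewrite enorm_eq0. Qed.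

Lemma enorm_gt0 x : (0 < enorm x) = (x != 0).
Proof. by rewrite lt_def enorm_ge0 enorm_eq0 andbT. Qed.

Lemma enormZ a x : enorm (a *: x) = `|a| * enorm x.
Proof.
by rewrite /enorm dotvZl dotvZr mulrA -expr2 sqrtrM ?sqr_ge0// sqrtr_sqr.
Qed.

Lemma enormN x : enorm (- x) = enorm x.
Proof. by rewrite -scaleN1r enormZ normrN1 mul1r. Qed.

Lemma enorm_normalize x : x != 0 -> enorm ((enorm x)^-1 *: x) = 1.
Proof.
move=> x0; rewrite enormZ ger0_norm ?invr_ge0 ?enorm_ge0//.
by rewrite mulVf// enorm_eq0.
Qed.

Lemma cauchy_schwarz x y : `|dotv x y| <= enorm x * enorm y.
Proof.
rewrite -(@ler_pXn2r _ 2) ?nnegrE ?mulr_ge0 ?enorm_ge0//.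
rewrite real_normK ?num_real// exprMn !sqr_enorm.
have [->|y0] := eqVneq y 0; first by rewrite dotvC !dotv0l expr0n mulr0.
have yy : 0 < dotv y y by rewrite lt_def dotvv_eq0 y0 dotvv_ge0.
have := dotvv_ge0 (dotv y y *: x - dotv x y *: y).
rewrite !(dotvDl, dotvDr, dotvNl, dotvNr, dotvZl, dotvZr) (dotvC y x).
set A := dotv x x; set B := dotv x y; set C := dotv y y.
rewrite (_ : (_ + _ = C * (A * C - B ^+ 2))%R); last by ring.
by rewrite pmulr_rge0// subr_ge0.
Qed.

Lemma enorm_triangle x y : enorm (x + y) <= enorm x + enorm y.
Proof.
rewrite -(@ler_pXn2r _ 2) ?nnegrE ?addr_ge0 ?enorm_ge0//.
rewrite sqr_enorm sqrrD !sqr_enorm !(dotvDl, dotvDr) (dotvC y x).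
have := le_trans (ler_norm _) (cauchy_schwarz x y).
move: (dotv x x) (dotv y y) (dotv x y) (enorm x * enorm y) => a b c d; lra.
Qed.

Lemma coord_le_enorm x i : `|x ord0 i| <= enorm x.
Proof.
rewrite -(@ler_pXn2r _ 2) ?nnegrE ?enorm_ge0// sqr_enorm real_normK ?num_real//.
rewrite /dotv (bigD1 i)//= -expr2 lerDl.
by apply: sumr_ge0 => j _; rewrite -expr2 sqr_ge0.
Qed.

Lemma coord_le_norm x i : `|x ord0 i| <= `|x|.
Proof.
rewrite -[leRHS]/(mx_norm x) mx_normrE.
exact: (le_bigmax _ (fun ij => `|x ij.1 ij.2|) (ord0, i)).
Qed.

Lemma enorm_le_norm x : enorm x <= n%:R * `|x|.
Proof.
rewrite -(@ler_pXn2r _ 2) ?nnegrE ?enorm_ge0 ?mulr_ge0// sqr_enorm.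
apply: (@le_trans _ _ (\sum_(i < n) `|x| ^+ 2)).
  apply: ler_sum => i _; rewrite -expr2 -real_normK ?num_real//.
  by rewrite ler_pXn2r ?nnegrE// coord_le_norm.
rewrite sumr_const card_ord exprMn -[leLHS]mulr_natl ler_wpM2r ?sqr_ge0//.
by rewrite -natrX ler_nat; case: (n) => // m; rewrite expnS expn1 leq_pmulr.
Qed.

Lemma norm_le_enorm x : `|x| <= enorm x.
Proof.
rewrite -[leLHS]/(mx_norm x) mx_normrE.
by apply: bigmax_le => [|[i j] _]; rewrite ?enorm_ge0//= ord1 coord_le_enorm.
Qed.

Lemma continuous_sumr m (V : normedModType R) (T : topologicalType)
    (F : 'I_m -> T -> V) (x : T) :
  (forall i, {for x, continuous (F i)}) ->
  {for x, continuous (fun t => \sum_(i < m) F i t)}.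
Proof.
move=> cF; apply: cvg_big => [|i _]; first exact: add_continuous.
exact: cF.
Qed.

Lemma dotv_continuous2 : continuous (fun p : 'rV[R]_n * 'rV[R]_n => dotv p.1 p.2).
Proof.
move=> p; apply: continuous_sumr => i; apply: continuousM.
  apply: (@continuous_comp _ _ _ fst (fun x : 'rV[R]_n => x ord0 i)).
    exact: cvg_fst.
  exact: coord_continuous.
apply: (@continuous_comp _ _ _ snd (fun x : 'rV[R]_n => x ord0 i)).
  exact: cvg_snd.
exact: coord_continuous.
Qed.

Lemma enorm_continuous : continuous (@enorm R n).
Proof.
move=> x; apply: (@continuous_comp _ _ _ (fun x => dotv x x) Num.sqrt).
  by apply: continuous_sumr => i; apply: continuousM; exact: coord_continuous.
exact: sqrt_continuous.
Qed.

Lemma normalize_continuous x : x != 0 ->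
  {for x, continuous (fun y : 'rV[R]_n => (enorm y)^-1 *: y)}.
Proof.
move=> x0; apply: continuousZ; last exact: cvg_id.
by apply: continuousV; [rewrite enorm_eq0|exact: enorm_continuous].
Qed.

Lemma sphere_neq0 x : sphere n x -> x != 0.
Proof. by move=> xS; rewrite -enorm_eq0 xS oner_eq0. Qed.

Lemma sphere_normalize x : x != 0 -> sphere n ((enorm x)^-1 *: x).
Proof. exact: enorm_normalize. Qed.

Lemma sphere_compact : compact (@sphere R n).
Proof.
apply: bounded_closed_compact.
  exists 1; split => // M M1 x xS; apply: le_trans (norm_le_enorm x) _.
  by rewrite xS ltW.
have -> : @sphere R n = @enorm R n @^-1` [set 1] by [].
by apply: closed_comp => [x _|]; [exact: enorm_continuous|exact: closed_eq].
Qed.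

Lemma open_neq0 : open [set x : 'rV[R]_n | x != 0].
Proof.
have -> : [set x : 'rV[R]_n | x != 0] = @enorm R n @^-1` [set r | 0 < r].
  by apply/seteqP; split => x /=; rewrite enorm_gt0.
by apply: open_comp => [x _|]; [exact: enorm_continuous|exact: open_gt].
Qed.

Lemma mulmx_continuous m (U : 'M[R]_(m, n)) : continuous (fun x : 'rV[R]_m => x *m U).
Proof.
have -> : (fun x : 'rV[R]_m => x *m U) = (fun t => \sum_i t ord0 i *: row i U).
  by apply/funext => x; exact: mulmx_sum_row.
move=> x; apply: continuous_sumr => i.
by apply: continuousZ; [exact: coord_continuous|exact: cst_continuous].
Qed.

End euclidean.

Section orthogonal.
Context {R : realType}.

Lemma dotv_isometry m n (U : 'M[R]_(m, n)) (x y : 'rV[R]_m) :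
  U *m U^T = 1%:M -> dotv (x *m U) (y *m U) = dotv x y.
Proof.
by move=> UU; rewrite !dotvE trmx_mul mulmxA -(mulmxA x) UU mulmx1.
Qed.

Lemma enorm_isometry m n (U : 'M[R]_(m, n)) (x : 'rV[R]_m) :
  U *m U^T = 1%:M -> enorm (x *m U) = enorm x.
Proof. by move=> UU; rewrite /enorm dotv_isometry. Qed.

Lemma mulmx_isometry_neq0 m n (U : 'M[R]_(m, n)) (x : 'rV[R]_m) :
  U *m U^T = 1%:M -> x != 0 -> x *m U != 0.
Proof. by move=> UU; rewrite -!enorm_gt0 enorm_isometry. Qed.

End orthogonal.

Section borel_coordinates.
Context {R : realType}.

(** This serves maps defined on a product of Borel spaces, which carries the product sigma-algebra:
    their measurability is checked coordinate by coordinate instead of through continuity. *)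
Lemma measurable_fun_borelRn d (T : measurableType d) n (D : set T)
    (g : T -> borelRn n) :
  (forall i, measurable_fun D (fun t => (g t : 'rV[R]_n) ord0 i)) ->
  measurable_fun D g.
Proof.
move=> mg mD.
have E : @measurable _ (@borelRn R n) =
    <<s [set A : set 'rV[R]_n | exists i c, A = halfspace i c] >>.
  apply/seteqP; split.
    by apply: borel_sub_sigma_algebra; [exact: smallest_sigma_algebra|move=> i c; apply: sub_sigma_algebra; exists i, c].
  apply: smallest_sub; first exact: smallest_sigma_algebra.
  move=> _ [i [c ->]]; apply: sub_sigma_algebra.
  have -> : halfspace i c = (fun x : 'rV[R]_n => x ord0 i) @^-1` [set y | c < y] by [].
  by apply: open_comp => [x _|]; [exact: coord_continuous|exact: open_gt].
apply: (measurability _ E) => // _ [_ [i [c ->]] <-].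
have -> : g @^-1` halfspace i c = (fun t => (g t : 'rV[R]_n) ord0 i) @^-1` `]c, +oo[.
  by apply/seteqP; split => t; rewrite /= in_itv/= andbT.
exact: mg.
Qed.

End borel_coordinates.

Section rotation.
Context {R : realType} {n : nat}.
Local Notation leb := (@leb R n).
Local Notation T := (@borelRn R n.+1).

HB.instance Definition _ := @Measure_isSigmaFinite.Build _ T R leb (@leb_sigma_finite R n).

Lemma tonelli_sections d1 d2 (T1 : measurableType d1) (T2 : measurableType d2)
    (m1 : {sigma_finite_measure set T1 -> \bar R})
    (m2 : {sigma_finite_measure set T2 -> \bar R}) (W : set (T1 * T2)) :
  measurable W ->
  (\int[m1]_x m2 (xsection W x) = \int[m2]_y m1 (ysection W y))%E.
Proof.
move=> mW; have := indic_fubini_tonelli m1 m2 mW.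
by rewrite indic_fubini_tonelli_FE// indic_fubini_tonelli_GE.
Qed.

Lemma eball_measurable : measurable (@eball R n.+1 : set T).
Proof.
have -> : (@eball R n.+1 : set T) = setT `&` (@enorm R n.+1 : T -> R) @^-1` `]-oo, 1].
  by apply/seteqP; split => x; rewrite /= in_itv/=; [|case].
apply: (continuous_borel_measurable openT) => // x _.
exact: enorm_continuous.
Qed.

Lemma vol_eball_lty : (vol (@eball R n.+1) < +oo)%E.
Proof.
apply: (@vol_bounded _ _ _ 1) => x i x1; exact: le_trans (coord_le_enorm x i) x1.
Qed.

Lemma vol_eball_gt0 : (0 < vol (@eball R n.+1))%E.
Proof.
pose c : R := n.+1%:R^-1; have c0 : 0 < c by rewrite invr_gt0.
apply: (@lt_le_trans _ _ (boxvol (const_mx 0) (const_mx c : 'rV[R]_n.+1))%:E).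
  rewrite lte_fin /boxvol; apply: prodr_gt0 => i _.
  by rewrite !mxE subr0 lt_max c0 orbT.
apply: le_trans (boxvol_le_vol _) _ => [i|]; first by rewrite !mxE ltW.
apply: le_vol => x xc; rewrite /eball/= (le_trans (enorm_le_norm x))//.
rewrite mulrC -ler_pdivlMr// div1r -[leLHS]/(mx_norm x) mx_normrE.
apply: bigmax_le => [|[i j] _] /=; first exact: ltW.
rewrite ord1; have := xc j; rewrite !mxE => /andP[h1 h2].
by rewrite ger0_norm.
Qed.

Lemma measurable_mulmx_rV (Q : 'M[R]_n.+1) :
  measurable_fun setT (fun x : T => (x : 'rV[R]_n.+1) *m Q : T).
Proof.
apply: measurable_fun_borelRn => i; apply: (continuous_borel_measurable openT) => // x _.
apply: (@continuous_comp _ _ _ (fun x : 'rV[R]_n.+1 => x *m Q) (fun x : 'rV[R]_n.+1 => x ord0 i)).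
  exact: mulmx_continuous.
exact: coord_continuous.
Qed.

(* Applied to [x + yQ in A, x in B] and [x in A, x - yQ in B], Tonelli gives
   [vol B * vol (A Q^-1) = vol A * vol B] because the ball [B] is rotation invariant. *)
Lemma vol_rotation (Q : 'M[R]_n.+1) (A : set 'rV[R]_n.+1) :
  Q *m Q^T = 1%:M -> measurable (A : set T) ->
  vol [set x | A (x *m Q)] = vol A.
Proof.
move=> QQ mA; have QQ' : Q^T *m Q = 1%:M by exact: mulmx1C.
pose B : set T := @eball R n.+1.
have mB : measurable B := eball_measurable.
pose f1 (p : T * T) : T := (p.1 : 'rV[R]_n.+1) + (p.2 : 'rV[R]_n.+1) *m Q.
pose f2 (p : T * T) : T := (p.1 : 'rV[R]_n.+1) - (p.2 : 'rV[R]_n.+1) *m Q.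
have mc1 i : measurable_fun setT (fun p : T * T => (p.1 : 'rV[R]_n.+1) ord0 i).
  exact: (measurableT_comp (@measurable_coord R n.+1 i) measurable_fst).
have mc2 i : measurable_fun setT (fun p : T * T => ((p.2 : 'rV[R]_n.+1) *m Q) ord0 i).
  apply: (measurableT_comp (@measurable_coord R n.+1 i)).
  exact: (measurableT_comp (measurable_mulmx_rV Q) measurable_snd).
have mf1 : measurable_fun setT f1.
  apply: measurable_fun_borelRn => i; rewrite /f1.
  under eq_fun do rewrite mxE.
  exact: measurable_funD.
have mf2 : measurable_fun setT f2.
  apply: measurable_fun_borelRn => i; rewrite /f2.
  under eq_fun do rewrite mxE [X in _ + X]mxE.
  exact: measurable_funB.
pose W1 : set (T * T) := (setT `&` fst @^-1` B) `&` (setT `&` f1 @^-1` A).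
pose W2 : set (T * T) := (setT `&` fst @^-1` A) `&` (setT `&` f2 @^-1` B).
have mW1 : measurable W1 by apply: measurableI; [exact: measurable_fst|exact: mf1].
have mW2 : measurable W2 by apply: measurableI; [exact: measurable_fst|exact: mf2].
have cst_int (C : set T) (k : \bar R) (F : T -> \bar R) : measurable C ->
    (forall x, C x -> F x = k) -> (forall x, ~ C x -> F x = 0%E) ->
    (\int[leb]_x F x = k * leb C)%E.
  move=> mC F1 F0; rewrite -integral_cst// [RHS]integral_mkcond.
  apply: eq_integral => x _; rewrite patchE; case: ifPn => xC.
    by rewrite F1//; exact: set_mem.
  by rewrite F0// => Cx; move: xC; rewrite mem_set.
have E1 : (\int[leb]_x leb (xsection W1 x) = vol [set x | A (x *m Q)] * vol B)%E.
  apply: cst_int => // x Bx.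
    rewrite -[RHS](vol_translate _ (x *m Q^T)) /leb; congr vol.
    apply/seteqP; split => y; rewrite /xsection/= ?in_setE /W1 /= /f1/= mulmxDl -mulmxA QQ' mulmx1 addrC.
      by move=> [[]] _ _ [].
    by move=> ?; do ?split.
  rewrite (_ : xsection _ _ = set0) ?measure0//.
  by apply/seteqP; split => y //; rewrite /xsection/= in_setE => -[[]].
have E2 : (\int[leb]_x leb (xsection W2 x) = vol B * vol A)%E.
  apply: cst_int => // x Ax; last first.
    rewrite (_ : xsection _ _ = set0) ?measure0//.
    by apply/seteqP; split => y //; rewrite /xsection/= in_setE => -[[]].
  rewrite -[RHS](vol_translate _ (- (x *m Q^T))) /leb; congr vol.
  have key y : enorm (y - x *m Q^T) = enorm (x - y *m Q).
    rewrite -(enorm_isometry _ QQ) mulmxBl -mulmxA QQ' mulmx1.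
    by rewrite -enormN opprB.
  apply/seteqP; split => y; rewrite /xsection/= ?in_setE /W2 /= /f2 /B /eball /=.
    by rewrite key => -[[]] _ _ [].
  by rewrite key => ?; do ?split.
have E3 y : leb (ysection W1 y) = leb (ysection W2 y).
  rewrite /leb -[RHS](vol_translate _ ((y : 'rV[R]_n.+1) *m Q)); congr vol.
  apply/seteqP; split => x; rewrite /ysection/= !in_setE /W1 /W2 /f1 /f2/= addrK;
    by move=> [[]] _ ? [] _ ?.
have := tonelli_sections leb leb mW1.
have -> : (\int[leb]_y leb (ysection W1 y) = \int[leb]_y leb (ysection W2 y))%E.
  by apply: eq_integral => y _; exact: E3.
rewrite -tonelli_sections// E1 E2 muleC => /eqP.
have fB : vol B \is a fin_num by rewrite ge0_fin_numE ?vol_ge0 ?vol_eball_lty.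
by rewrite eq_le !lee_pmul2l ?vol_eball_gt0// -eq_le => /eqP.
Qed.

(** Tonelli on the region below the graph of [g]: its sections at fixed height are the superlevel
    sets of the layer-cake formula, its sections at fixed [x] are the intervals from 0 to [g x]. *)
Lemma nnintegralE (g : 'rV[R]_n.+1 -> R) : (forall x, 0 <= g x) ->
  measurable_fun setT (g : T -> R) ->
  nnintegral g = (\int[leb]_x (g x)%:E)%E.
Proof.
move=> g0 mg.
pose W : set (R * T) := [set p | 0 < p.1 < g p.2].
have mW : measurable W.
  have -> : W = (setT `&` fst @^-1` `]0, +oo[) `&`
      (setT `&` (fun p : R * T => g p.2 - p.1) @^-1` `]0, +oo[).
    apply/seteqP; split => -[t x]; rewrite /W/= !in_itv/= !andbT subr_gt0.
      by move=> /andP[].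
    by move=> [[_ ->] [_ ->]].
  apply: measurableI; first exact: measurable_fst.
  suff : measurable_fun setT (fun p : R * T => g p.2 - p.1) by apply.
  apply: measurable_funB; last exact: measurable_fst.
  exact: (measurableT_comp mg measurable_snd).
have := tonelli_sections (@lebesgue_measure R) leb mW.
have -> : (\int[@lebesgue_measure R]_t leb (xsection W t))%E = nnintegral g.
  rewrite /nnintegral [RHS]integral_mkcond; apply: eq_integral => t _.
  rewrite patchE; case: ifPn => t0.
    move: t0; rewrite inE/= in_itv/= andbT => t0; rewrite /leb; congr vol.
    by apply/seteqP; split => x; rewrite /xsection/= in_setE /W/= t0.
  rewrite (_ : xsection _ _ = set0) ?measure0//.
  apply/seteqP; split => x //; rewrite /xsection/= in_setE /W/= => /andP[h _].
  by move: t0; rewrite notin_setE/= in_itv/= h.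
move=> ->; apply: eq_integral => x _.
have -> : ysection W x = `]0, g x[%classic.
  by apply/seteqP; split => t; rewrite /ysection/= in_itv/= in_setE.
rewrite [LHS]lebesgue_measure_itv/= lte_fin; case: ltP => // h.
  by rewrite oppr0 adde0.
by have -> : g x = 0 by apply/eqP; rewrite eq_le h g0.
Qed.

End rotation.

(** * Integration over the sphere *)

Section sphere_continuity.
Context {R : realType} {n : nat}.
Implicit Types f g : 'rV[R]_n -> R.

Definition scont f := {within @sphere R n, continuous f}.

Lemma scontP f :
  scont f <-> (forall x, sphere n x -> f @ within (sphere n) (nbhs x) --> f x).
Proof. exact: (@subspace_continuousP _ (@sphere R n) _ f). Qed.

Definition nrm (x : 'rV[R]_n) := (enorm x)^-1 *: x.

Lemma nrm_id x : sphere n x -> nrm x = x.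
Proof. by rewrite /nrm => ->; rewrite invr1 scale1r. Qed.

Lemma nrmZ a x : 0 < a -> nrm (a *: x) = nrm x.
Proof.
move=> a0; rewrite /nrm enormZ gtr0_norm// scalerA invfM.
by rewrite mulrAC mulVf ?gt_eqF// mul1r.
Qed.

Lemma scont_at f : (forall x, sphere n x -> {for x, continuous f}) -> scont f.
Proof.
by move=> cf; apply/scontP => x Sx; apply: cvg_within_filter; exact: cf.
Qed.

Lemma eq_scont f g : (forall x, sphere n x -> f x = g x) -> scont f -> scont g.
Proof.
move=> fg /scontP cf; apply/scontP => x Sx.
rewrite -fg//; apply: cvg_trans (cf x Sx); apply: near_eq_cvg.
by rewrite near_withinE; near=> y => Sy; exact: fg.
Unshelve. all: by end_near. Qed.

(** Functions that are continuous on the sphere become integrands on the punctured space through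
    their extension constant along rays. *)
Lemma scont_nrm f x : scont f -> x != 0 -> {for x, continuous (fun y => f (nrm y))}.
Proof.
move=> /scontP cf x0.
have /cf h : sphere n (nrm x) by exact: sphere_normalize.
apply: (@cvg_comp _ _ _ nrm f (nbhs x) (within (sphere n) (nbhs (nrm x)))); last exact: h.
move=> A; rewrite /within/= => nA.
have := normalize_continuous x0; rewrite /continuous_at => /(_ _ nA).
have : \forall y \near x, y != 0 by apply: open_nbhs_nbhs; split => //; exact: open_neq0.
apply: filterS2 => y y0; apply; exact: sphere_normalize.
Qed.

Lemma scont_cst c : scont (fun=> c).
Proof. by apply: scont_at => x _; exact: cst_continuous. Qed.

Lemma scontD f g : scont f -> scont g -> scont (fun x => f x + g x).
Proof. by move=> cf cg x; apply: continuousD; [exact: cf|exact: cg]. Qed.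

Lemma scontM f g : scont f -> scont g -> scont (fun x => f x * g x).
Proof. by move=> cf cg x; apply: continuousM; [exact: cf|exact: cg]. Qed.

Lemma scontX f k : scont f -> scont (fun x => f x ^+ k).
Proof.
move=> cf; elim: k => [|k IH]; first by under eq_fun do rewrite expr0; exact: scont_cst.
by under eq_fun do rewrite exprS; exact: scontM.
Qed.

Lemma scont_max f g : scont f -> scont g -> scont (fun x => Num.max (f x) (g x)).
Proof. by move=> cf cg x; apply: continuous_max; [exact: cf|exact: cg]. Qed.

Lemma scont_min f g : scont f -> scont g -> scont (fun x => Num.min (f x) (g x)).
Proof. by move=> cf cg x; apply: continuous_min; [exact: cf|exact: cg]. Qed.

Lemma scont_sum m (F : 'I_m -> 'rV[R]_n -> R) : (forall i, scont (F i)) ->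
  scont (fun x => \sum_i F i x).
Proof. by move=> cF x; apply: (@continuous_sumr R m) => i; exact: cF. Qed.

Lemma scontV f : (forall x, sphere n x -> f x != 0) -> scont f ->
  scont (fun x => (f x)^-1).
Proof.
move=> f0 /scontP cf; apply/scontP => x Sx.
by apply: cvgV; [exact: f0|exact: cf].
Qed.

Lemma scont_bounded f : scont f -> exists2 M, 0 < M & forall x, sphere n x -> `|f x| <= M.
Proof.
move=> cf; have := continuous_compact cf (@sphere_compact R n).
move=> /compact_bounded[M [_ HM]].
exists (`|M| + 1); first by rewrite ltr_wpDl.
move=> x Sx; apply: HM; last by exists x.
by rewrite (le_lt_trans (ler_norm M))// ltrDl.
Qed.

Lemma scont_ubound f : scont f -> exists2 M, 0 < M & forall x, sphere n x -> f x <= M.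
Proof.
by move=> /scont_bounded[M M0 HM]; exists M => // x /HM; exact: le_trans (ler_norm _).
Qed.

Lemma scont_pos_lbound f : scont f -> (forall x, sphere n x -> 0 < f x) ->
  exists2 m, 0 < m & forall x, sphere n x -> m <= f x.
Proof.
move=> cf f0; have [M M0 HM] : exists2 M, 0 < M & forall x, sphere n x -> (f x)^-1 <= M.
  by apply/scont_ubound/scontV => // x /f0/lt0r_neq0.
exists M^-1; first by rewrite invr_gt0.
by move=> x Sx; rewrite invf_ple ?posrE ?f0// HM.
Qed.

End sphere_continuity.

Lemma scont_isometry {R : realType} m n (U : 'M[R]_(m, n)) (f : 'rV[R]_n -> R) :
  U *m U^T = 1%:M -> scont f -> scont (fun y : 'rV[R]_m => f (y *m U)).
Proof.
move=> UU /scontP cf; apply/scontP => x Sx.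
have SU y : sphere m y -> sphere n (y *m U) by rewrite /sphere/= enorm_isometry.
apply: (@cvg_comp _ _ _ (fun y => y *m U) f _ (within (sphere n) (nbhs (x *m U)))); last exact/cf/SU.
move=> A; rewrite /within/= => nA.
have nA' : \forall y \near x, sphere n (y *m U) -> A (y *m U).
  exact: (@mulmx_continuous _ _ _ U x) _ nA.
change (\forall y \near x, sphere m y -> A (y *m U)).
by apply: filterS nA' => y hA Sy; exact/hA/SU.
Qed.

Section sph_integral.
Context {R : realType} {n : nat}.
Local Notation leb := (@leb R n).
Local Notation T := (@borelRn R n.+1).
Implicit Types f g : 'rV[R]_n.+1 -> R.

Definition shell : set T := [set x : 'rV[R]_n.+1 | 0 < enorm x <= 1].

(** The real-valued counterpart of [sphint], equal to it on continuous functions; linearity and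
    monotonicity are inherited from the integral with respect to [leb]. *)
Definition Sph f : R := n.+1%:R * (\int[leb]_(x in shell) f (nrm x)).

Lemma shell_neq0 x : shell x -> x != 0 :> 'rV[R]_n.+1.
Proof. by rewrite /shell/= enorm_gt0 => /andP[]. Qed.

Lemma shell_sphere x : shell x -> sphere n.+1 (nrm x).
Proof. by move=> /shell_neq0; exact: sphere_normalize. Qed.

Lemma shell_measurable : measurable shell.
Proof.
have -> : shell = setT `&` (@enorm R n.+1 : T -> R) @^-1` `]0, 1].
  by apply/seteqP; split => x; rewrite /shell/= in_itv/=; [|case].
apply: (continuous_borel_measurable openT) => // x _.
exact: enorm_continuous.
Qed.

Lemma leb_shell_lty : (leb shell < +oo)%E.
Proof.
apply: le_lt_trans (@vol_eball_lty R n); apply: le_vol => x /andP[]; exact.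
Qed.

Lemma neq0_measurable : measurable ([set x : 'rV[R]_n.+1 | x != 0] : set T).
Proof. by apply: sub_sigma_algebra; exact: open_neq0. Qed.

Lemma scont_measurable f : scont f ->
  measurable_fun ([set x : 'rV[R]_n.+1 | x != 0] : set T) (fun x => f (nrm x)).
Proof.
move=> cf; apply: (continuous_borel_measurable open_neq0) => x x0.
exact: scont_nrm.
Qed.

Lemma scont_measurable_shell f : scont f -> measurable_fun shell (fun x : T => f (nrm x)).
Proof.
move=> /scont_measurable; apply: measurable_funS; first exact: neq0_measurable.
by move=> x; exact: shell_neq0.
Qed.

Lemma scont_integrable f : scont f ->
  leb.-integrable shell (EFin \o (fun x => f (nrm x))).
Proof.
move=> cf; apply: measurable_bounded_integrable.
- exact: shell_measurable.
- exact: leb_shell_lty.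
- exact: scont_measurable_shell.
have [M M0 HM] := scont_bounded cf.
exists M; split; first exact: num_real.
by move=> r Mr x /shell_sphere/HM h; apply: le_trans h _; exact: ltW.
Qed.

Lemma sphint_Sph f : scont f -> sphint f = (Sph f)%:E.
Proof.
move=> cf; rewrite /sphint /Sph EFinM; congr (_ * _)%E.
rewrite /Rintegral fineK; last first.
  by apply: integrable_fin_num; [exact: shell_measurable|exact: scont_integrable].
set g := (fun x => _); have mg : measurable_fun setT (g : T -> R).
  have -> : (g : T -> R) = (fun x : T => f (nrm x)) \_ shell.
    apply/funext => x; rewrite /g patchE; case: ifPn => h.
      by rewrite mem_set.
    by rewrite memNset// => h'; rewrite h' in h.
  apply/(measurable_restrictT _ shell_measurable).
  exact: scont_measurable_shell.
rewrite /rintegral !nnintegralE; last 4 first.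
- by move=> x; rewrite le_max lexx orbT.
- by apply: measurable_maxr => //; exact: measurableT_comp.
- by move=> x; rewrite le_max lexx orbT.
- exact: measurable_maxr.
rewrite integral_mkcond.
transitivity (\int[leb]_x (g x)%:E)%E.
  by rewrite [RHS]integralE; congr (_ - _)%E; apply: eq_integral => x _;
     rewrite ?funeposE ?funenegE/= EFin_max.
apply: eq_integral => x _; rewrite patchE /g.
case: ifPn => h; first by rewrite mem_set.
by rewrite memNset// => h'; rewrite h' in h.
Qed.

Lemma eq_Sph f g : (forall x, sphere n.+1 x -> f x = g x) -> Sph f = Sph g.
Proof.
move=> fg; congr (_ * _); apply: eq_Rintegral => x /set_mem/shell_sphere.
exact: fg.
Qed.

Lemma SphD f g : scont f -> scont g -> Sph (fun x => f x + g x) = Sph f + Sph g.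
Proof.
move=> cf cg; rewrite -mulrDr -RintegralD//; first exact: shell_measurable.
  exact: scont_integrable.
exact: scont_integrable.
Qed.

Lemma SphZ c f : scont f -> Sph (fun x => c * f x) = c * Sph f.
Proof.
move=> cf; rewrite /Sph RintegralZl//; first by rewrite mulrCA.
  exact: shell_measurable.
exact: scont_integrable.
Qed.

Lemma le_Sph f g : scont f -> scont g -> (forall x, sphere n.+1 x -> f x <= g x) ->
  Sph f <= Sph g.
Proof.
move=> cf cg fg; rewrite ler_wpM2l//; apply: le_Rintegral.
- exact: shell_measurable.
- exact: scont_integrable.
- exact: scont_integrable.
- by move=> x /shell_sphere; exact: fg.
Qed.

Lemma vol_set1 : vol [set (0 : 'rV[R]_n.+1)] = 0%E.
Proof.
apply/eqP; rewrite eq_le vol_ge0 andbT.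
apply: le_trans (_ : (vol (box (0 : 'rV[R]_n.+1) 0) <= 0)%E).
  by apply: le_vol => x -> i; rewrite lexx.
apply: le_trans (vol_box_le _ _) _; rewrite lee_fin.
by rewrite /boxvol big_ord_recl mxE subrr maxxx mul0r.
Qed.

Lemma vol_remove0 (A : set 'rV[R]_n.+1) : vol A = vol (A `&` [set x | x != 0]).
Proof.
apply/eqP; rewrite eq_le; apply/andP; split; last by apply: le_vol; exact: subIsetl.
apply: (@le_trans _ _ (vol (A `&` [set x | x != 0%R]) + vol [set (0%R : 'rV[R]_n.+1)])%E).
  apply: le_trans (outer_measureU2 _ _ _); apply: le_vol => x Ax.
  by have [->|x0] := eqVneq x 0; [right|left].
by rewrite vol_set1 adde0.
Qed.

Lemma Sph_cst c : Sph (fun=> c) = c * (n.+1%:R * fine (vol (@eball R n.+1))).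
Proof.
rewrite /Sph mulrCA; congr (_ * _); rewrite Rintegral_cst; last exact: shell_measurable.
congr (_ * fine _); rewrite [RHS]vol_remove0; congr vol; apply/seteqP; split => x.
  by rewrite /shell/= enorm_gt0 => /andP[].
by rewrite /shell/= enorm_gt0 => -[-> ->].
Qed.

Lemma vol_eball_fine : (fine (vol (@eball R n.+1)))%:E = vol (@eball R n.+1).
Proof. by rewrite fineK// ge0_fin_numE ?vol_ge0 ?vol_eball_lty. Qed.

Lemma fine_vol_eball_gt0 : 0 < fine (vol (@eball R n.+1)).
Proof. by rewrite -lte_fin vol_eball_fine vol_eball_gt0. Qed.

(** By the layer-cake formula it suffices that the superlevel sets of the positive and negative
    parts keep their volume, which is [vol_rotation]. *)
Lemma Sph_rotation (Q : 'M[R]_n.+1) f : Q *m Q^T = 1%:M -> scont f ->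
  Sph (fun x => f (x *m Q)) = Sph f.
Proof.
move=> QQ cf; apply: EFin_inj; rewrite -!sphint_Sph//; last exact: scont_isometry.
rewrite /sphint; congr (_ * _)%E.
pose g (x : 'rV[R]_n.+1) := if 0 < enorm x <= 1 then f ((enorm x)^-1 *: x) else 0.
have mg : measurable_fun setT (g : T -> R).
  have -> : (g : T -> R) = (fun x : T => f (nrm x)) \_ shell.
    apply/funext => x; rewrite /g patchE; case: ifPn => h.
      by rewrite mem_set.
    by rewrite memNset// => h'; rewrite h' in h.
  apply/(measurable_restrictT _ shell_measurable).
  exact: scont_measurable_shell.
have gQ : (fun x => if 0 < enorm x <= 1 then f (((enorm x)^-1 *: x) *m Q) else 0)
    = (fun x => g (x *m Q)).
  by apply/funext => x; rewrite /g enorm_isometry// -scalemxAl.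
rewrite gQ -/g /rintegral; congr (_ - _)%E; apply: eq_integral => t _;
  rewrite -[RHS](vol_rotation QQ)//.
  have -> : [set x | t < Num.max (g x) 0] =
      setT `&` (fun x : T => Num.max (g x) 0) @^-1` `]t, +oo[.
    by apply/seteqP; split => x; rewrite /= in_itv/= andbT; [|case].
  suff : measurable_fun setT (fun x : T => Num.max (g x) 0) by apply.
  exact: measurable_maxr.
have -> : [set x | t < Num.max (- g x) 0] =
    setT `&` (fun x : T => Num.max (- g x) 0) @^-1` `]t, +oo[.
  by apply/seteqP; split => x; rewrite /= in_itv/= andbT; [|case].
suff : measurable_fun setT (fun x : T => Num.max (- g x) 0) by apply.
by apply: measurable_maxr => //; exact: measurableT_comp.
Qed.

End sph_integral.

(** * Volume in polar coordinates *)

Section radial.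
Context {R : realType} {n : nat}.
Local Notation leb := (@leb R n).
Local Notation T := (@borelRn R n.+1).
Variable M : 'rV[R]_n.+1 -> R.
Hypothesis M_gt0 : forall x, x != 0 -> 0 < M x.
Hypothesis M_hom : forall a x, 0 <= a -> M (a *: x) = a * M x.
Hypothesis M_cont : scont M.

(** The radial function of the body where [M x <= 1], extended to be constant along rays. *)
Let rho (x : 'rV[R]_n.+1) : R := (M (nrm x))^-1.

Let rho_gt0 x : x != 0 -> 0 < rho x.
Proof.
by move=> x0; rewrite invr_gt0 M_gt0// -enorm_gt0 enorm_normalize.
Qed.

Let rhoZ a x : 0 < a -> rho (a *: x) = rho x.
Proof. by move=> a0; rewrite /rho nrmZ. Qed.

Let M_rho x : x != 0 -> M x = enorm x / rho x.
Proof.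
move=> x0; rewrite invrK /nrm M_hom ?invr_ge0 ?enorm_ge0// mulrA mulfV ?mul1r//.
by rewrite enorm_eq0.
Qed.

Let scont_rho : scont (fun x => (M x)^-1).
Proof. by apply: scontV => // x /sphere_neq0/M_gt0/lt0r_neq0. Qed.

Let neq0T : set T := [set x : 'rV[R]_n.+1 | x != 0].

Let rho_measurable : measurable_fun neq0T (rho : T -> R).
Proof. exact: scont_measurable scont_rho. Qed.

Let K0 : set T := [set x : 'rV[R]_n.+1 | x != 0 /\ M x <= 1].
Let I : \bar R := (\int[leb]_(x in shell) (rho x ^+ n.+1)%:E)%E.

Let K0_measurable : measurable K0.
Proof.
pose g (x : T) : R := rho x - enorm x.
have -> : K0 = neq0T `&` g @^-1` `[0, +oo[.
  apply/seteqP; split => x; rewrite /= in_itv/= andbT subr_ge0 => -[x0].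
    by rewrite M_rho// ler_pdivrMr ?rho_gt0// mul1r.
  by move=> h; split => //; rewrite M_rho// ler_pdivrMr ?rho_gt0// mul1r.
suff : measurable_fun neq0T g by apply => //; exact: neq0_measurable.
apply: measurable_funB => //.
apply: (continuous_borel_measurable open_neq0) => x _; exact: enorm_continuous.
Qed.

Let shell_rho_measurable : measurable_fun shell (fun x => (rho x ^+ n.+1)%:E).
Proof.
apply/measurable_EFinP/measurable_funX.
by apply: measurable_funS rho_measurable => [|x]; [exact: neq0_measurable|exact: shell_neq0].
Qed.

(* Where [rho] lies in [r q^j, r q^(j+1)) the body is squeezed between two
   dilates, by [r q^j] and [r q^(j+1)], of a piece of the unit ball. *)
Let squeeze (q : R) : 1 < q ->
  (leb K0 <= (q ^+ n.+1)%:E * I /\ I <= (q ^+ n.+1)%:E * leb K0)%E.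
Proof.
move=> q1; have q0 : 0 < q by exact: lt_trans q1.
have [r r0 rP] : exists2 r, 0 < r & forall x, x != 0 -> r <= rho x.
  have [r r0 rP] := scont_pos_lbound scont_rho (fun x Sx => ltac:(by rewrite invr_gt0 M_gt0// sphere_neq0)).
  by exists r => // x x0; apply: rP; exact: sphere_normalize.
pose s j := r * q ^+ j.
have s0 j : 0 < s j by rewrite mulr_gt0// exprn_gt0.
have sS j : s j.+1 = q * s j by rewrite /s exprS mulrCA.
pose cone j : set T := [set x : 'rV[R]_n.+1 | x != 0 /\ s j <= rho x < s j.+1].
pose A j := shell `&` cone j; pose C j := K0 `&` cone j.
have mcone j : measurable (cone j).
  have -> : cone j = neq0T `&` rho @^-1` `[s j, s j.+1[.
    by apply/seteqP; split => x; rewrite /= in_itv/=.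
  by apply: rho_measurable; [exact: neq0_measurable|exact: measurable_itv].
have mA j : measurable (A j) by apply: measurableI => //; exact: shell_measurable.
have mC j : measurable (C j) by exact: measurableI.
have cover x : x != 0 -> exists j, cone j x.
  move=> x0; have ex : exists j, rho x < s j.+1.
    have [j hj] : exists j, rho x / r < q ^+ j.
      have bern k : 1 + k%:R * (q - 1) <= q ^+ k.
        elim: k => [|k IH]; first by rewrite mul0r addr0 expr0.
        rewrite exprS; apply: le_trans (_ : q * (1 + k%:R * (q - 1)) <= _); last first.
          by rewrite ler_pM2l.
        rewrite -natr1 -subr_ge0.
        rewrite (_ : _ - _ = k%:R * (q - 1) ^+ 2); last by ring.
        by rewrite mulr_ge0// sqr_ge0.
      have [k hk] : exists k : nat, rho x / r / (q - 1) < k%:R.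
        by exists (Num.truncn (rho x / r / (q - 1))).+1; exact: truncnS_gt.
      exists k; apply: lt_le_trans (bern k).
      by rewrite ltr_wpDl// -ltr_pdivrMr// subr_gt0.
    exists j; rewrite /s exprS mulrC; apply: (lt_trans _ (_ : q ^+ j * r < _)).
      by rewrite -ltr_pdivrMr.
    by rewrite ltr_pM2r// ltr_pMl ?exprn_gt0.
  exists (ex_minn ex); case: ex_minnP => -[|j] hj jmin; split => //.
    by rewrite /s expr0 mulr1 rP.
  rewrite hj andbT leNgt; apply/negP => /jmin; by rewrite ltnn.
have tcone : trivIset setT cone.
  apply/trivIsetP => i j _ _ ij; apply/seteqP; split => // x [[_ /andP[i1 i2]] [_ /andP[j1 j2]]].
  have smono k l : (k < l)%N -> s k.+1 <= s l.
    by move=> kl; rewrite ler_pM2l// ler_weXn2l// ltW.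
  move: ij; rewrite neq_ltn => /orP[/smono h|/smono h].
    by have := lt_le_trans (lt_le_trans i2 h) j1; rewrite ltxx.
  by have := lt_le_trans (lt_le_trans j2 h) i1; rewrite ltxx.
have shellE : shell = \bigcup_j A j.
  rewrite /A -setI_bigcupr; apply/seteqP; split => x; last by case.
  by move=> sx; split => //; have [j] := cover x (shell_neq0 sx); exists j.
have K0E : K0 = \bigcup_j C j.
  rewrite /C -setI_bigcupr; apply/seteqP; split => x; last by case.
  by move=> sx; split => //; have [j] := cover x sx.1; exists j.
have coneZ j a x : 0 < a -> cone j (a *: (x : 'rV[R]_n.+1)) <-> cone j x.
  by move=> a0; rewrite /cone/= rhoZ// scaler_eq0 (gt_eqF a0).
have C_le j : (leb (C j) <= (s j.+1 ^+ n.+1)%:E * leb (A j))%E.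
  rewrite /leb -vol_scale//; apply: le_vol => x [[x0 Mx] cx]; split => /=; last first.
    by apply/coneZ => //; rewrite invr_gt0.
  rewrite /shell/= enorm_gt0 scaler_eq0 negb_or x0 invr_neq0 ?gt_eqF//=.
  rewrite enormZ gtr0_norm ?invr_gt0// ler_pdivrMl// mulr1.
  move: Mx; rewrite M_rho// ler_pdivrMr ?rho_gt0// mul1r => /le_trans; apply.
  by case: cx => _ /andP[_ /ltW].
have C_ge j : ((s j ^+ n.+1)%:E * leb (A j) <= leb (C j))%E.
  rewrite /leb -vol_scale//; apply: le_vol => x [/= sx cx].
  have s'0 : 0 < (s j)^-1 by rewrite invr_gt0.
  have {}cx : cone j x by apply/(coneZ j _ x s'0).
  split => //; split; first by case: cx.
  have [x0 /andP[h _]] := cx.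
  rewrite M_rho// ler_pdivrMr ?rho_gt0// mul1r; apply: le_trans h.
  by move: sx => /andP[_]; rewrite enormZ gtr0_norm// ler_pdivrMl// mulr1.
have I_le j : (\int[leb]_(x in A j) (rho x ^+ n.+1)%:E <= (s j.+1 ^+ n.+1)%:E * leb (A j))%E.
  rewrite -integral_cst//; apply: ge0_le_integral => //.
  - by move=> x [/shell_neq0/rho_gt0 h _]; rewrite lee_fin exprn_ge0// ltW.
  - by apply: measurable_funS shell_rho_measurable; [exact: shell_measurable|exact: subIsetl].
  - move=> x [/shell_neq0/rho_gt0 h [_ /andP[_ h2]]].
    by rewrite lee_fin lerXn2r ?nnegrE ?(ltW (s0 _)) ?(ltW h) ?(ltW h2) ?h2.
have I_ge j : ((s j ^+ n.+1)%:E * leb (A j) <= \int[leb]_(x in A j) (rho x ^+ n.+1)%:E)%E.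
  rewrite -integral_cst//; apply: ge0_le_integral => //.
  - by move=> x _; rewrite lee_fin exprn_ge0// ltW.
  - by apply: measurable_funS shell_rho_measurable; [exact: shell_measurable|exact: subIsetl].
  - move=> x [/shell_neq0/rho_gt0 h [_ /andP[h2 _]]].
    by rewrite lee_fin lerXn2r ?nnegrE ?(ltW (s0 _)) ?(ltW h) ?(ltW h2) ?h2.
have Isum : I = (\sum_(0 <= j <oo) \int[leb]_(x in A j) (rho x ^+ n.+1)%:E)%E.
  rewrite /I {1}shellE ge0_integral_bigcup//.
  - by rewrite -shellE.
  - by move=> x; rewrite -shellE => /shell_neq0/rho_gt0 h; rewrite lee_fin exprn_ge0// ltW.
  - by apply: trivIset_setIl.
have Ksum : leb K0 = (\sum_(0 <= j <oo) leb (C j))%E.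
  rewrite {1}K0E measure_semi_bigcup//; first exact: trivIset_setIl.
  by rewrite -K0E.
have intA_ge0 j : (0 <= \int[leb]_(x in A j) (rho x ^+ n.+1)%:E)%E.
  by apply: integral_ge0 => x [/shell_neq0/rho_gt0 h _]; rewrite lee_fin exprn_ge0// ltW.
have qn0 : (0 <= (q ^+ n.+1)%:E)%E by rewrite lee_fin exprn_ge0// ltW.
split.
  rewrite Isum Ksum -nneseriesZl//.
  apply: lee_nneseries => [//|j _]; apply: le_trans (C_le j) _.
  by rewrite sS exprMn EFinM -muleA lee_wpmul2l.
rewrite Isum Ksum -nneseriesZl//.
apply: lee_nneseries => [j _ _|j _]; first exact: intA_ge0.
apply: le_trans (I_le j) _.
by rewrite sS exprMn EFinM -muleA lee_wpmul2l.
Qed.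

Let le_limit (a b : R) : 0 <= b -> (forall s, 1 < s -> a <= s * b) -> a <= b.
Proof.
move=> b0 h; apply/ler_addgt0Pr => e e0.
have := h (1 + e / (b + 1)); rewrite ltrDl divr_gt0 ?ltr_wpDl// => /(_ isT).
move=> /le_trans; apply; rewrite mulrDl mul1r lerD2l -mulrA ler_piMr ?(ltW e0)//.
by rewrite mulrC ler_pdivrMr ?mul1r ?lerDl// ltr_wpDl.
Qed.

(** The two bounds of [squeeze] meet as [q] tends to 1. The assumptions on [M] are positivity,
    homogeneity and continuity on the sphere, so the formula applies equally to a body and to the
    function [y |-> M (y *m U)] that describes its sections. *)
Theorem vol_radial :
  vol [set x | M x <= 1] = (Sph (fun x => (M x)^-1 ^+ n.+1) / n.+1%:R)%:E.
Proof.
have M0 : M 0 = 0 by rewrite -[0 in LHS](scale0r (0 : 'rV[R]_n.+1)) M_hom// mul0r.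
have -> : vol [set x | M x <= 1] = leb K0.
  rewrite vol_remove0; congr vol; apply/seteqP; split => x [].
    by [].
  by [].
have finI : I \is a fin_num.
  apply: integrable_fin_num; first exact: shell_measurable.
  apply: (scont_integrable (f := fun x => (M x)^-1 ^+ n.+1)).
  exact: scontX.
have root s : 1 < s -> exists2 q : R, 1 < q & q ^+ n.+1 = s.
  move=> s1; have s0 : 0 < s := lt_trans ltr01 s1.
  exists (s `^ (n.+1%:R^-1)); last by rewrite -powR_mulrn ?powR_ge0// -powRrM mulVf// powRr1// ltW.
  have := @gt0_ltr_powR R n.+1%:R^-1 (ltac:(by rewrite invr_gt0)) 1 s.
  by rewrite powR1 !nnegrE; apply => //; exact: ltW.
have finK : leb K0 \is a fin_num.
  have [q q1 _] := root 2 (ltr1n _ 2).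
  have [h _] := squeeze q1; rewrite ge0_fin_numE ?vol_ge0//.
  by apply: le_lt_trans h _; rewrite lte_mul_pinfty ?lee_fin ?exprn_ge0 ?(ltW (lt_trans ltr01 q1))// ltey_eq finI.
have I0 : (0 <= I)%E.
  by apply: integral_ge0 => x /shell_neq0/rho_gt0 h; rewrite lee_fin exprn_ge0// ltW.
have <- : n.+1%:R * fine I = Sph (fun x => (M x)^-1 ^+ n.+1).
  by [].
rewrite mulrAC mulfV ?pnatr_eq0// mul1r fineK//.
rewrite -(fineK finK) -(fineK finI); congr EFin; apply/eqP; rewrite eq_le; apply/andP; split.
  apply: le_limit => [|s /root[q q1 <-]]; first exact: fine_ge0.
  by have [+ _] := squeeze q1; rewrite -(fineK finK) -(fineK finI) -EFinM lee_fin.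
apply: le_limit => [|s /root[q q1 <-]]; first exact/fine_ge0/vol_ge0.
by have [_] := squeeze q1; rewrite -(fineK finK) -(fineK finI) -EFinM lee_fin.
Qed.

End radial.

(** * The spherical Radon transform *)

Section uniform_continuity.
Context {R : realType} {n : nat}.
Implicit Types f : 'rV[R]_n -> R.

Lemma near_enorm (x : 'rV[R]_n) (d : R) : 0 < d -> \forall y \near x, enorm (x - y) < d.
Proof.
move=> d0; have c : {for x, continuous (fun y : 'rV[R]_n => enorm (x - y))}.
  apply: (@continuous_comp _ _ _ (fun y : 'rV[R]_n => x - y) (@enorm R n)); last exact: enorm_continuous.
  by apply: continuousB; [exact: cst_continuous|exact: cvg_id].
have := cvgr_lt _ c d; rewrite /= subrr enorm0; exact.
Qed.

Lemma scont_eps f :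
  (forall x e, sphere n x -> 0 < e -> exists2 d, 0 < d &
    forall y, sphere n y -> enorm (x - y) < d -> `|f x - f y| <= e) -> scont f.
Proof.
move=> h; apply/scontP => x Sx; apply/cvgrPdist_le => e e0.
have [d d0 hd] := h x e Sx e0.
rewrite near_withinE; have := near_enorm x d0.
by apply: filterS => y xy Sy; exact: hd.
Qed.

Lemma scont_unif f e : scont f -> 0 < e -> exists2 d, 0 < d &
  forall x y, sphere n x -> sphere n y -> enorm (x - y) < d -> `|f x - f y| <= e.
Proof.
move=> /scontP cf e0.
have /compact_near_coveringP/near_covering_withinP := @sphere_compact R n.
move=> /(_ R (0^'+) (fun d x => forall y, sphere n y -> enorm (x - y) < d -> `|f x - f y| <= e)).
move=> /(_ _)[] => [x Sx|d0 /= d00 hd]; last first.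
  exists (d0 / 2); first by rewrite divr_gt0.
  move=> x y Sx; apply: (hd (d0 / 2)) => //=.
    rewrite sub0r normrN gtr0_norm ?divr_gt0//.
    by rewrite ltr_pdivrMr// ltr_pMr// ltr1n.
  by rewrite divr_gt0.
have e20 : 0 < e / 2 by rewrite divr_gt0.
have := cf x Sx => /cvgrPdist_le/(_ _ e20); rewrite near_withinE => H.
have /nbhs_ballP[r /= r0 hr] := H.
have r20 : 0 < r / 2 by rewrite divr_gt0.
exists ([set x' | enorm (x - x') < r / 2], [set d | d < r / 2]).
  split; first exact: near_enorm.
  exact: nbhs_right_lt.
move=> [x' d] [/= xx' dr] Sx' y Sy x'y.
have aux z : sphere n z -> enorm (x - z) < r -> `|f x - f z| <= e / 2.
  move=> Sz xz; apply: hr => //; rewrite mx_norm_ball /ball_/=.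
  by rewrite (le_lt_trans (norm_le_enorm _)).
have h1 : enorm (x - x') < r by rewrite (lt_trans xx')// ltr_pdivrMr// ltr_pMr// ltr1n.
have h2 : enorm (x - y) < r.
  have -> : x - y = (x - x') + (x' - y) by rewrite addrA subrK.
  apply: le_lt_trans (enorm_triangle _ _) _.
  by rewrite [ltRHS](splitr r) ltrD// (lt_trans x'y).
have -> : f x' - f y = (f x - f y) - (f x - f x') by ring.
rewrite (le_trans (ler_normB _ _))// [leRHS](splitr e) lerD//.
  exact: aux.
exact: aux.
Qed.

End uniform_continuity.

Section householder.
Context {R : realType} {n : nat}.
Implicit Types d x : 'rV[R]_n.

Definition refl d : 'M[R]_n := 1%:M - (2 / dotv d d) *: (d^T *m d).

Lemma mul_refl d x : x *m refl d = x - (2 * dotv x d / dotv d d) *: d.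
Proof.
rewrite mulmxBr mulmx1 -scalemxAr mulmxA; congr (_ - _).
rewrite (_ : x *m d^T = (dotv x d)%:M); last by rewrite [LHS]mx11_scalar -dotvE.
by rewrite mul_scalar_mx scalerA mulrAC.
Qed.

Lemma tr_refl d : (refl d)^T = refl d.
Proof. by rewrite /refl linearB/= trmx1 linearZ/= trmx_mul trmxK. Qed.

Lemma refl_orthogonal d : d != 0 -> refl d *m (refl d)^T = 1%:M.
Proof.
move=> d0; rewrite tr_refl; apply/row_matrixP => i.
rewrite !rowE mulmx1 mulmxA !mul_refl dotvDl dotvNl dotvZl.
have dd : dotv d d != 0 by rewrite dotvv_eq0.
rewrite mulfVK// -addrA -opprD -scalerDl.
set k := (X in X *: d).
have -> : k = 0 by rewrite /k; field.
by rewrite scale0r subr0.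
Qed.

(** The reflection is taken along [xi + xi'] rather than [xi - xi']: the image [- xi] has the same
    orthogonal hyperplane as [xi], and the direction of reflection stays away from 0 when [xi'] is
    close to [xi], as the continuity of the Radon transform demands. *)
Lemma refl_swap xi xi' : sphere n xi -> sphere n xi' -> xi + xi' != 0 ->
  xi' *m refl (xi + xi') = - xi.
Proof.
move=> S S'; rewrite -dotvv_eq0 mul_refl !(dotvDl, dotvDr) (dotvC xi xi').
rewrite -!sqr_enorm S S' !expr1n => h.
rewrite (_ : _ / _ = 1) ?scale1r; first by rewrite opprD addrCA subrr addr0.
by rewrite (_ : 2 * _ = 1 + dotv xi' xi + (dotv xi' xi + 1)) ?divff//; ring.
Qed.

End householder.

Section radon.
Context {R : realType} {n : nat}.
Implicit Types (xi : 'rV[R]_n.+2) (f : 'rV[R]_n.+2 -> R).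

Lemma hyperplane_refl xi xi' (U : 'M[R]_(n.+1, n.+2)) :
  sphere n.+2 xi -> sphere n.+2 xi' -> xi + xi' != 0 ->
  hyperplane_param xi U -> hyperplane_param xi' (U *m refl (xi + xi')).
Proof.
move=> S S' d0 [UU Uxi]; split.
  by rewrite trmx_mul mulmxA -(mulmxA U) refl_orthogonal// mulmx1.
rewrite -mulmxA -[refl _]tr_refl -trmx_mul (refl_swap S S' d0).
by rewrite linearN/= mulmxN Uxi oppr0.
Qed.

Lemma hyperplane_exists xi : sphere n.+2 xi ->
  exists U : 'M[R]_(n.+1, n.+2), hyperplane_param xi U.
Proof.
move=> S; pose e : 'rV[R]_n.+2 := delta_mx ord0 ord_max.
have Se : sphere n.+2 e.
  rewrite /sphere/= /enorm dotvE trmx_delta mul_delta_mx mxE eqxx sqrtr1.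
  by [].
pose U0 : 'M[R]_(n.+1, n.+2) := pid_mx n.+1.
have U0U0 : U0 *m U0^T = 1%:M.
  by rewrite /U0 tr_pid_mx mul_pid_mx minnn (minn_idPr (leqnSn _)) pid_mx_1.
have U0e : U0 *m e^T = 0.
  apply/matrixP => i j; rewrite trmx_delta !mxE big1// => k _; rewrite !mxE.
  case: (k =P ord_max) => [->|_]; last by rewrite mulr0.
  by rewrite (_ : (i == ord_max :> nat) = false) ?mul0r//; apply/negbTE; rewrite neq_ltn/= ltn_ord.
have P0 : hyperplane_param e U0 by [].
(* The reflection degenerates at [xi = - e], but there [U0] itself parametrizes the hyperplane. *)
have [d0|d0] := eqVneq (e + xi) 0; last by exists (U0 *m refl (e + xi)); exact: hyperplane_refl.
exists U0; split => //; have -> : xi = - e by apply/eqP; rewrite -addr_eq0 addrC d0.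
by rewrite linearN/= mulmxN U0e oppr0.
Qed.

(** The very frame selected inside [radon]. *)
Definition frame xi : 'M[R]_(n.+1, n.+2) := xget 0 [set U | hyperplane_param xi U].

Lemma frameP xi : sphere n.+2 xi -> hyperplane_param xi (frame xi).
Proof. by move=> /hyperplane_exists[U HU]; rewrite /frame; case: xgetP => [? ->//|/(_ U)]. Qed.

Definition Rad f xi : R := Sph (fun y => f (y *m frame xi)).

Lemma radon_Rad f xi : scont f -> sphere n.+2 xi -> radon f xi = (Rad f xi)%:E.
Proof.
move=> cf S; rewrite /radon -sphint_Sph//; apply: scont_isometry => //.
by have [] := frameP S.
Qed.

(** Adding the row [xi] to [V] gives a square matrix with orthonormal rows, hence with orthonormal
    columns. So [V^T *m V] is the projection onto the hyperplane, which fixes the rows of [U], and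
    [Q = U *m V^T] works. *)
Lemma frame_change xi (U V : 'M[R]_(n.+1, n.+2)) : sphere n.+2 xi ->
  hyperplane_param xi U -> hyperplane_param xi V ->
  exists2 Q, Q *m Q^T = 1%:M & U = Q *m V.
Proof.
move=> S [UU Ux] [VV Vx].
have xx : xi *m xi^T = 1%:M.
  by rewrite [LHS]mx11_scalar -dotvE -sqr_enorm S expr1n.
have xV : xi *m V^T = 0 by rewrite -[xi]trmxK -trmx_mul Vx trmx0.
have proj : V^T *m V + xi^T *m xi = 1%:M.
  have e : (n.+1 + 1)%N = n.+2 by rewrite addn1.
  have : col_mx V xi *m row_mx V^T xi^T = 1%:M.
    by rewrite mul_col_row VV Vx xV xx -scalar_mx_block.
  move=> h.
  have : row_mx V^T xi^T *m col_mx V xi = 1%:M.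
    by move: h; move: (col_mx V xi) (row_mx V^T xi^T); rewrite e => A B; exact: mulmx1C.
  by rewrite mul_row_col.
have UE : U *m V^T *m V = U.
  rewrite -mulmxA -[RHS]mulmx1 -proj mulmxDr [X in _ + X]mulmxA Ux mul0mx addr0.
  by [].
exists (U *m V^T) => //.
by rewrite trmx_mul trmxK mulmxA UE.
Qed.

(** Two frames of a hyperplane differ by a rotation of the parameter space, which [Sph] ignores.
    This reconciles the arbitrary frame of [section_vol] with the fixed frame of [radon]. *)
Lemma Rad_frame f xi (U : 'M[R]_(n.+1, n.+2)) : scont f -> sphere n.+2 xi ->
  hyperplane_param xi U -> Sph (fun y => f (y *m U)) = Rad f xi.
Proof.
move=> cf S HU; have HV := frameP S.
have [Q QQ ->] := frame_change S HU HV.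
rewrite /Rad -[RHS](Sph_rotation QQ); last by apply: scont_isometry => //; case: HV.
by apply: eq_Sph => y _; rewrite mulmxA.
Qed.

Section lemmas.
Variable xi : 'rV[R]_n.+2.
Hypothesis S : sphere n.+2 xi.
Let UU : frame xi *m (frame xi)^T = 1%:M. Proof. by have [] := frameP S. Qed.
Let SU y : sphere n.+1 y -> sphere n.+2 (y *m frame xi).
Proof. by rewrite /sphere/= enorm_isometry. Qed.

Lemma RadD f g : scont f -> scont g -> Rad (fun x => f x + g x) xi = Rad f xi + Rad g xi.
Proof. by move=> cf cg; apply: (SphD (scont_isometry UU cf) (scont_isometry UU cg)). Qed.

Lemma RadZ c f : scont f -> Rad (fun x => c * f x) xi = c * Rad f xi.
Proof. by move=> cf; apply: (SphZ c (scont_isometry UU cf)). Qed.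

Lemma le_Rad f g : scont f -> scont g -> (forall x, sphere n.+2 x -> f x <= g x) ->
  Rad f xi <= Rad g xi.
Proof.
move=> cf cg fg; apply: (le_Sph (scont_isometry UU cf) (scont_isometry UU cg)).
by move=> y /SU; exact: fg.
Qed.

Lemma Rad_cst c : Rad (fun=> c) xi = c * (n.+1%:R * fine (vol (@eball R n.+1))).
Proof. exact: Sph_cst. Qed.

Lemma Rad_opp f : scont f -> Rad (fun x => f (- x)) xi = Rad f xi.
Proof.
move=> cf; have NN : (- 1%:M : 'M[R]_n.+1) *m (- 1%:M)^T = 1%:M.
  by rewrite linearN/= trmx1 mulNmx mulmxN opprK mulmx1.
rewrite /Rad -(Sph_rotation NN (scont_isometry UU cf)); apply: eq_Sph => y _.
by rewrite mulmxN mulmx1 mulNmx.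
Qed.

End lemmas.

(* The reflection along [xi + xi'] maps [xi'^perp] to [xi^perp] and moves unit
   vectors of [xi^perp] by at most [2 |xi - xi'| / |xi + xi'|]. *)
Lemma scont_Rad f : scont f -> scont (Rad f).
Proof.
move=> cf; apply: scont_eps => xi e S e0.
pose w : R := n.+1%:R * fine (vol (@eball R n.+1)).
have w0 : 0 < w by rewrite mulr_gt0// fine_vol_eball_gt0.
have ew0 : 0 < e / w by rewrite divr_gt0.
have [d d0 hd] := scont_unif cf ew0.
(* The bound 1 forces [|xi + xi'| >= 1], so that unit vectors of the hyperplane move by at most
   [2 |xi - xi'|]; the bound [d / 2] makes this less than [d]. *)
exists (Num.min 1 (d / 2)); first by rewrite lt_min ltr01 divr_gt0.
move=> xi' S'; rewrite lt_min => /andP[x1 xd].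
have n1 : 1 <= enorm (xi + xi').
  have := enorm_triangle (xi + xi') (xi - xi').
  rewrite addrACA subrr addr0 -[xi in X in enorm X <= _]scale1r -scalerDl enormZ S mulr1.
  rewrite ger0_norm//; move: (enorm (xi + xi')) (enorm (xi - xi')) x1 => a b; lra.
have n0 : xi + xi' != 0 by rewrite -enorm_gt0 (lt_le_trans ltr01).
have HU := frameP S; have HU' := hyperplane_refl S S' n0 HU.
rewrite -(Rad_frame cf S' HU') /Rad.
have c1 : scont (fun y => f (y *m frame xi)) by apply: scont_isometry => //; case: HU.
have c2 : scont (fun y => f (y *m (frame xi *m refl (xi + xi')))).
  by apply: scont_isometry => //; case: HU'.
have key y : sphere n.+1 y ->
    `|f (y *m frame xi) - f (y *m (frame xi *m refl (xi + xi')))| <= e / w.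
  move=> Sy; set x := y *m frame xi.
  have Sx : sphere n.+2 x by rewrite /sphere/= enorm_isometry//; case: HU.
  have xxi : dotv x xi = 0.
    by case: HU => _ h; rewrite dotvE /x -mulmxA h mulmx0 mxE.
  apply: hd => //; rewrite mulmxA -/x.
    by rewrite /sphere/= enorm_isometry//; exact: refl_orthogonal.
  rewrite mul_refl opprB addrC subrK enormZ.
  have h1 : `|dotv x (xi + xi')| <= enorm (xi - xi').
    have -> : dotv x (xi + xi') = - dotv x (xi - xi').
      by rewrite dotvDr xxi add0r dotvDr xxi add0r dotvNr opprK.
    by rewrite normrN (le_trans (cauchy_schwarz _ _))// Sx mul1r.
  rewrite -sqr_enorm normrM normrM normfV gtr0_norm//.
  rewrite [`|_ ^+ 2|]ger0_norm ?sqr_ge0// expr2 invfM mulrA mulfVK ?enorm_eq0//.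
  apply: (@le_lt_trans _ _ (2 * enorm (xi - xi'))).
    rewrite -mulrA ler_pM2l//; apply: le_trans h1; rewrite ler_piMr//.
    by rewrite invf_le1// (lt_le_trans ltr01).
  by rewrite mulrC -ltr_pdivlMr.
have bound g h : scont g -> scont h ->
    (forall y, sphere n.+1 y -> `|g y - h y| <= e / w) -> Sph g - Sph h <= e.
  move=> cg ch gh; rewrite lerBlDr.
  have -> : e + Sph h = Sph (fun y => e / w + h y).
    rewrite SphD//; last exact: scont_cst.
    by rewrite Sph_cst -/w mulfVK// gt_eqF.
  apply: le_Sph => //; first by apply: scontD => //; exact: scont_cst.
  by move=> y /gh; rewrite -lerBlDr => /(le_trans (ler_norm _)).
rewrite ler_norml; apply/andP; split; last exact: bound.
rewrite lerNl opprB; apply: bound => // y Sy; rewrite distrC; exact: key.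
Qed.

End radon.

(** * The Hahn-Banach and Riesz-Markov theorems *)

Section hahn_banach.
Context {R : realType} {V : lmodType R}.
Variable D : set V.
Hypothesis D_add : forall x y, D x -> D y -> D (x + y).
Hypothesis D_scale : forall (a : R) x, D x -> D (a *: x).

(** Homogeneity is required as an inequality only, because in this form it passes to infima; for
    [a > 0] equality follows by rescaling with the inverse of [a]. The predicate [D] plays the part
    of a linear subspace. *)
Definition sublinear (q : V -> R) :=
  (forall x y, D x -> D y -> q (x + y) <= q x + q y) /\
  (forall (a : R) x, 0 <= a -> D x -> q (a *: x) <= a * q x).

Let D_opp x : D x -> D (- x).
Proof. by move=> Dx; rewrite -scaleN1r; exact: D_scale. Qed.

Lemma sublinearZ q a x : sublinear q -> 0 < a -> D x -> q (a *: x) = a * q x.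
Proof.
move=> [_ qZ] a0 Dx; apply/eqP; rewrite eq_le qZ ?(ltW a0)//=.
rewrite -ler_pdivlMl//.
have := qZ a^-1 (a *: x); rewrite scalerA mulVf ?gt_eqF// scale1r; apply.
  by rewrite invr_ge0 ltW.
exact: D_scale.
Qed.

Lemma sublinear0 q x : sublinear q -> D x -> q 0 = 0.
Proof.
move=> sq Dx; have [qD qZ] := sq; have D0 : D 0 by rewrite -(scale0r x); exact: D_scale.
apply/eqP; rewrite eq_le; apply/andP; split.
  by have := qZ 0 0 (lexx _) D0; rewrite scale0r mul0r.
by have := qD 0 0 D0 D0; rewrite addr0 -{1}(addr0 (q 0)) lerD2l.
Qed.

Lemma sublinear_opp q x : sublinear q -> D x -> - q (- x) <= q x.
Proof.
move=> sq Dx; have [qD _] := sq; rewrite -subr_ge0 opprK.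
rewrite -(sublinear0 sq Dx) -[X in q X](subrr x).
by apply: qD => //; exact: D_opp.
Qed.

Variable p : V -> R.
Hypothesis p_sub : sublinear p.

Let Q := {q : V -> R | sublinear q /\ forall x, D x -> q x <= p x}.
(** The order is reversed, so that a maximal element in the sense of Zorn is a minimal functional.
    It compares values on [D] only and is therefore a preorder. *)
Let le_Q : rel Q := fun q r => `[< forall x, D x -> sval r x <= sval q x >].

(** The bound is the pointwise infimum of the chain, finite because [- p (- x)] lies below all its
    members. For subadditivity, of two members nearly attaining the infimum at [x] and at [y], the
    smaller one serves at both points. *)
Let chain_bound (A : set Q) : total_on A le_Q -> exists t, forall s, A s -> le_Q s t.
Proof.
move=> tA; have [A0|/set0P[q0 Aq0]] := eqVneq A set0.
  have pQ : sublinear p /\ forall x, D x -> p x <= p x by [].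
  by exists (exist _ p pQ) => s; rewrite A0.
pose E x := [set sval q x | q in A].
pose t x := inf (E x).
have lb (q : Q) x : D x -> - p (- x) <= sval q x.
  move=> Dx; have [sq qp] := svalP q; apply: le_trans (sublinear_opp sq Dx).
  by rewrite lerN2 qp//; exact: D_opp.
have infE x : D x -> has_inf (E x).
  move=> Dx; split; first by exists (sval q0 x), q0.
  by exists (- p (- x)) => _ [q Aq <-]; exact: lb.
have t_le (q : Q) x : A q -> D x -> t x <= sval q x.
  by move=> Aq Dx; apply: ge_inf; [exact: (infE x Dx).2|exists q].
have le_t a x : D x -> (forall q, A q -> a <= sval q x) -> a <= t x.
  by move=> Dx h; apply: lb_le_inf; [exists (sval q0 x), q0|move=> _ [q Aq <-]; exact: h].
have st : sublinear t.
  split=> [x y Dx Dy|a x a0 Dx].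
    rewrite -lerBlDr; apply: (@le_t) => // q1 Aq1; rewrite lerBlDr -lerBlDl.
    apply: (@le_t) => // q2 Aq2; rewrite lerBlDl.
    have [q [Aq h1 h2]] : exists q, [/\ A q, sval q x <= sval q1 x & sval q y <= sval q2 y].
      have [/asboolP h|/asboolP h] := tA q1 q2 Aq1 Aq2.
        by exists q2; split => //; exact: h.
      by exists q1; split => //; exact: h.
    apply: le_trans (t_le q (x + y) Aq (D_add Dx Dy)) _.
    have [/(_ x y Dx Dy) hq _] := (svalP q).1.
    by rewrite (le_trans hq)// lerD.
  move: a0; rewrite le_eqVlt => /predU1P[<-|a0].
    rewrite mul0r; apply: le_trans (t_le q0 _ Aq0 (D_scale _ Dx)) _.
    by rewrite scale0r (sublinear0 (svalP q0).1 Dx).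
  rewrite mulrC -ler_pdivrMr//; apply: (@le_t) => // q Aq; rewrite ler_pdivrMr// mulrC.
  apply: le_trans (t_le q _ Aq (D_scale _ Dx)) _.
  by rewrite (sublinearZ (svalP q).1).
have tQ : sublinear t /\ forall x, D x -> t x <= p x.
  by split => // x Dx; apply: le_trans (t_le q0 x Aq0 Dx) _; exact: (svalP q0).2.
by exists (exist _ t tQ) => q Aq; apply/asboolP => x Dx /=; exact: t_le.
Qed.

(* A pointwise minimal sublinear functional [q] is linear: compare it with
   [inf_(t >= 0) (q (x + t v) - t q v)]. *)
Theorem hahn_banach : exists Lam : V -> R,
  [/\ forall x y, D x -> D y -> Lam (x + y) = Lam x + Lam y,
      forall a x, D x -> Lam (a *: x) = a * Lam x &
      forall x, D x -> Lam x <= p x].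
Proof.
have pQ : sublinear p /\ forall x, D x -> p x <= p x by [].
have [||q qmin] := @ZL_preorder Q (exist _ p pQ) le_Q _ _ chain_bound.
- by move=> q; apply/asboolP.
- move=> r s t /asboolP rs /asboolP st; apply/asboolP => x Dx.
  exact: le_trans (st x Dx) (rs x Dx).
case: q qmin => q [sq qp] qmin; have [qD qZ] := sq.
have q_super x v : D x -> D v -> q x + q v <= q (x + v).
  move=> Dx Dv; pose E x := [set q (x + t *: v) - t * q v | t in [set t | 0 <= t]].
  pose r x := inf (E x).
  have lb y t : D y -> 0 <= t -> - q (- y) <= q (y + t *: v) - t * q v.
    move=> Dy t0; rewrite lerBrDl lerBlDr.
    have -> : t * q v = q (t *: v).
      move: t0; rewrite le_eqVlt => /predU1P[<-|t0]; last by rewrite (sublinearZ sq).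
      by rewrite mul0r scale0r (sublinear0 sq Dv).
    rewrite -{1}(addrK y (t *: v)) [t *: v + y]addrC.
    apply: qD; last exact: D_opp.
    by apply: D_add => //; exact: D_scale.
  have infE y : D y -> has_inf (E y).
    move=> Dy; split; first by exists (q (y + 0 *: v) - 0 * q v), 0; rewrite //= lexx.
    by exists (- q (- y)) => _ [t /= t0 <-]; exact: lb.
  have r_le t y : 0 <= t -> D y -> r y <= q (y + t *: v) - t * q v.
    by move=> t0 Dy; apply: ge_inf; [exact: (infE y Dy).2|exists t].
  have le_r a y : D y -> (forall t, 0 <= t -> a <= q (y + t *: v) - t * q v) -> a <= r y.
    move=> Dy h; apply: lb_le_inf; first exact: (infE y Dy).1.
    by move=> _ [t /= t0 <-]; exact: h.
  have Dt t y : D y -> D (y + t *: v) by move=> Dy; apply: D_add => //; exact: D_scale.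
  have sr : sublinear r.
    split=> [y z Dy Dz|a y a0 Dy].
      rewrite -lerBlDr; apply: (@le_r) => // t t0; rewrite lerBlDr -lerBlDl.
      apply: (@le_r) => // s s0; rewrite lerBlDl.
      apply: le_trans (r_le (t + s) _ (addr_ge0 t0 s0) (D_add Dy Dz)) _.
      rewrite scalerDl addrACA; have := qD _ _ (Dt t y Dy) (Dt s z Dz).
      move: (q (y + t *: v + (z + s *: v))) (q (y + t *: v)) (q (z + s *: v)) (q v) => a b c d.
      by move=> h; rewrite mulrDl; lra.
    move: a0; rewrite le_eqVlt => /predU1P[<-|a0].
      rewrite mul0r scale0r; have D0 : D 0 by rewrite -(scale0r v); exact: D_scale.
      apply: le_trans (r_le 0 0 (lexx _) D0) _.
      by rewrite scale0r addr0 mul0r subr0 (sublinear0 sq Dv).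
    rewrite mulrC -ler_pdivrMr//; apply: (@le_r) => // t t0; rewrite ler_pdivrMr// mulrC.
    apply: le_trans (r_le (a * t) _ (mulr_ge0 (ltW a0) t0) (D_scale _ Dy)) _.
    by rewrite -scalerA -scalerDr (sublinearZ sq)// ?mulrBr ?mulrA//; exact: Dt.
  have rq y : D y -> r y <= q y.
    by move=> Dy; have := r_le 0 y (lexx _) Dy; rewrite scale0r addr0 mul0r subr0.
  have rQ : sublinear r /\ forall x, D x -> r x <= p x.
    by split => // y Dy; apply: le_trans (rq y Dy) (qp y Dy).
  (* Minimality of [q] gives [q x <= r x], and the term [t = 1] of the infimum bounds [r x] by
     [q (x + v) - q v]. *)
  have /asboolP /= h := qmin (exist _ r rQ) (asboolT rq).
  rewrite -lerBrDr; apply: le_trans (h x Dx) _.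
  by have := r_le 1 x ler01 Dx; rewrite scale1r mul1r.
have qDe x y : D x -> D y -> q (x + y) = q x + q y.
  by move=> Dx Dy; apply/eqP; rewrite eq_le qD//= q_super.
exists q; split => // a x Dx.
have qN y : D y -> q (- y) = - q y.
  move=> Dy; apply/eqP; rewrite -addr_eq0 -qDe//; last exact: D_opp.
  by rewrite addNr (sublinear0 sq Dy).
have [a0|a0|->] := ltgtP a 0; last 2 first.
- exact: sublinearZ.
- by rewrite scale0r mul0r (sublinear0 sq Dx).
rewrite -[a]opprK scaleNr qN; last exact: D_scale.
by rewrite (sublinearZ sq) ?oppr_gt0// !mulNr.
Qed.

End hahn_banach.

Section riesz_markov.
Context {R : realType} {n : nat}.
Local Notation S := (@sphere R n).
Local Notation T := (@borelRn R n).
Variable Lam : ('rV[R]_n -> R) -> R.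
Hypothesis LamD : forall f g, scont f -> scont g -> Lam (fun x => f x + g x) = Lam f + Lam g.
Hypothesis LamZ : forall a f, scont f -> Lam (fun x => a * f x) = a * Lam f.
Hypothesis Lam_ge0 : forall f, scont f -> (forall x, S x -> 0 <= f x) -> 0 <= Lam f.

Let Lam_le f g : scont f -> scont g -> (forall x, S x -> f x <= g x) -> Lam f <= Lam g.
Proof.
move=> cf cg fg; rewrite -subr_ge0 -mulN1r -LamZ// -LamD//; last first.
  by apply: scontM => //; exact: scont_cst.
apply: Lam_ge0 => [|x Sx]; last by rewrite mulN1r subr_ge0 fg.
by apply: scontD => //; apply: scontM => //; exact: scont_cst.
Qed.

Let Lam_eq f g : scont f -> scont g -> (forall x, S x -> f x = g x) -> Lam f = Lam g.
Proof.
by move=> cf cg fg; apply/eqP; rewrite eq_le !Lam_le// => x Sx; rewrite fg.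
Qed.

Let Lam0 : Lam (fun=> 0) = 0.
Proof.
rewrite -[RHS](mul0r (Lam (fun=> 0))) -LamZ; last exact: scont_cst.
apply: Lam_eq => [||x _]; [exact: scont_cst| |by rewrite mul0r].
by apply: scontM; exact: scont_cst.
Qed.

(** A set is covered by nonnegative continuous functions whose sum is at least 1 on its trace on the
    sphere, and the price of a function is its value under [Lam]. Points off the sphere impose no
    condition, so the resulting measure is carried by the sphere. *)
Definition fun_cover (A : set 'rV[R]_n) (c : nat -> 'rV[R]_n -> R) :=
  (forall k, scont (c k) /\ forall x, S x -> 0 <= c k x) /\
  forall x, S x -> A x -> (1 <= \sum_(0 <= k <oo) (c k x)%:E)%E.

Definition rm_outer : set 'rV[R]_n -> \bar R := cover_outer (fun c => (Lam c)%:E) fun_cover.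

Let cov_ge0 A c k : fun_cover A c -> (0 <= (Lam (c k))%:E)%E.
Proof. by move=> [/(_ k)[ck ck0] _]; rewrite lee_fin; exact: Lam_ge0. Qed.

Let cov_sub (A B : set 'rV[R]_n) c : A `<=` B -> fun_cover B c -> fun_cover A c.
Proof. by move=> AB [h1 h2]; split => // x Sx /AB; exact: h2. Qed.

Let cov0 : exists2 c, fun_cover set0 c & forall k, (Lam (c k))%:E = 0%E.
Proof.
exists (fun _ _ => 0) => [|k]; last by rewrite Lam0.
by split => // k; split => //; exact: scont_cst.
Qed.

Let cov_bigcup (A : nat -> set 'rV[R]_n) c (f : nat -> nat * nat) g :
  cancel f g -> cancel g f -> (forall j, fun_cover (A j) (c j)) ->
  fun_cover (\bigcup_j A j) (fun k => c (f k).1 (f k).2).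
Proof.
move=> fg gf Ac; split=> [k|x Sx [j _ Ajx]]; first exact: (Ac _).1.
have c0 i k : (0 <= (c i k x)%:E)%E by rewrite lee_fin; exact: ((Ac i).1 k).2.
rewrite (nneseries_pair (a := fun i k => (c i k x)%:E) c0 fg gf).
apply: le_trans (nneseries_lim_ge j.+1 _); last first.
  by move=> i _ _; apply: nneseries_ge0.
rewrite big_nat_recr//=; apply: le_trans ((Ac j).2 x Sx Ajx) _.
by apply: leeDr; apply: sume_ge0 => i _; apply: nneseries_ge0.
Qed.

Lemma rm_outer0 : rm_outer set0 = 0%E.
Proof. exact: cover_outer0. Qed.
Lemma rm_outer_ge0 A : (0 <= rm_outer A)%E.
Proof. exact: cover_outer_ge0. Qed.
Lemma le_rm_outer : {homo rm_outer : A B / A `<=` B >-> (A <= B)%E}.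
Proof. exact: le_cover_outer. Qed.
Lemma rm_outer_sub : sigma_subadditive rm_outer.
Proof. exact: cover_outer_sigma_subadditive. Qed.

HB.instance Definition _ := isOuterMeasure.Build R 'rV[R]_n rm_outer
  rm_outer0 rm_outer_ge0 le_rm_outer rm_outer_sub.

(* [u m = min 1 (m (x_i - c)^+)] increases to the indicator of the half-space;
   the increments of [u] split a cover of [X] into covers of both parts. *)
Lemma rm_halfspace i c : rm_outer.-caratheodory (halfspace i c).
Proof.
apply: le_caratheodory_measurable => X.
change (rm_outer (X `&` halfspace i c) + rm_outer (X `&` ~` halfspace i c) <= rm_outer X)%E.
apply: le_ereal_inf_tmp => _ [F [[F1 F2] ->]].
have cF k : scont (F k) by exact: (F1 k).1.
have F0 k x : S x -> 0 <= F k x by exact: (F1 k).2.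
pose u (m : nat) (x : 'rV[R]_n) := Num.min 1 (m%:R * Num.max 0 (x ord0 i - c)).
have cu m : scont (u m).
  apply: scont_min; first exact: scont_cst.
  apply: scontM; first exact: scont_cst.
  apply: scont_max; first exact: scont_cst.
  apply: scontD; last exact: scont_cst.
  by apply: scont_at => x _; exact: coord_continuous.
have u0 x : u 0%N x = 0 by rewrite /u mul0r; apply/min_idPr.
have u_le1 m x : u m x <= 1 by rewrite ge_min lexx.
have u_ge0 m x : 0 <= u m x by rewrite le_min ler01 mulr_ge0// le_max lexx.
have u_nd m x : u m x <= u m.+1 x.
  rewrite le_min u_le1 /= ge_min; apply/orP; right.
  by rewrite ler_wpM2r ?le_max ?lexx// ler_nat.
(* The difference is spelled with [-1 *] so that [LamD] and [LamZ] apply to it as they stand. *)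
pose D m x := u m.+1 x + -1 * u m x.
have cD m : scont (D m).
  by apply: scontD => //; apply: scontM => //; exact: scont_cst.
have D0 m x : 0 <= D m x by rewrite /D mulN1r subr_ge0 u_nd.
have sumD m x : \sum_(0 <= j < m) D j x = u m x.
  rewrite (@telescope_sumr_eq _ 0 m (fun j => u j x))// ?u0 ?subr0// => j _.
  by rewrite /D mulN1r.
pose G k j x := F k x * D j x.
have cG k j : scont (G k j) by exact: scontM.
have G0 k j x : S x -> 0 <= G k j x by move=> Sx; rewrite mulr_ge0// F0.
have LG0 k j : (0 <= (Lam (G k j))%:E)%E by rewrite lee_fin; apply: Lam_ge0 => // x; exact: G0.
have sumLG m k : \sum_(0 <= j < m) Lam (G k j) = Lam (fun x => F k x * u m x).
  elim: m => [|m IH].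
    rewrite big_nil -Lam0; apply: Lam_eq => [||x _]; first exact: scont_cst.
      exact: scontM.
    by rewrite u0 mulr0.
  rewrite big_nat_recr//= IH -LamD//; last exact: scontM.
  apply: Lam_eq => [||x _]; [by apply: scontD => //; exact: scontM|exact: scontM|].
  by rewrite /G /D; ring.
have hH : (rm_outer (X `&` halfspace i c) <=
    \sum_(0 <= k <oo) \sum_(0 <= j <oo) (Lam (G k j))%:E)%E.
  have /card_esym/ppcard_eqP[f0] := card_nat2.
  have [f [g [fg gf]]] : exists f g, cancel (f : nat -> nat * nat) g /\ cancel g f.
    by exists f0, f0^-1%FUN; split => x; rewrite ?funK ?invK ?inE.
  rewrite -(nneseries_pair (a := fun k j => (Lam (G k j))%:E) LG0 fg gf).
  apply: ereal_inf_lbound; exists (fun l => G (f l).1 (f l).2); split => //; split.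
    by move=> l; split => // x; exact: G0.
  move=> x Sx [Xx Hx].
  rewrite (nneseries_pair (a := fun k j => (G k j x)%:E) _ fg gf); last first.
    by move=> k j; rewrite lee_fin G0.
  apply: le_trans (F2 x Sx Xx) _; apply: lee_nneseries => [k _ _|k _].
    by rewrite lee_fin F0.
  have [m hm] : exists m, u m x = 1.
    exists (Num.truncn (x ord0 i - c)^-1).+1; apply/min_idPl.
    have xc : 0 < x ord0 i - c by rewrite subr_gt0.
    rewrite (max_idPr (ltW xc)) -ler_pdivrMr// div1r.
    exact/ltW/truncnS_gt.
  apply: le_trans (nneseries_lim_ge m _); last by move=> j _ _; rewrite lee_fin G0.
  by rewrite sumEFin -mulr_sumr sumD hm mulr1.
have hC m : (rm_outer (X `&` ~` halfspace i c) <=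
    \sum_(0 <= k <oo) (Lam (fun x => F k x * (1 + -1 * u m x))%R)%:E)%E.
  have c1 : scont (fun x => 1 + -1 * u m x).
    apply: scontD; first exact: scont_cst.
    by apply: scontM => //; exact: scont_cst.
  apply: ereal_inf_lbound; eexists; split; last by [].
  split=> [k|x Sx [Xx Hx]].
    split; first exact: scontM.
    by move=> x Sx; rewrite mulr_ge0 ?F0// mulN1r subr_ge0.
  apply: le_trans (F2 x Sx Xx) _; apply: lee_nneseries => [k _ _|k _].
    by rewrite lee_fin F0.
  rewrite lee_fin (_ : u m x = 0) ?mulr0 ?addr0 ?mulr1//.
  have -> : u m x = Num.min 1 (m%:R * 0).
    congr (Num.min 1 (_ * _)); apply/max_idPl; rewrite subr_le0 leNgt.
    exact/negP.
  by rewrite mulr0; apply/min_idPr.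
rewrite nneseries_interchange in hH => //.
apply: le_trans (leeD2r _ hH) _.
have part m : (\sum_(0 <= j < m) \sum_(0 <= k <oo) (Lam (G k j))%:E +
    rm_outer (X `&` ~` halfspace i c) <= \sum_(0 <= k <oo) (Lam (F k))%:E)%E.
  apply: le_trans (leeD2l _ (hC m)) _.
  rewrite -nneseries_sum_nat//.
  under eq_eseriesr => k _ do rewrite sumEFin sumLG.
  have c1 : scont (fun x => 1 + -1 * u m x).
    apply: scontD; first exact: scont_cst.
    by apply: scontM => //; exact: scont_cst.
  rewrite -nneseriesD; last 2 first.
  - move=> k _ _; rewrite lee_fin; apply: Lam_ge0; first exact: scontM.
    by move=> x Sx; rewrite mulr_ge0// F0.
  - move=> k _ _; rewrite lee_fin; apply: Lam_ge0; first exact: scontM.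
    by move=> x Sx; rewrite mulr_ge0 ?F0// mulN1r subr_ge0.
  apply: lee_nneseries => [k _ _|k _].
    rewrite -EFinD lee_fin addr_ge0//; apply: Lam_ge0; do ?exact: scontM.
      by move=> x Sx; rewrite mulr_ge0// F0.
    by move=> x Sx; rewrite mulr_ge0 ?F0// mulN1r subr_ge0.
  rewrite -EFinD -LamD; do ?exact: scontM.
  rewrite lee_fin; apply: Lam_le => //.
    by apply: scontD; exact: scontM.
  by move=> x Sx; rewrite le_eqVlt; apply/orP; left; apply/eqP; ring.
move: part; set b := rm_outer (X `&` ~` _); set t := (X in (_ <= X)%E) => part.
have [->|tfin] := eqVneq t +oo%E; first exact: leey.
have b0 : (0 <= b)%E := rm_outer_ge0 _.
have bt : (b <= t)%E by have := part 0%N; rewrite big_nil add0e.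
have bfin : b \is a fin_num.
  by rewrite ge0_fin_numE// (le_lt_trans bt)// ltey.
rewrite -leeBrDr//; apply: lime_le.
  by apply: is_cvg_nneseries => j _ _; apply: nneseries_ge0.
by apply: nearW => m; rewrite leeBrDr//; exact: part.
Qed.

Definition rm_measure : set T -> \bar R := rm_outer.

Let rm_lty : (rm_outer setT <= (Lam (fun=> 1%R))%:E)%E.
Proof.
apply: ereal_inf_lbound.
exists (fun k => if k is 0%N then fun=> 1 else fun=> 0); split.
  split=> [[|k]|x _ _]; [by split => // *; exact: scont_cst|by split => // *; exact: scont_cst|].
  apply: le_trans (nneseries_lim_ge 1 _); first by rewrite big_nat1.
  by move=> [|k] _ _; rewrite lee_fin.
rewrite nneseries_recl//; last first.
  by move=> [|k] _; rewrite lee_fin ?Lam0//; apply: Lam_ge0 => //; exact: scont_cst.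
by rewrite eseries0 ?adde0// => -[//|k] _ _ /=; rewrite Lam0.
Qed.

HB.instance Definition _ := isMeasure.Build _ T R rm_measure
  rm_outer0 rm_outer_ge0 (borel_sigma_additive rm_halfspace).

Let rm_fin : fin_num_fun rm_measure.
Proof.
move=> A mA; rewrite ge0_fin_numE ?rm_outer_ge0//.
apply: le_lt_trans (le_trans (le_rm_outer (@subsetT _ A)) rm_lty) _.
exact: ltry.
Qed.

HB.instance Definition _ := @Measure_isFinite.Build _ T R rm_measure rm_fin.

Lemma rm_outside : rm_measure (~` S) = 0%E.
Proof.
apply/eqP; rewrite eq_le rm_outer_ge0 andbT.
apply: ereal_inf_lbound; exists (fun _ _ => 0); split.
  by split => // k; split => //; exact: scont_cst.
by rewrite eseries0// => k _ _; rewrite Lam0.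
Qed.

(** The lower bound is an argument of Dini type: by compactness, some finite partial sum of a cover
    of the sphere exceeds [1 - d] everywhere, and positivity of [Lam] compares it with the
    constant. *)
Lemma rm_sphere : rm_measure S = (Lam (fun=> 1))%:E.
Proof.
apply/eqP; rewrite eq_le; apply/andP; split.
  exact: le_trans (le_rm_outer (@subsetT _ _)) rm_lty.
apply: le_ereal_inf_tmp => _ [F [[F1 F2] ->]].
have cF k : scont (F k) by exact: (F1 k).1.
have F0 k x : S x -> 0 <= F k x by exact: (F1 k).2.
have LF0 k : (0 <= (Lam (F k))%:E)%E by rewrite lee_fin; apply: Lam_ge0 => // x; exact: F0.
have sumF m : scont (fun x => \sum_(0 <= k < m) F k x).
  by under eq_fun do rewrite big_mkord; exact: scont_sum.
have LsumF m : Lam (fun x => \sum_(0 <= k < m) F k x) = \sum_(0 <= k < m) Lam (F k).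
  elim: m => [|m IH].
    rewrite [RHS]big_nil -[RHS]Lam0; apply: Lam_eq => [//||x _]; first exact: scont_cst.
    by rewrite big_nil.
  rewrite big_nat_recr//= -IH -LamD//; apply: Lam_eq => [//||x _].
    exact: scontD.
  by rewrite big_nat_recr.
have L1 : 0 <= Lam (fun=> 1) by apply: Lam_ge0 => //; exact: scont_cst.
apply/lee_addgt0Pr => e e0.
(* Chosen so that [d * Lam 1 <= e]; the added 1 covers the case where [Lam] vanishes on
   constants. *)
pose d := e / (Lam (fun=> 1) + 1).
have d0 : 0 < d by rewrite divr_gt0// ltr_wpDl.
have [m hm] : exists m, forall x, S x -> 1 - d <= \sum_(0 <= k < m) F k x.
  have /compact_near_coveringP/near_covering_withinP := @sphere_compact R n.
  move=> /(_ nat \oo (fun m x => 1 - d <= \sum_(0 <= k < m) F k x)).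
  move=> /(_ _)[] => [x Sx|m _ hm]; last by exists m; exact: (hm m (leqnn m)).
  have [m hm] : exists m, 1 - d / 2 < \sum_(0 <= k < m) F k x.
    apply: contrapT => /forallNP h.
    have : (\sum_(0 <= k <oo) (F k x)%:E <= (1 - d / 2)%:E)%E.
      apply: lime_le; first by apply: is_cvg_nneseries => k _ _; rewrite lee_fin F0.
      near=> m; rewrite sumEFin lee_fin leNgt; exact/negP/h.
    move=> /(le_trans (F2 x Sx Sx)); rewrite lee_fin; apply/negP; rewrite -ltNge.
    by rewrite ltrBlDr ltrDl divr_gt0.
  have := sumF m; move=> /scontP/(_ x Sx)/cvgrPdist_lt/(_ (d / 2)).
  rewrite divr_gt0// near_withinE => /(_ isT) near_x.
  exists ([set x' | S x' -> `|\sum_(0 <= k < m) F k x - \sum_(0 <= k < m) F k x'| < d / 2],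
          [set m' | (m <= m')%N]).
    by split => //; exists m.
  move=> [x' m'] [/= h mm'] Sx'; have := h Sx'; rewrite ltr_norml => /andP[_ h2].
  apply: (@le_trans _ _ (\sum_(0 <= k < m) F k x')); last first.
    rewrite (@big_cat_nat _ _ _ m 0 m')//= lerDl sumr_ge0// => k _; exact: F0.
  move: hm h2; move: (\sum_(0 <= k < m) F k x) (\sum_(0 <= k < m) F k x') => p q; lra.
apply: (@le_trans _ _ ((Lam (fun x => \sum_(0 <= k < m) F k x))%:E + e%:E)%E); last first.
  apply: leeD2r; rewrite LsumF -sumEFin.
  by apply: nneseries_lim_ge => k _ _; exact: LF0.
rewrite -EFinD lee_fin -lerBlDr; apply: le_trans (_ : Lam (fun=> (1 - d) * 1) <= _).
  rewrite (LamZ (1 - d) (@scont_cst R n 1)) mulrBl mul1r lerB// /d mulrAC -mulrA.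
  by rewrite ler_piMr ?(ltW e0)// ler_pdivrMr ?mul1r ?lerDl// ltr_wpDl.
apply: Lam_le => //; first exact: scont_cst.
by move=> x Sx; rewrite mulr1; exact: hm.
Unshelve. all: by end_near. Qed.

Let mS : measurable (S : set T).
Proof.
rewrite -[X in measurable X]setCK; apply: measurableC; apply: sub_sigma_algebra.
apply: closed_openC.
have -> : S = @enorm R n @^-1` [set 1] by [].
by apply: closed_comp => [x _|]; [exact: enorm_continuous|exact: closed_eq].
Qed.

Let scont_measurable_sphere f : scont f -> measurable_fun (S : set T) (f : T -> R).
Proof.
move=> cf; apply: (@eq_measurable_fun _ _ _ _ _ (fun x : T => f (nrm x))).
  by move=> x /set_mem Sx; rewrite nrm_id.
apply: (@measurable_funS _ _ _ _ ([set x : 'rV[R]_n | x != 0] : set T)).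
- by apply: sub_sigma_algebra; exact: open_neq0.
- by move=> x; exact: sphere_neq0.
by apply: (continuous_borel_measurable open_neq0) => x x0; exact: scont_nrm.
Qed.

Let scont_rm_integrable f : scont f -> rm_measure.-integrable S (EFin \o f).
Proof.
move=> cf; apply: measurable_bounded_integrable => //.
- by rewrite -ge0_fin_numE ?rm_outer_ge0//; exact: rm_fin.
- exact: scont_measurable_sphere.
have [M M0 HM] := scont_bounded cf.
exists M; split; first exact: num_real.
by move=> r Mr x /HM h; apply: le_trans h _; exact: ltW.
Qed.

Let clamp_sum m (a : R) : 0 <= a ->
  \sum_(0 <= i < m) Num.min 1 (Num.max 0 (a - i%:R)) = Num.min a m%:R.
Proof.
move=> a0; elim: m => [|m IH]; first by rewrite big_nil; apply/esym/min_idPr.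
rewrite big_nat_recr//= IH -natr1; move: (m%:R : R) => k.
by rewrite /Num.min /Num.max; repeat case: ifPn; rewrite -?leNgt => *; lra.
Qed.

Let count_sum m (a : R) :
  Num.min (a - 1) m%:R <= \sum_(0 <= i < m) ((i%:R + 1 <= a)%R : nat)%:R.
Proof.
elim: m => [|m IH]; first by rewrite big_nil ge_min lexx orbT.
have aux (s k : R) : Num.min (a - 1) k <= s -> Num.min (a - 1) (k + 1) <= s + ((k + 1 <= a)%R : nat)%:R.
  by case: (leP (k + 1) a) => h; rewrite ?mulr1n ?mulr0n /Num.min;
    repeat case: ifPn; rewrite -?leNgt => *; lra.
by rewrite big_nat_recr//= -natr1; exact: aux.
Qed.

Let rm_superlevel u m i : scont u ->
  (rm_measure [set x | S x /\ (i%:R + 1 <= m%:R * u x)%R] <=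
    (Lam (fun x => Num.min 1 (Num.max 0 (m%:R * u x + - i%:R)))%R)%:E)%E.
Proof.
move=> cu; set v := (X in (Lam X)%:E).
have cv : scont v.
  apply: scont_min; first exact: scont_cst.
  apply: scont_max; first exact: scont_cst.
  apply: scontD; last exact: scont_cst.
  by apply: scontM => //; exact: scont_cst.
have v0 x : 0 <= v x by rewrite /v le_min ler01 le_max lexx.
apply: ereal_inf_lbound.
exists (fun k => if k is 0%N then v else (fun _ : 'rV[R]_n => 0)); split.
  split=> [[|k]|x _ [Sx h]]; [by split|by split => // *; exact: scont_cst|].
  apply: le_trans (nneseries_lim_ge 1 _); last by move=> [|k] _ _; rewrite lee_fin.
  rewrite big_nat1 lee_fin le_min lexx le_max; apply/orP; right.
  by rewrite lerBrDr addrC.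
rewrite nneseries_recl//; last first.
  by move=> [|k] _; rewrite lee_fin ?Lam0//; apply: Lam_ge0.
by rewrite eseries0 ?adde0// => -[//|k] _ _ /=; rewrite Lam0.
Qed.

(** The function [m u] is cut into the [m] layers [v i], its clampings to height 1 above level [i],
    whose sum is [m u] again. Each [v i] covers the superlevel set [A i] where [m u >= i + 1], and
    the number of these sets containing a point is at least [m u - 1]. Hence the integral of [m u]
    is at most [Lam 1 + m Lam u]; after division by [m] the error is at most [e]. *)
Let rm_int_le u : scont u -> (forall x, S x -> 0 <= u x <= 1) ->
  \int[rm_measure]_(x in S) u x <= Lam u.
Proof.
move=> cu u01; have L1 : 0 <= Lam (fun=> 1) by apply: Lam_ge0 => //; exact: scont_cst.
have iu := scont_rm_integrable cu.
have fin : (\int[rm_measure]_(x in S) (u x)%:E)%E \is a fin_num by exact: integrable_fin_num.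
apply/ler_addgt0Pr => e e0.
pose m := (Num.truncn (Lam (fun=> 1) / e)).+1.
have me : Lam (fun=> 1) <= m%:R * e by rewrite -ler_pdivrMr//; exact/ltW/truncnS_gt.
have m0 : 0 < m%:R :> R by [].
rewrite -(ler_pM2l m0) mulrDr.
apply: (@le_trans _ _ (Lam (fun=> 1) + m%:R * Lam u)); last by rewrite addrC lerD2l.
pose A i : set T := [set x | S x /\ (i%:R + 1 <= m%:R * u x)%R].
have mA i : measurable (A i).
  have -> : A i = S `&` (fun x => m%:R * u x) @^-1` `[i%:R + 1, +oo[.
    by apply/seteqP; split => x; rewrite /A/= in_itv/= andbT.
  suff : measurable_fun (S : set T) (fun x => m%:R * u x) by apply.
  by apply: scont_measurable_sphere; apply: scontM => //; exact: scont_cst.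
have step : (m%:R%:E * \int[rm_measure]_(x in S) (u x)%:E <=
    rm_measure S + \sum_(0 <= i < m) rm_measure (A i))%E.
  rewrite -integralZl// -[X in (X + _)%E](mul1e) -integral_cst//.
  have -> : (\sum_(0 <= i < m) rm_measure (A i) =
      \int[rm_measure]_(x in S) (\sum_(0 <= i < m) (\1_(A i) x)%:E))%E.
    rewrite ge0_integral_sum//; last first.
      by move=> i; apply/measurable_EFinP; exact: measurable_indic.
    apply: eq_bigr => i _; rewrite integral_indic//; congr (rm_measure _).
    by apply/seteqP; split => x; [move=> Ax; split => //; case: Ax|case].
  rewrite -ge0_integralD//; last 2 first.
    by move=> x _; apply: sume_ge0 => i _; rewrite lee_fin.
    by apply: emeasurable_sum => i; apply/measurable_EFinP; exact: measurable_indic.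
  apply: ge0_le_integral => //.
  - by move=> x /u01/andP[? _]; rewrite mule_ge0// lee_fin.
  - apply/measurable_EFinP; apply: scont_measurable_sphere.
    by apply: scontM => //; exact: scont_cst.
  - apply: emeasurable_funD => //.
    by apply: emeasurable_sum => i; apply/measurable_EFinP; exact: measurable_indic.
  - move=> x Sx; rewrite sumEFin -EFinD -EFinM lee_fin addrC -lerBlDr.
    have /andP[h0 h1] := u01 x Sx.
    apply: le_trans (_ : Num.min (m%:R * u x - 1) m%:R <= _).
      by rewrite le_min lexx lerBlDr (@le_trans _ _ m%:R)// ?ler_piMr// lerDl.
    apply: le_trans (count_sum m (m%:R * u x)) _; apply: ler_sum => i _.
    by rewrite indicE /A ler_nat; case: (boolP (_ <= _)%R) => // h; rewrite mem_set.
move: step; rewrite rm_sphere -(fineK fin) -EFinM -/(Rintegral _ _ _) => step.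
rewrite -lee_fin; apply: le_trans step _; rewrite EFinD; apply: leeD2l.
pose v i x := Num.min 1 (Num.max 0 (m%:R * u x + - i%:R)).
have cv i : scont (v i).
  apply: scont_min; first exact: scont_cst.
  apply: scont_max; first exact: scont_cst.
  apply: scontD; last exact: scont_cst.
  by apply: scontM => //; exact: scont_cst.
apply: (@le_trans _ _ (\sum_(0 <= i < m) (Lam (v i))%:E)%E).
  by apply: lee_sum => i _; exact: rm_superlevel.
have Lsum k : Lam (fun x => \sum_(0 <= i < k) v i x) = \sum_(0 <= i < k) Lam (v i).
  elim: k => [|k IH].
    rewrite [RHS]big_nil -[RHS]Lam0; apply: Lam_eq => [||x _].
    - by under eq_fun do rewrite big_mkord; exact: scont_sum.
    - exact: scont_cst.
    - by rewrite big_nil.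
  rewrite big_nat_recr//= -IH -LamD//; last first.
    by under eq_fun do rewrite big_mkord; exact: scont_sum.
  apply: Lam_eq => [||x _].
  - by under eq_fun do rewrite big_mkord; exact: scont_sum.
  - apply: scontD => //; by under eq_fun do rewrite big_mkord; exact: scont_sum.
  - by rewrite big_nat_recr.
rewrite sumEFin -Lsum lee_fin -LamZ//; apply: Lam_le.
- by under eq_fun do rewrite big_mkord; exact: scont_sum.
- by apply: scontM => //; exact: scont_cst.
- move=> x Sx; have /andP[h0 h1] := u01 x Sx.
  by rewrite /v clamp_sum ?mulr_ge0// ge_min lexx.
Qed.

Let rm_int_cst c : \int[rm_measure]_(x in S) c = c * Lam (fun=> 1).
Proof. by rewrite Rintegral_cst// -[Lam _]/(fine (Lam (fun=> 1))%:E) -rm_sphere. Qed.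

(** The upper bound applied to [1 - u] is the lower bound for [u], because the total mass is exactly
    [Lam 1]. *)
Let rm_int01 u : scont u -> (forall x, S x -> 0 <= u x <= 1) ->
  \int[rm_measure]_(x in S) u x = Lam u.
Proof.
move=> cu u01; apply/eqP; rewrite eq_le rm_int_le//=.
have c1 : scont (fun _ : 'rV[R]_n => 1 : R) by exact: scont_cst.
have cN : scont (fun x => -1 * u x) by apply: scontM => //; exact: scont_cst.
have := @rm_int_le (fun x => 1 + -1 * u x).
rewrite LamD// LamZ// RintegralD//; last 2 first.
- exact: scont_rm_integrable c1.
- exact: scont_rm_integrable cN.
rewrite RintegralZl//; last exact: scont_rm_integrable.
rewrite rm_int_cst mul1r lerD2l !mulN1r lerN2; apply.
  exact: scontD.
by move=> x /u01; move: (u x) => a /andP[? ?]; apply/andP; split; lra.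
Qed.

Theorem riesz_markov : exists nu : {finite_measure set T -> \bar R},
  nu (~` (S : set T)) = 0%E /\
  forall f, scont f -> (\int[nu]_(x in (S : set T)) (f x)%:E = (Lam f)%:E)%E.
Proof.
exists rm_measure; split => [|f cf]; first exact: rm_outside.
have iff := scont_rm_integrable cf.
rewrite -[LHS]fineK; last exact: integrable_fin_num.
congr EFin; rewrite -/(Rintegral _ _ _).
have [M M0 HM] := scont_bounded cf.
(* The affine map [f |-> 1/2 + k f] brings the values of [f] into the unit interval, where
   [rm_int01] applies. *)
pose k := (2 * M)^-1; have k0 : 0 < k by rewrite invr_gt0 mulr_gt0.
have kM : k * M = 2^-1 by rewrite /k invfM mulfVK// gt_eqF.
have cg : scont (fun x => 2^-1 + k * f x).
  by apply: scontD; [exact: scont_cst|apply: scontM => //; exact: scont_cst].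
have c2 : scont (fun _ : 'rV[R]_n => 2^-1 : R) by exact: scont_cst.
have c1 : scont (fun _ : 'rV[R]_n => 1 : R) by exact: scont_cst.
have ckf : scont (fun x => k * f x) by apply: scontM => //; exact: scont_cst.
have := @rm_int01 _ cg; rewrite LamD// LamZ// RintegralD//; last 2 first.
- exact: scont_rm_integrable c2.
- exact: scont_rm_integrable ckf.
rewrite RintegralZl// rm_int_cst.
have -> : Lam (fun=> 2^-1) = 2^-1 * Lam (fun=> 1).
  by rewrite -LamZ//; congr Lam; apply/funext => x; rewrite mulr1.
move=> h; have /h/addrI/(mulfI (lt0r_neq0 k0)) : forall x, S x -> 0 <= 2^-1 + k * f x <= 1.
  move=> x /HM; rewrite -(ler_pM2l k0) kM -[X in X * `|_|](gtr0_norm k0) -normrM.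
  by rewrite ler_norml => /andP[? ?]; apply/andP; split; lra.
by [].
Qed.

End riesz_markov.

(** * Intersection bodies and duality *)

Section duality.
Context {R : realType} {n : nat}.
Local Notation S := (@sphere R n.+2).
Variable N : 'rV[R]_n.+2 -> R.
Hypothesis cN : scont N.
Hypothesis N_gt0 : forall x, S x -> 0 < N x.

Let J f := Sph (fun x => (N x)^-1 * f x).
Let cNV : scont (fun x => (N x)^-1).
Proof. by apply: scontV => // x /N_gt0/lt0r_neq0. Qed.
Let cJ f : scont f -> scont (fun x => (N x)^-1 * f x).
Proof. exact: scontM. Qed.

Hypothesis J_ge0 : forall f, scont f -> (forall xi, S xi -> 0 <= Rad f xi) -> 0 <= J f.

Let JD f g : scont f -> scont g -> J (fun x => f x + g x) = J f + J g.
Proof.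
move=> cf cg; rewrite /J -SphD; [|exact: cJ..].
by apply: eq_Sph => x _; rewrite mulrDr.
Qed.

Let JZ a f : scont f -> J (fun x => a * f x) = a * J f.
Proof.
move=> cf; rewrite /J -SphZ; last exact: cJ.
by apply: eq_Sph => x _; rewrite mulrCA.
Qed.

Let V := ('rV[R]_n.+2 -> R^o).
Let D : set V := [set g | exists M, forall x, S x -> `|g x| <= M].
Let E (g : V) := [set J f | f in [set f | scont f /\ forall xi, S xi -> g xi <= Rad f xi]].
(** The least cost [J f] of a continuous [f] whose Radon transform dominates [g]. It is finite on
    bounded functions: constants are Radon transforms of constants, and [J_ge0] bounds the cost from
    below. A linear functional below [p] is nonnegative on nonnegative functions, since
    [p (- g) <= J 0 = 0] when [g >= 0]; it equals [J f] on [Rad f], since it is at most [J] there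
    and the same holds for [- f]. *)
Let p (g : V) := inf (E g).

Let w : R := n.+1%:R * fine (vol (@eball R n.+1)).
Let w0 : 0 < w. Proof. by rewrite mulr_gt0// fine_vol_eball_gt0. Qed.

Let infE g : D g -> has_inf (E g).
Proof.
move=> [M HM]; split.
  exists (J (fun=> M / w)), (fun=> M / w) => //; split; first exact: scont_cst.
  move=> xi S; rewrite Rad_cst -/w mulfVK ?gt_eqF//.
  exact: le_trans (ler_norm _) (HM _ S).
exists (- (J (fun=> M / w))) => _ [f [cf gf] <-].
rewrite -subr_ge0 opprK -JD//; last exact: scont_cst.
apply: J_ge0; first by apply: scontD => //; exact: scont_cst.
move=> xi Sx; rewrite RadD//; last exact: scont_cst.
rewrite Rad_cst -/w mulfVK ?gt_eqF// -lerBlDr sub0r.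
by apply: le_trans (gf xi Sx); have := HM xi Sx; rewrite ler_norml => /andP[].
Qed.

Let p_le g f : D g -> scont f -> (forall xi, S xi -> g xi <= Rad f xi) -> p g <= J f.
Proof. by move=> Dg cf gf; apply: ge_inf; [exact: (infE Dg).2|exists f]. Qed.

Let le_p a g : D g ->
  (forall f, scont f -> (forall xi, S xi -> g xi <= Rad f xi) -> a <= J f) -> a <= p g.
Proof.
move=> Dg h; apply: lb_le_inf; first exact: (infE Dg).1.
by move=> _ [f [cf gf] <-]; exact: h.
Qed.

Let D_add g h : D g -> D h -> D (g + h).
Proof.
move=> [M HM] [M' HM']; exists (M + M') => x Sx.
by rewrite (le_trans (ler_normD _ _))// lerD// ?HM ?HM'.
Qed.

Let D_scale (a : R) g : D g -> D (a *: g).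
Proof.
move=> [M HM]; exists (`|a| * M) => x Sx; rewrite normrM.
by rewrite ler_wpM2l// HM.
Qed.

Let J0 : J (fun=> 0) = 0.
Proof.
have := @JZ 0 (fun=> 0) (@scont_cst R _ 0); rewrite [RHS]mul0r => h.
by rewrite -[RHS]h; apply: eq_Sph => x _; rewrite mul0r.
Qed.

Let p_sub : sublinear D p.
Proof.
split=> [g h Dg Dh|a g a0 Dg].
  rewrite -lerBlDr; apply: le_p => // f cf gf; rewrite lerBlDr -lerBlDl.
  apply: le_p => // f' cf' gf'; rewrite lerBlDl -JD//.
  apply: p_le; [exact: D_add|exact: scontD|move=> xi S].
  by rewrite RadD// lerD ?gf ?gf'.
move: a0; rewrite le_eqVlt => /predU1P[<-|a0].
  rewrite mul0r -[leRHS]J0; apply: p_le; [exact: D_scale|exact: scont_cst|move=> xi S].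
  by rewrite Rad_cst mul0r -[leLHS]/(0 * g xi) mul0r.
rewrite mulrC -ler_pdivrMr//; apply: le_p => // f cf gf.
rewrite ler_pdivrMr// mulrC -JZ//; apply: p_le; first exact: D_scale.
  by apply: scontM => //; exact: scont_cst.
by move=> xi S; rewrite RadZ// ler_pM2l// gf.
Qed.

Let scont_D f : scont f -> D f.
Proof. by move=> /scont_bounded[M _ HM]; exists M. Qed.

Theorem radon_representation : exists nu : {finite_measure set (@borelRn R n.+2) -> \bar R},
  nu (~` (S : set (@borelRn R n.+2))) = 0%E /\
  forall f, scont f -> (\int[nu]_(x in (S : set (@borelRn R n.+2))) (Rad f x)%:E = (J f)%:E)%E.
Proof.
have [Lam [LamD LamZ Lamp]] := hahn_banach D_add D_scale p_sub.
have [|||nu [nu0 nuE]] := @riesz_markov R n.+2 Lam.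
- by move=> f g cf cg; apply: LamD; exact: scont_D.
- by move=> a f cf; apply: LamZ; exact: scont_D.
- move=> f cf f0; rewrite -oppr_le0 -mulN1r -LamZ; last exact: scont_D.
  apply: le_trans (Lamp _ _) _; first by apply: D_scale; exact: scont_D.
  rewrite -[leRHS]J0; apply: p_le; [by apply: D_scale; exact: scont_D|exact: scont_cst|].
  by move=> xi S; rewrite Rad_cst mul0r -[leLHS]/(-1 * f xi) mulN1r oppr_le0 f0.
exists nu; split => // f cf; rewrite nuE; last exact: scont_Rad.
have DR : D (Rad f) by apply/scont_D/scont_Rad.
congr EFin; apply/eqP; rewrite eq_le; apply/andP; split.
  by apply: le_trans (Lamp _ DR) _; exact: p_le.
rewrite -lerN2 -[leLHS]mulN1r -[leRHS]mulN1r -LamZ// -JZ//; apply: le_trans (Lamp _ (D_scale _ DR)) _.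
apply: p_le; first exact: D_scale.
  by apply: scontM => //; exact: scont_cst.
by move=> xi S; rewrite RadZ.
Qed.

End duality.

Lemma not_intersection_body {R : realType} {n : nat} (L : set 'rV[R]_n.+2) :
  scont (mink L) -> (forall x, sphere n.+2 x -> 0 < mink L x) ->
  ~ intersection_body L ->
  exists f, [/\ scont f, forall xi, sphere n.+2 xi -> 0 <= Rad f xi &
    Sph (fun x => (mink L x)^-1 * f x) < 0].
Proof.
move=> cN N0; apply: contra_notP => h.
have [|nu [nu0 nuE]] := radon_representation cN N0.
  move=> f cf Rf; rewrite leNgt; apply/negP => Jf; apply: h.
  by exists f.
exists nu; split => // f cf; rewrite sphint_Sph; last first.
  by apply: scontM => //; apply: scontV => // x /N0/lt0r_neq0.
rewrite -nuE//; apply: eq_integral => x /set_mem Sx.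
by rewrite radon_Rad.
Qed.

(** * Gauges of symmetric convex bodies *)

Section gauge_def.
Context {R : realType} {n : nat}.
Implicit Types M : 'rV[R]_n -> R.

(** A norm on the space. The last field compares it with the Euclidean norm and, with subadditivity,
    makes it Lipschitz. *)
Record gauge M := Gauge {
  gaugeZ : forall a x, 0 <= a -> M (a *: x) = a * M x;
  gaugeD : forall x y, M (x + y) <= M x + M y;
  gaugeN : forall x, M (- x) = M x;
  gauge_gt0 : forall x, x != 0 -> 0 < M x;
  gauge_ub : exists2 C, 0 < C & forall x, M x <= C * enorm x }.

Lemma lipschitz_continuous M C : 0 < C ->
  (forall x y, `|M x - M y| <= C * enorm (x - y)) -> continuous M.
Proof.
move=> C0 lip x; apply/(@cvgrPdist_lt _ _ _ (nbhs x) (nbhs_filter x)) => e e0.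
have := @near_enorm R n x (e / C) (divr_gt0 e0 C0); apply: filterS => y xy.
by rewrite (le_lt_trans (lip _ _))// mulrC -ltr_pdivlMr.
Qed.

Lemma gauge_lipschitz M C : gauge M -> (forall x, M x <= C * enorm x) ->
  forall x y, `|M x - M y| <= C * enorm (x - y).
Proof.
move=> gM hC x y.
have h u v : M u - M v <= C * enorm (u - v).
  by rewrite lerBlDr; apply: le_trans (lerD (hC _) (lexx _)); have := gaugeD gM (u - v) v; rewrite subrK.
by rewrite ler_norml h andbT lerNl opprB -[enorm (x - y)]enormN opprB h.
Qed.

Lemma gauge_continuous M : gauge M -> continuous M.
Proof.
move=> gM; have [C C0 hC] := gauge_ub gM.
exact: lipschitz_continuous C0 (gauge_lipschitz gM hC).
Qed.

Lemma gauge0 M : gauge M -> M 0 = 0.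
Proof. by move=> gM; rewrite -(scale0r (0 : 'rV[R]_n)) gaugeZ// mul0r. Qed.

Lemma gauge_ge0 M x : gauge M -> 0 <= M x.
Proof.
move=> gM; have [->|x0] := eqVneq x 0; first by rewrite gauge0.
exact/ltW/gauge_gt0.
Qed.

Lemma gauge_scont M : gauge M -> scont M.
Proof. by move=> gM; apply: scont_at => x _; exact: gauge_continuous. Qed.

Lemma gauge_lb M : gauge M -> exists2 c, 0 < c & forall x, c * enorm x <= M x.
Proof.
move=> gM; have [|c c0 hc] := scont_pos_lbound (gauge_scont gM).
  by move=> x /sphere_neq0; exact: gauge_gt0.
exists c => // x; have [->|x0] := eqVneq x 0; first by rewrite enorm0 mulr0 gauge0.
have := hc _ (sphere_normalize x0); rewrite gaugeZ ?invr_ge0 ?enorm_ge0//.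
by rewrite ler_pdivlMl ?enorm_gt0// mulrC.
Qed.

Lemma gauge_body M : gauge M ->
  convex_body [set x | M x <= 1] /\ origin_symmetric [set x | M x <= 1].
Proof.
move=> gM; split; last by move=> x /=; rewrite gaugeN.
split.
- apply: bounded_closed_compact.
    have [c c0 hc] := gauge_lb gM.
    exists c^-1; split; first exact: num_real.
    move=> r cr x /= Mx; apply: le_trans (norm_le_enorm x) _; apply: le_trans (ltW cr).
    by rewrite -[leRHS]mulr1 -ler_pdivrMl ?invr_gt0// invrK (le_trans (hc x)).
  have -> : [set x | M x <= 1] = M @^-1` [set r | r <= 1] by [].
  by apply: closed_comp => [x _|]; [exact: gauge_continuous|exact: closed_le].
- move=> x y t /= Mx My /andP[t0 t1]; rewrite (le_trans (gaugeD gM _ _))//.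
  rewrite !gaugeZ ?subr_ge0//; have : 0 <= 1 - t by rewrite subr_ge0.
  move: (M x) (M y) Mx My => a b *; nra.
- exists 0; rewrite /interior; have c0 : {for 0, continuous M} := @gauge_continuous M gM 0.
  have : \forall x \near (0 : 'rV[R]_n), M x < 1.
    by apply: (cvgr_lt _ c0); rewrite gauge0.
  by apply: filterS => x /ltW.
Qed.

End gauge_def.

Section mink.
Context {R : realType} {n : nat}.
Variable L : set 'rV[R]_n.
Hypothesis bodyL : convex_body L.
Hypothesis symL : origin_symmetric L.
Local Notation N := (mink L).

Let cvxL := let: And3 _ h _ := bodyL in h.

(** If [L] contains a ball around [x0], it contains by symmetry the ball around [- x0]; every small
    [x] is the midpoint of [x0 + x] and [- (x0 - x)]. *)
Lemma body_eball : exists2 r : R, 0 < r & forall x, enorm x <= r -> L x.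
Proof.
have [_ _ [x0]] := bodyL; rewrite /interior => /nbhs_ballP[e /= e0 he].
exists (e / 2); first by rewrite divr_gt0.
move=> x xe.
have h (v : 'rV[R]_n) : enorm v <= e / 2 -> L (x0 + v).
  move=> ve; apply: he; rewrite mx_norm_ball /ball_/= opprD addrA subrr sub0r normrN.
  rewrite (le_lt_trans (norm_le_enorm _))// (le_lt_trans ve)//.
  by rewrite ltr_pdivrMr// ltr_pMr// ltr1n.
have h1 := h x xe; have h2 : L (- (x0 - x)) by apply/symL/h; rewrite enormN.
have t01 : 0 <= (2^-1 : R) <= 1 by apply/andP; split; lra.
have := cvxL h1 h2 t01.
have -> : 1 - 2^-1 = 2^-1 :> R by lra.
have -> : 2^-1 *: (x0 + x) + 2^-1 *: - (x0 - x) = x; last by [].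
by apply/rowP => i; rewrite !mxE; field.
Qed.

Let L0 : L 0.
Proof. by have [r r0 h] := body_eball; apply: h; rewrite enorm0 ltW. Qed.

Let A x := [set a : R | 0 <= a /\ exists y, L y /\ x = a *: y].

Let A_up x a b : A x a -> a <= b -> A x b.
Proof.
move=> [a0 [y [Ly ->]]]; rewrite le_eqVlt => /predU1P[<-|ab]; first by split => //; exists y.
have b0 : 0 < b by exact: le_lt_trans ab.
split; first exact: ltW.
exists ((a / b) *: y); split; last by rewrite scalerA mulrCA mulfV ?gt_eqF// mulr1.
rewrite -[_ *: y]addr0 -(scaler0 _ (1 - a / b)); apply: cvxL => //.
by rewrite divr_ge0 ?(ltW b0)//= ler_pdivrMr// mul1r ltW.
Qed.

Let A_ub r x : 0 < r -> (forall x, enorm x <= r -> L x) -> A x (enorm x / r).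
Proof.
move=> r0 h; have [->|x0] := eqVneq x 0.
  by rewrite enorm0 mul0r; split => //; exists 0; rewrite scaler0.
split; first by rewrite divr_ge0 ?enorm_ge0// ltW.
exists ((r / enorm x) *: x); split.
  apply: h; rewrite enormZ ger0_norm ?divr_ge0 ?enorm_ge0 ?(ltW r0)//.
  by rewrite mulfVK// enorm_eq0.
by rewrite scalerA mulrA mulfVK ?gt_eqF// mulfV ?scale1r// enorm_eq0.
Qed.

Let A_inf x : has_inf (A x).
Proof.
have [r r0 h] := body_eball; split; first by exists (enorm x / r); exact: A_ub.
by exists 0 => a [].
Qed.

Let N_le x a : A x a -> N x <= a.
Proof. by move=> Aa; apply: ge_inf => //; exact: (A_inf x).2. Qed.

Let N_lt x b : N x < b -> A x b.
Proof.
move=> Nb; have e0 : 0 < b - N x by rewrite subr_gt0.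
have [a Aa] := inf_adherent e0 (A_inf x); rewrite addrC subrK => ab.
exact: A_up Aa (ltW ab).
Qed.

Let N_ge x a : (forall b, A x b -> a <= b) -> a <= N x.
Proof. by move=> h; apply: lb_le_inf; [exact: (A_inf x).1|exact: h]. Qed.

Lemma mink_gauge : gauge N.
Proof.
have Z1 a x : 0 < a -> N (a *: x) <= a * N x.
  move=> a0; rewrite mulrC -ler_pdivrMr//; apply: N_ge => b [b0 [y [Ly ->]]].
  rewrite ler_pdivrMr//; apply: N_le; split; first by rewrite mulr_ge0// ltW.
  by exists y; split => //; rewrite scalerA mulrC.
have N0 : N 0 = 0.
  apply/eqP; rewrite eq_le; apply/andP; split; last by apply: N_ge => b [].
  by apply: N_le; split => //; exists 0; rewrite scaler0.
split.
- move=> a x; rewrite le_eqVlt => /predU1P[<-|a0]; first by rewrite scale0r mul0r.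
  apply/eqP; rewrite eq_le Z1//=; have := Z1 a^-1 (a *: x).
  by rewrite invr_gt0 => /(_ a0); rewrite scalerA mulVf ?gt_eqF// scale1r ler_pdivlMl.
- move=> x y; rewrite -lerBlDr; apply: N_ge => a [a0 [u [Lu xE]]].
  rewrite lerBlDr -lerBlDl; apply: N_ge => b [b0 [v [Lv yE]]]; rewrite lerBlDl.
  have : 0 <= a + b by rewrite addr_ge0.
  rewrite le_eqVlt => /predU1P[ab|ab].
    have [a00 b00] : a = 0 /\ b = 0 by split; lra.
    by rewrite xE yE a00 b00 !scale0r !addr0 N0.
  apply: N_le; split; first exact: ltW.
  exists ((a / (a + b)) *: u + (1 - a / (a + b)) *: v); split.
    by apply: cvxL => //; rewrite divr_ge0 ?(ltW ab)//= ler_pdivrMr// mul1r lerDl.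
  rewrite xE yE scalerDr !scalerA; congr (_ *: _ + _ *: _); field; by rewrite gt_eqF.
- have h x : N (- x) <= N x.
    apply: N_ge => b [b0 [y [Ly ->]]]; apply: N_le; split => //.
    by exists (- y); rewrite scalerN; split => //; exact: symL.
  by move=> x; apply/eqP; rewrite eq_le h/= -{1}(opprK x) h.
- have [cL _ _] := bodyL; have [M [_ HM]] := compact_bounded cL.
  pose B := n%:R * (`|M| + 1) + 1.
  have B0 : 0 < B by rewrite ltr_wpDl// mulr_ge0// addr_ge0.
  have LB y : L y -> enorm y <= B.
    move=> Ly; apply: le_trans (enorm_le_norm y) _; rewrite ler_wpDr// ler_wpM2l//.
    by apply: HM => //; rewrite (le_lt_trans (ler_norm M))// ltrDl.
  move=> x x0; apply: (@lt_le_trans _ _ (enorm x / B)); first by rewrite divr_gt0 ?enorm_gt0.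
  apply: N_ge => b [b0 [y [Ly ->]]]; rewrite enormZ ger0_norm// ler_pdivrMr//.
  by rewrite ler_wpM2l// LB.
- have [r r0 h] := body_eball; exists r^-1; first by rewrite invr_gt0.
  by move=> x; rewrite mulrC; apply: N_le; exact: A_ub.
Qed.

Lemma mink_body : L = [set x | N x <= 1].
Proof.
apply/seteqP; split => x /=.
  by move=> Lx; apply: N_le; split => //; exists x; rewrite scale1r.
move=> Nx; have [cL _ _] := bodyL.
have clL : closed L by apply: compact_closed => //; exact: norm_hausdorff.
have h k : L ((1 + k.+1%:R^-1)^-1 *: x).
  have k0 : 0 < k.+1%:R^-1 :> R by rewrite invr_gt0.
  have [|_ [y [Ly ->]]] := @N_lt x (1 + k.+1%:R^-1); first by rewrite (le_lt_trans Nx)// ltrDl.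
  by rewrite scalerA mulVf ?scale1r// gt_eqF// addr_gt0.
apply: (@closed_cvg _ _ \oo _ (fun k : nat => (1 + k.+1%:R^-1)^-1 *: x) L clL).
  by apply: nearW => k; exact: h.
rewrite -[X in _ --> X]scale1r; apply: cvgZr_tmp.
rewrite -[X in _ --> X]invr1; apply: cvgV; first exact: oner_neq0.
rewrite -[X in _ --> X](addr0 1); apply: cvgD; first exact: cvg_cst.
exact: cvg_harmonic.
Qed.

End mink.

(** * Strong convexity from positive curvature *)

Section directional.
Context {R : realType} {n : nat}.
Local Notation V := 'rV[R]_n.
Implicit Types (f : V -> R) (x u v w : V).

Definition quot f x v (h : R) : R := h^-1 * (f (h *: v + x) - f x).

Lemma derive_cvg f x v l : quot f x v @ 0^' --> l -> 'D_v f x = l.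
Proof. by move=> h; apply: cvg_lim => //; exact: norm_hausdorff. Qed.

Lemma derivable_cvg f x v : derivable f x v -> quot f x v @ 0^' --> 'D_v f x.
Proof. by []. Qed.

Lemma is_derive_line f x w s : derivable f (x + s *: w) w ->
  is_derive s 1 (fun s => f (x + s *: w)) ('D_w f (x + s *: w)).
Proof.
have e : (fun h => h^-1 *: (((fun s => f (x + s *: w)) \o shift s) (h *: 1) - f (x + s *: w)))
    = (fun h => h^-1 *: ((f \o shift (x + s *: w)) (h *: w) - f (x + s *: w))).
  apply/funext => h /=; congr (_ *: (f _ - _)).
  by rewrite -[h *: 1]/(h * 1) mulr1 scalerDl addrCA.
by move=> df; apply: DeriveDef; rewrite /derivable /derive /= e.
Qed.

Lemma derive_dirZ f x v a : derivable f x v -> 'D_(a *: v) f x = a * 'D_v f x.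
Proof.
move=> df; have [->|a0] := eqVneq a 0; first by rewrite scale0r derive0 mul0r.
apply: derive_cvg.
have -> : quot f x (a *: v) = (fun h => a * quot f x v (h * a)).
  apply/funext => h; rewrite /quot scalerA; have [->|h0] := eqVneq h 0.
    by rewrite !mul0r scale0r add0r subrr !mulr0.
  by move: (f _ - f _) => Y; field; rewrite h0 a0.
apply: cvgM; first exact: cvg_cst.
apply: (@cvg_comp _ _ _ (fun h : R => h * a) (quot f x v) _ (0 : R)^').
  move=> A; rewrite /dnbhs /within/= => /nbhs_ballP[e /= e0 he].
  have e'0 : 0 < e / `|a| by rewrite divr_gt0// normr_gt0.
  apply/nbhs_ballP; exists (e / `|a|) => // h /= hb h0; apply: he; last by rewrite mulf_neq0.
  move: hb; rewrite /ball/= !sub0r !normrN normrM.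
  by rewrite ltr_pdivlMr// normr_gt0.
exact: derivable_cvg.
Qed.

Definition C1 (O : set V) f := forall x, O x ->
  forall v, derivable f x v /\ {for x, continuous (fun z => 'D_v f z)}.

(** [smooth_on] speaks of directional derivatives only, so their linearity in the direction has to
    be proved. The increment along [h (u + v)] is taken first along [h u] and then along [h v]; on
    the second leg the mean value theorem and the continuity of the derivative along [v] give the
    limit. *)
Lemma derive_dirD (O : set V) f x u v : open O -> C1 O f -> O x ->
  'D_(u + v) f x = 'D_u f x + 'D_v f x.
Proof.
move=> oO cf Ox; apply: derive_cvg.
pose q h : R := h^-1 * (f (h *: u + x + h *: v) - f (h *: u + x)).
have -> : quot f x (u + v) = (fun h => quot f x u h + q h).
  apply/funext => h; rewrite /quot /q -mulrDr; congr (_ * _).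
  by rewrite [RHS]addrC [RHS]addrA subrK scalerDr addrAC.
apply: cvgD; first exact/derivable_cvg/(cf x Ox u).1.
apply/cvgrPdist_le => e e0.
have [d d0 hd] : exists2 d, 0 < d &
    forall z, enorm (z - x) < d -> O z /\ `|'D_v f x - 'D_v f z| <= e.
  have /cvgrPdist_le/(_ e e0) H := (cf x Ox v).2.
  have oOx : \forall z \near x, O z by exact: open_nbhs_nbhs.
  have /nbhs_ballP[d /= d0 hd] : \forall z \near x, O z /\ `|'D_v f x - 'D_v f z| <= e.
    by apply: filterS2 oOx H => z.
  exists d => // z zx; apply: hd; rewrite mx_norm_ball /ball_/= -normrN opprB.
  by rewrite (le_lt_trans (norm_le_enorm _)).
(* With [|h| < d / K] the whole second leg stays within distance [d] of [x]. *)
pose K := enorm u + enorm v + 1.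
have K0 : 0 < K by rewrite ltr_wpDl// addr_ge0 ?enorm_ge0.
near=> h.
have h0 : h != 0 by near: h; exact: nbhs_dnbhs_neq.
have hK : `|h| < d / K by near: h; apply: dnbhs0_lt; exact: divr_gt0.
have inO (s : R) : 0 <= s <= 1 -> enorm (h *: u + x + s *: (h *: v) - x) < d.
  move=> /andP[s0 s1]; rewrite addrAC addrK.
  apply: le_lt_trans (enorm_triangle _ _) _; rewrite !enormZ (ger0_norm s0).
  apply: (@le_lt_trans _ _ (`|h| * K)); last by rewrite -ltr_pdivlMr.
  rewrite /K mulrDr mulrDr mulr1 -addrA lerD2l (@le_trans _ _ (`|h| * enorm v))//.
    by rewrite ler_piMl// mulr_ge0// enorm_ge0.
  by rewrite lerDl.
have dl (s : R) : 0 <= s <= 1 -> is_derive s 1 (fun s : R => f (h *: u + x + s *: (h *: v)))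
    (h * 'D_v f (h *: u + x + s *: (h *: v))).
  move=> /inO/hd[Oz _]; rewrite -derive_dirZ; last exact: (cf _ Oz v).1.
  exact/is_derive_line/(cf _ Oz _).1.
have [||c] := @MVT R (fun s => f (h *: u + x + s *: (h *: v)))
    (fun s => h * 'D_v f (h *: u + x + s *: (h *: v))) 0 1 ltr01.
- by move=> s; rewrite in_itv/= => /andP[/ltW s0 /ltW s1]; apply: dl; rewrite s0.
- apply: derivable_within_continuous => s; rewrite in_itv/= => s01.
  by have [] := dl s s01.
rewrite in_itv/= => /andP[/ltW c0 /ltW c1]; rewrite scale1r scale0r addr0 subr0 mulr1 => E.
rewrite /q E mulrA mulVf// mul1r.
by apply: (hd _ _).2; apply: inO; rewrite c0.
Unshelve. all: by end_near. Qed.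

Local Notation e j := (delta_mx ord0 j : V).

Lemma derive_coord (O : set V) f x u : open O -> C1 O f -> O x ->
  'D_u f x = \sum_j u ord0 j * 'D_(e j) f x.
Proof.
move=> oO cf Ox; rewrite {1}(row_sum_delta u).
elim: (index_enum _) => [|j r IH]; first by rewrite !big_nil derive0.
by rewrite !big_cons (derive_dirD _ _ oO cf Ox) IH derive_dirZ//; exact: (cf x Ox _).1.
Qed.

Lemma derive_dilation f x v a c : (\forall z \near x, f (a *: z) = c * f z) ->
  derivable f x v -> 'D_(a *: v) f (a *: x) = c * 'D_v f x.
Proof.
move=> fa df.
have -> : 'D_(a *: v) f (a *: x) = 'D_v (fun z => f (a *: z)) x.
  have E : (fun h => h^-1 *: ((f \o shift (a *: x)) (h *: (a *: v)) - f (a *: x))) =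
      (fun h => h^-1 *: (((fun z => f (a *: z)) \o shift x) (h *: v) - f (a *: x))).
    apply/funext => h /=; congr (_ *: (f _ - _)).
    by rewrite scalerDr !scalerA mulrC.
  by rewrite /derive E.
by rewrite (near_eq_derive v fa) (deriveZ c df).
Qed.

End directional.

Section curvature.
Context {R : realType} {n : nat}.
Local Notation V := 'rV[R]_n.
Variable N : V -> R.
Hypothesis gN : gauge N.
Hypothesis smoothN : smooth_on [set x : V | x != 0] N.
Hypothesis curvN : forall x, N x = 1 -> forall v : V, v != 0 ->
  'D_v N x = 0 -> 0 < 'D_v (fun z => 'D_v N z) x.

Let O : set V := [set x | x != 0].
Let oO : open O := open_neq0.
Local Notation e j := (delta_mx ord0 j : V).

Let C1N : C1 O N.
Proof.
move=> x Ox v; split; first exact: (smoothN [::] Ox).2.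
exact: (smoothN [:: v] Ox).1.
Qed.

Let C1DN u : C1 O (fun z => 'D_u N z).
Proof.
move=> x Ox v; split; first exact: (smoothN [:: u] Ox).2.
exact: (smoothN [:: v; u] Ox).1.
Qed.

Definition hess x : 'M[R]_n := \matrix_(i, j) 'D_(e i) (fun z => 'D_(e j) N z) x.
Definition Bf x (u v : V) : R := (u *m hess x *m v^T) ord0 ord0.

Lemma BfE x u v : Bf x u v = \sum_i u ord0 i * (\sum_j v ord0 j * hess x i j).
Proof.
rewrite /Bf mxE; under eq_bigr => j _ do rewrite !mxE mulr_suml.
rewrite exchange_big/=; apply: eq_bigr => i _; rewrite mulr_sumr.
by apply: eq_bigr => j _; rewrite -mulrA [hess x i j * _]mulrC.
Qed.

Lemma derive2 x u v : x != 0 -> 'D_u (fun z => 'D_v N z) x = Bf x u v.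
Proof.
move=> x0; rewrite (derive_coord _ oO (C1DN v) x0) BfE.
apply: eq_bigr => i _; congr (_ * _).
have E : \forall z \near x, 'D_v N z = (\sum_j (v ord0 j \*: (fun z => 'D_(e j) N z))) z.
  have : \forall z \near x, O z by exact: open_nbhs_nbhs.
  apply: filterS => z Oz; rewrite (derive_coord _ oO C1N Oz).
  by rewrite fct_sumE.
rewrite (near_eq_derive _ E) derive_sum => [|j]; last first.
  by apply: derivableZ; exact: (C1DN _ x0 _).1.
apply: eq_bigr => j _; rewrite deriveZ ?mxE//.
exact: (C1DN _ x0 _).1.
Qed.

Lemma BfDl x u v w : Bf x (u + v) w = Bf x u w + Bf x v w.
Proof. by rewrite /Bf !mulmxDl mxE. Qed.
Lemma BfDr x u v w : Bf x u (v + w) = Bf x u v + Bf x u w.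
Proof. by rewrite /Bf linearD/= mulmxDr mxE. Qed.
Lemma BfZl x a u v : Bf x (a *: u) v = a * Bf x u v.
Proof. by rewrite /Bf -!scalemxAl mxE. Qed.
Lemma BfZr x a u v : Bf x u (a *: v) = a * Bf x u v.
Proof. by rewrite /Bf linearZ/= -scalemxAr mxE. Qed.

Let near0 (d : R) : 0 < d -> \forall h \near (0 : R)^', `|h| < d /\ h != 0.
Proof.
by move=> d0; near=> h; split; near: h; [exact: dnbhs0_lt|exact: nbhs_dnbhs_neq].
Unshelve. all: by end_near. Qed.

Lemma euler x : x != 0 -> 'D_x N x = N x.
Proof.
move=> x0; apply: derive_cvg; apply: cvg_near_cst.
apply: filterS (near0 ltr01) => h [h1 h0].
rewrite /quot -[X in h *: x + X]scale1r -scalerDl gaugeZ//; last first.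
  by move: h1; rewrite ltr_norml => /andP[]; lra.
by rewrite mulrDl mul1r addrK mulrA mulVf// mul1r.
Qed.

Lemma derive_dilate x a v : x != 0 -> 0 < a -> 'D_v N (a *: x) = 'D_v N x.
Proof.
move=> x0 a0; have ax0 : a *: x != 0 by rewrite scaler_eq0 negb_or gt_eqF.
have E : \forall z \near x, N (a *: z) = a * N z.
  by apply: (@filterE _ _ (nbhs_filter x)) => z; rewrite gaugeZ// ltW.
have := derive_dilation E (C1N x0 v).1; rewrite derive_dirZ; last exact: (C1N ax0 v).1.
by move/(mulfI (lt0r_neq0 a0)).
Qed.

Lemma Bf_dilate x a u v : x != 0 -> 0 < a -> a * Bf (a *: x) u v = Bf x u v.
Proof.
move=> x0 a0; have ax0 : a *: x != 0 by rewrite scaler_eq0 negb_or gt_eqF.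
rewrite -!derive2// -derive_dirZ; last exact: (C1DN v ax0 u).1.
have E : \forall z \near x, 'D_v N (a *: z) = 1 * 'D_v N z.
  have : \forall z \near x, O z by exact: open_nbhs_nbhs.
  by apply: filterS => z Oz; rewrite mul1r derive_dilate.
by rewrite (derive_dilation E (C1DN v x0 u).1) mul1r.
Qed.

Lemma Bf_xl x v : x != 0 -> Bf x x v = 0.
Proof.
move=> x0; rewrite -derive2//; apply: derive_cvg; apply: cvg_near_cst.
apply: filterS (near0 ltr01) => h [h1 h0].
rewrite /quot -[X in h *: x + X]scale1r -scalerDl derive_dilate ?subrr ?mulr0//.
by move: h1; rewrite ltr_norml => /andP[]; lra.
Qed.

(** Euler's identity at [z = x + h v] gives [D_x N z = N z - h D_v N z]. So the difference quotient
    of [D_x N] along [v] is that of [N] minus [D_v N z], and it tends to 0. This replaces an appeal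
    to the symmetry of second derivatives. *)
Lemma Bf_xr x v : x != 0 -> Bf x v x = 0.
Proof.
move=> x0; rewrite -derive2//; apply: derive_cvg.
have L0 : {for 0, continuous (fun h : R => h *: v + x)}.
  apply: continuousD; last exact: cst_continuous.
  by apply: continuousZ; [exact: cvg_id|exact: cst_continuous].
have L1 : (fun h : R => h *: v + x) @ 0^' --> x.
  by move: L0; rewrite /prop_for /continuous_at scale0r add0r => L0; exact: cvg_within_filter.
have L2 : (fun h => quot N x v h - 'D_v N (h *: v + x)) @ 0^' --> 'D_v N x - 'D_v N x.
  apply: cvgB; first exact/derivable_cvg/(C1N x0 v).1.
  exact: (cvg_comp _ _ L1 (C1N x0 v).2).
rewrite subrr in L2; apply: cvg_trans L2; apply: near_eq_cvg.
have Oz : \forall h \near (0 : R)^', O (h *: v + x).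
  exact: (L1 _ (open_nbhs_nbhs (conj oO x0))).
apply: filterS2 Oz (near0 ltr01) => h Oz [_ h0].
set z := h *: v + x; have xE : x = z + (- h) *: v by rewrite /z scaleNr addrAC subrr add0r.
have Dx : 'D_x N z = N z + - h * 'D_v N z.
  have -> : 'D_x N z = 'D_(z + (- h) *: v) N z by rewrite -xE.
  rewrite (derive_dirD _ _ oO C1N Oz) euler// derive_dirZ//.
  exact: (C1N Oz v).1.
rewrite /quot -/z euler// Dx.
by move: (N z) (N x) ('D_v N z) => a b c; field.
Qed.

Lemma Bf_tangent x a u : x != 0 -> Bf x (a *: x + u) (a *: x + u) = Bf x u u.
Proof.
move=> x0; rewrite BfDl BfZl Bf_xl// mulr0 add0r BfDr BfZr Bf_xr//.
by rewrite mulr0 add0r.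
Qed.

(** The curvature hypothesis concerns the kernel of the differential of [N] at a boundary point,
    whereas the compactness argument uses the Euclidean orthogonal complement of [x]. Removing from
    [u] a multiple of the boundary point [y] leads from one to the other without changing the
    quadratic form, since radial directions lie in its kernel. What remains of [u] is nonzero
    because [u] is orthogonal to [x]. *)
Lemma Bf_pos x u : x != 0 -> u != 0 -> dotv x u = 0 -> 0 < Bf x u u.
Proof.
move=> x0 u0 xu; have Nx0 := gauge_gt0 gN x0.
pose a := (N x)^-1; have a0 : 0 < a by rewrite invr_gt0.
pose y := a *: x; have y0 : y != 0 by rewrite scaler_eq0 negb_or gt_eqF.
have Ny : N y = 1 by rewrite gaugeZ ?(ltW a0)// mulVf// gt_eqF.
rewrite -(Bf_dilate u u x0 a0) pmulr_rgt0// -/y.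
pose b := 'D_u N y; pose v := u + (- b) *: y.
have uE : u = b *: y + v by rewrite /v scaleNr addrC subrK.
rewrite uE Bf_tangent// -derive2//; apply: curvN => //.
  apply: contraNneq u0 => v0; rewrite -dotvv_eq0 {2}uE v0 addr0 dotvZr /y dotvZr dotvC xu.
  by rewrite !mulr0.
rewrite (derive_dirD _ _ oO C1N y0) derive_dirZ; last exact: (C1N y0 y).1.
by rewrite euler// Ny mulr1 subrr.
Qed.

Lemma hess_continuous x i j : x != 0 -> {for x, continuous (fun z => hess z i j)}.
Proof.
move=> x0; have := (C1DN (e j) x0 (e i)).2.
suff -> : (fun z => hess z i j) = (fun z => 'D_(e i) (fun z => 'D_(e j) N z) z) by [].
by apply/funext => z; rewrite mxE.
Qed.

Lemma Bf_lower : exists2 c, 0 < c &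
  forall x u, sphere n x -> sphere n u -> dotv x u = 0 -> c <= Bf x u u.
Proof.
pose K : set (V * V) := (sphere n `*` sphere n) `&` [set p | dotv p.1 p.2 = 0].
have cK : compact K.
  apply: compact_closedI; first by apply: compact_setX; exact: sphere_compact.
  have -> : [set p : V * V | dotv p.1 p.2 = 0] = (fun p : V * V => dotv p.1 p.2) @^-1` [set 0] by [].
  by apply: closed_comp => [p _|]; [exact: dotv_continuous2|exact: closed_eq].
(* In dimension below 2 there is no orthonormal pair, and any constant does. *)
have [K0|/set0P K0] := eqVneq K set0.
  exists 1 => // x u Sx Su xu; have : K (x, u) by [].
  by rewrite K0.
have [|p /set_mem[[Sp1 Sp2] p12] pmin] := compact_EVT_min (f := fun p => Bf p.1 p.2 p.2) K0 cK.
  apply: continuous_in_subspaceT => p /set_mem[[Sp1 Sp2] _].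
  have -> : (fun p : V * V => Bf p.1 p.2 p.2) = (fun p : V * V =>
      \sum_i p.2 ord0 i * (\sum_j p.2 ord0 j * hess p.1 i j)).
    by apply/funext => q; exact: BfE.
  have c2 i : {for p, continuous (fun q : V * V => q.2 ord0 i)}.
    apply: (@continuous_comp _ _ _ snd (fun x : V => x ord0 i)); first exact: cvg_snd.
    exact: coord_continuous.
  apply: continuous_sumr => i; apply: continuousM => //.
  apply: continuous_sumr => j; apply: continuousM => //.
  apply: (@continuous_comp _ _ _ fst (fun x : V => hess x i j)); first exact: cvg_fst.
  exact/hess_continuous/sphere_neq0.
exists (Bf p.1 p.2 p.2); first by apply: Bf_pos => //; exact: sphere_neq0.
by move=> x u Sx Su xu; apply: (pmin (x, u)); exact: mem_set.
Qed.

(** The factor of [c] is the second derivative of the Euclidean norm at [z] in the direction [v]. It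
    equals [|u|^2 / |z|] for the component [u] of [v] orthogonal to [z], and only this component
    counts for [Bf]. *)
Lemma Bf_ge c z v : (forall x u, sphere n x -> sphere n u -> dotv x u = 0 -> c <= Bf x u u) ->
  z != 0 -> c * ((dotv v v - dotv z v ^+ 2 / dotv z z) / enorm z) <= Bf z v v.
Proof.
move=> hc z0; have zz0 : dotv z z != 0 by rewrite dotvv_eq0.
have Ez0 : 0 < enorm z by rewrite enorm_gt0.
pose a := dotv z v / dotv z z; pose u := v + (- a) *: z.
have vE : v = a *: z + u by rewrite /u scaleNr addrC subrK.
have zu : dotv z u = 0 by rewrite /u dotvDr dotvZr /a mulNr mulfVK// subrr.
have -> : dotv v v - dotv z v ^+ 2 / dotv z z = dotv u u.
  rewrite /u !(dotvDl, dotvDr, dotvZl, dotvZr) (dotvC v z) /a; by field.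
rewrite [in leRHS]vE Bf_tangent//.
have [->|u0] := eqVneq u 0.
  by rewrite dotv0l mul0r mulr0 /Bf !mul0mx mxE.
have Eu0 : 0 < enorm u by rewrite enorm_gt0.
have := hc _ _ (sphere_normalize z0) (sphere_normalize u0).
rewrite dotvZl dotvZr zu !mulr0 => /(_ erefl).
rewrite BfZl BfZr -[X in Bf _ X](scale1r u) => h.
have E := Bf_dilate u u z0 (_ : 0 < (enorm z)^-1); rewrite invr_gt0 in E.
rewrite -(E Ez0) -sqr_enorm mulrA mulrC ler_pM2l ?invr_gt0//.
move: h; rewrite scale1r; set B := Bf _ u u; move=> h.
have : c * enorm u ^+ 2 <= (enorm u)^-1 * ((enorm u)^-1 * B) * enorm u ^+ 2.
  by rewrite ler_wpM2r// sqr_ge0.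
rewrite (_ : _ * _ * enorm u ^+ 2 = B)//; by field; rewrite gt_eqF.
Qed.

(** The midpoint inequality is the form in which subadditivity of a positively homogeneous function
    is obtained. *)
Lemma convex_of_second_derivative (f df ddf : R -> R) :
  (forall t : R, 0 <= t <= 1 -> is_derive t 1 f (df t)) ->
  (forall t : R, 0 <= t <= 1 -> is_derive t 1 df (ddf t)) ->
  (forall t : R, 0 <= t <= 1 -> 0 <= ddf t) -> f 2^-1 <= (f 0 + f 1) / 2.
Proof.
move=> h1 h2 h3.
have mvt (g dg : R -> R) a b : (forall t : R, 0 <= t <= 1 -> is_derive t 1 g (dg t)) ->
    0 <= a -> a < b -> b <= 1 -> exists2 c, a < c < b & g b - g a = dg c * (b - a).
  move=> hg a0 ab b1; have [||c] := @MVT R g dg a b ab.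
  - move=> t; rewrite in_itv/= => /andP[ta tb]; apply: hg.
    by rewrite (le_trans a0 (ltW ta)) (le_trans (ltW tb) b1).
  - apply: derivable_within_continuous => t; rewrite in_itv/= => /andP[ta tb].
    have /hg[] // : 0 <= t <= 1 by rewrite (le_trans a0 ta) (le_trans tb b1).
  - by rewrite in_itv/=; exists c.
have [c1 /andP[c10 c11] E1] := mvt f df 0 2^-1 h1 (lexx _) (ltac:(lra)) (ltac:(lra)).
have [c2 /andP[c20 c21] E2] := mvt f df 2^-1 1 h1 (ltac:(lra)) (ltac:(lra)) (lexx _).
have c12 : c1 < c2 by exact: lt_trans c20.
have [c /andP[cl cr] E3] := mvt df ddf c1 c2 h2 (ltW c10) c12 (ltW c21).
have d0 : 0 <= df c2 - df c1.
  rewrite E3 mulr_ge0 ?subr_ge0 ?(ltW c12)//; apply: h3; apply/andP; split; lra.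
move: E1 E2 d0; move: (df c1) (df c2) (f 0) (f 1) (f 2^-1) => p q a b d; lra.
Qed.

Lemma enorm_line (y v : V) t : y + t *: v != 0 ->
  is_derive t 1 (fun t => enorm (y + t *: v)) (dotv (y + t *: v) v / enorm (y + t *: v)).
Proof.
move=> z0; have q0 : 0 < dotv (y + t *: v) (y + t *: v).
  by rewrite lt_def dotvv_eq0 z0 dotvv_ge0.
have dq : is_derive t 1 (fun t : R => dotv (y + t *: v) (y + t *: v)) (2 * dotv (y + t *: v) v).
  pose p := (dotv y y)%:P + (2 * dotv y v)%:P * 'X + (dotv v v)%:P * 'X^2.
  have -> : (fun t : R => dotv (y + t *: v) (y + t *: v)) = horner p.
    apply/funext => s; rewrite !hornerE !(dotvDl, dotvDr, dotvZl, dotvZr) (dotvC v y)/=.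
    by ring.
  apply: is_derive_eq (is_derive_poly p t) _.
  rewrite /p !derivD !derivM !derivC !derivX !hornerE dotvDl dotvZl.
  by rewrite /=; ring.
have := @is_derive1_comp R Num.sqrt (fun t : R => dotv (y + t *: v) (y + t *: v)) t _ _
   (is_derive1_sqrt q0) dq.
move=> h; apply: is_derive_eq h _.
rewrite -/(enorm (y + t *: v)); field.
by rewrite gt_eqF// enorm_gt0.
Qed.

Lemma enorm_line2 (y v : V) t : y + t *: v != 0 ->
  is_derive t 1 (fun t => dotv (y + t *: v) v / enorm (y + t *: v))
    ((dotv v v - dotv (y + t *: v) v ^+ 2 / dotv (y + t *: v) (y + t *: v)) / enorm (y + t *: v)).
Proof.
move=> z0; have Ez0 : enorm (y + t *: v) != 0 by rewrite enorm_eq0.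
have d1 := enorm_line z0.
have d2 : is_derive t 1 (fun t : R => dotv (y + t *: v) v) (dotv v v).
  pose p := (dotv y v)%:P + (dotv v v)%:P * 'X.
  have -> : (fun t : R => dotv (y + t *: v) v) = horner p.
    by apply/funext => s; rewrite !hornerE dotvDl dotvZl mulrC.
  apply: is_derive_eq (is_derive_poly p t) _.
  by rewrite /p !derivD !derivM !derivC derivX !hornerE/=; ring.
have d3 : is_derive t 1 (fun t : R => (enorm (y + t *: v))^-1)
    (- (enorm (y + t *: v)) ^- 2 *: (dotv (y + t *: v) v / enorm (y + t *: v))).
  have dd := @ex_derive _ _ _ _ _ _ _ d1.
  apply: DeriveDef; first exact: derivableV.
  by rewrite deriveV// derive_val.
have := is_deriveM d2 d3; move=> h; apply: is_derive_eq h _.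
move: (y + t *: v) Ez0 => z Ez0; rewrite -(sqr_enorm z) /GRing.scale/=.
by move: (enorm z) (dotv z v) (dotv v v) Ez0 => a b c a0; field.
Qed.

Lemma is_derive_subZ (f g : R -> R) (t a b c : R) :
  is_derive t 1 f a -> is_derive t 1 g b ->
  is_derive t 1 (fun s => f s - c * g s) (a - c * b).
Proof. by move=> df dg; exact: (is_deriveB df (is_deriveZ c dg)). Qed.

(** The constant is the smaller of two: the bound of [Bf_lower], which makes the second derivatives
    of [N - c |.|] along lines avoiding the origin nonnegative, and the constant of [gauge_lb],
    which makes [N - c |.|] nonnegative. *)
Theorem gauge_strongly_convex : exists2 c, 0 < c & (forall x, c * enorm x <= N x) /\
  forall x y, N (x + y) - c * enorm (x + y) <= (N x - c * enorm x) + (N y - c * enorm y).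
Proof.
have [c0 c00 hc0] := Bf_lower; have [c1 c10 hc1] := gauge_lb gN.
pose c := Num.min c0 c1; have cpos : 0 < c by rewrite lt_min c00.
have hc x u : sphere n x -> sphere n u -> dotv x u = 0 -> c <= Bf x u u.
  by move=> Sx Su xu; rewrite ge_min hc0.
have cN x : c * enorm x <= N x.
  by apply: le_trans (hc1 x); rewrite ler_wpM2r ?enorm_ge0// ge_min lexx orbT.
exists c => //; split => // x y.
pose F z := N z - c * enorm z.
have F0 z : 0 <= F z by rewrite subr_ge0.
have FZ a z : F (a *: z) = `|a| * F z.
  rewrite /F enormZ mulrBr [c * _]mulrCA; congr (_ - _).
  have [a0|a0] := leP 0 a; first by rewrite gaugeZ// ger0_norm.
  by rewrite -gaugeN// -scaleNr gaugeZ ?oppr_ge0 ?(ltW a0)// ltr0_norm.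
rewrite -/(F (x + y)) -/(F x) -/(F y).
pose v := x - y.
have [[t [/andP[t0 t1] tz]]|nz] := pselect (exists t, 0 <= t <= 1 /\ y + t *: v = 0).
  have E : (1 - t) *: y = - (t *: x).
    apply/eqP; rewrite -addr_eq0 -tz /v scalerBr scalerBl scale1r; apply/eqP.
    by rewrite -addrA [- _ + _]addrC.
  have [t1'|t1'] := eqVneq t 1.
    have -> : x = 0 by move: E; rewrite t1' subrr scale0r scale1r => /esym/eqP; rewrite oppr_eq0 => /eqP.
    by rewrite add0r lerDr.
  have t10 : 1 - t != 0 by rewrite subr_eq0 eq_sym.
  pose s := t / (1 - t).
  have s0 : 0 <= s by rewrite divr_ge0// subr_ge0.
  have -> : y = (- s) *: x.
    apply: (scalerI t10); rewrite E scalerA -scaleNr; congr (_ *: _).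
    by rewrite /s; field.
  rewrite -{1}[x]scale1r -scalerDl !FZ normrN (ger0_norm s0) -{2}[F x]mul1r -mulrDl.
  by rewrite ler_wpM2r// (le_trans (ler_normB _ _))// normr1 (ger0_norm s0).
have z0 t : 0 <= t <= 1 -> y + t *: v != 0.
  by move=> t01; apply/eqP => h; apply: nz; exists t.
have := @convex_of_second_derivative (fun t => F (y + t *: v))
  (fun t => 'D_v N (y + t *: v) - c * (dotv (y + t *: v) v / enorm (y + t *: v)))
  (fun t => Bf (y + t *: v) v v - c * ((dotv v v - dotv (y + t *: v) v ^+ 2 /
     dotv (y + t *: v) (y + t *: v)) / enorm (y + t *: v))).
have -> : y + 2^-1 *: v = 2^-1 *: (x + y).
  by apply/rowP => i; rewrite !mxE; field.
have -> : y + 1 *: v = x by rewrite scale1r /v addrC subrK.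
rewrite FZ scale0r addr0 => h.
have {}h : `|2^-1| * F (x + y) <= (F y + F x) / 2.
  apply: h.
  - move=> t /z0 zt; apply: is_derive_subZ; last exact: enorm_line.
    exact: is_derive_line (C1N zt v).1.
  - move=> t /z0 zt; apply: is_derive_subZ; last exact: enorm_line2.
    have h2 : is_derive t 1 (fun s : R => 'D_v N (y + s *: v)) ('D_v (fun z => 'D_v N z) (y + t *: v)).
      exact: is_derive_line (C1DN v zt v).1.
    by rewrite (derive2 v v zt) in h2.
  - by move=> t /z0 zt; rewrite subr_ge0; exact: Bf_ge.
move: h; rewrite ger0_norm ?invr_ge0//.
by move: (F (x + y)) (F x) (F y) => a b d; lra.
Qed.

End curvature.

(** * Perturbation of the body *)

Section approximation.
Context {R : realType} {n : nat}.
Local Notation V := 'rV[R]_n.+1.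
Variables (N : V -> R) (c : R).
Hypothesis gN : gauge N.
Hypothesis c0 : 0 < c.
Hypothesis sN : forall x y, N (x + y) - c * enorm (x + y) <=
  (N x - c * enorm x) + (N y - c * enorm y).
Local Notation S := (@sphere R n.+1).

(* [(G y + e/2) N x + C (|<x, y>| - |x|)] is tangent to [(G + e/2) N] along
   [y] and drops below [G N] away from [+-y]; [w] is the supremum over [y].
   Adding a multiple of [N] makes each of these functions convex. *)
Theorem upper_approximation (G : V -> R) (e : R) : scont G ->
  (forall x, S x -> G (- x) = G x) -> 0 < e ->
  exists w : V -> R, exists2 Lam : R, 0 <= Lam &
  [/\ forall a x, 0 <= a -> w (a *: x) = a * w x,
      forall x, w (- x) = w x,
      forall x y, w (x + y) + Lam * N (x + y) <= (w x + Lam * N x) + (w y + Lam * N y),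
      scont w &
      forall x, S x -> G x * N x <= w x <= (G x + e) * N x].
Proof.
move=> cG eG e0.
have [M M0 hM] := scont_bounded cG.
have [P P0 hP] := scont_ubound (gauge_scont gN).
have e20 : 0 < e / 2 by rewrite divr_gt0.
have [d d0 hd] := scont_unif cG e20.
(* Chosen so that [C * (d^2 / 2) = 2 M P], a bound for [(G y - G x) * N x] on the sphere: the
   penalty outweighs any variation of [G] once [x] is far from [y] and [- y]. *)
pose C := 4 * M * P / d ^+ 2.
have C0 : 0 <= C by rewrite divr_ge0 ?sqr_ge0// !mulr_ge0// ltW.
pose g (y x : V) := (G y + e / 2) * N x + C * (`|dotv x y| - enorm x).
pose E x := [set g y x | y in S].
pose w x := sup (E x).
(* The summand [C / c] turns the concave term [- C |x|] into the convex [C / c * (N x - c |x|)],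
   which is where [sN] enters; the summand [M] makes the coefficient [G y + M + e / 2] of [N]
   nonnegative. *)
pose Lam := C / c + M.
have Lam0 : 0 <= Lam by rewrite addr_ge0 ?(ltW M0)// divr_ge0// ltW.
pose y0 : V := delta_mx ord0 ord0.
have Sy0 : S y0.
  by rewrite /sphere/= /enorm dotvE trmx_delta mul_delta_mx mxE eqxx sqrtr1.
have CS (x y : V) : S y -> `|dotv x y| <= enorm x.
  by move=> Sy; apply: le_trans (cauchy_schwarz x y) _; rewrite Sy mulr1.
have Gb y : S y -> - M <= G y <= M by move=> Sy; rewrite -ler_norml hM.
have g_ub y x : S y -> g y x <= (M + e / 2) * N x.
  move=> Sy; have /andP[_ h] := Gb y Sy; have N0 := gauge_ge0 x gN.
  have : C * (`|dotv x y| - enorm x) <= 0 by rewrite mulr_ge0_le0// subr_le0 CS.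
  have : G y * N x <= M * N x by rewrite ler_wpM2r.
  rewrite /g !mulrDl; move: (G y * N x) (M * N x) (e / 2 * N x) (C * _) => p1 p2 p3 p4; lra.
have supE x : has_sup (E x).
  split; first by exists (g y0 x), y0.
  by exists ((M + e / 2) * N x) => _ [y Sy <-]; exact: g_ub.
have g_le y x : S y -> g y x <= w x.
  by move=> Sy; apply: ub_le_sup; [exact: (supE x).2|exists y].
have w_le x a : (forall y, S y -> g y x <= a) -> w x <= a.
  by move=> h; apply: ge_sup; [exact: (supE x).1|move=> _ [y Sy <-]; exact: h].
have gZ y a x : 0 <= a -> g y (a *: x) = a * g y x.
  by move=> a0; rewrite /g gaugeZ// dotvZl enormZ normrM (ger0_norm a0); ring.
have gN' y x : g y (- x) = g y x by rewrite /g gaugeN// dotvNl normrN enormN.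
have wZ1 a x : 0 < a -> w (a *: x) <= a * w x.
  by move=> a0; apply: w_le => y Sy; rewrite gZ ?(ltW a0)// ler_pM2l// g_le.
have wZ a x : 0 <= a -> w (a *: x) = a * w x.
  rewrite le_eqVlt => /predU1P[<-|a0].
    rewrite mul0r scale0r; apply/eqP; rewrite eq_le; apply/andP; split.
      by apply: w_le => y _; rewrite -(scale0r y0) gZ// mul0r.
    by apply: le_trans (g_le y0 0 Sy0); rewrite -(scale0r y0) gZ// mul0r.
  apply/eqP; rewrite eq_le wZ1//=; have := wZ1 a^-1 (a *: x).
  by rewrite invr_gt0 => /(_ a0); rewrite scalerA mulVf ?gt_eqF// scale1r ler_pdivlMl.
have wN x : w (- x) = w x.
  have h z : w (- z) <= w z by apply: w_le => y Sy; rewrite gN' g_le.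
  by apply/eqP; rewrite eq_le h/= -{1}(opprK x) h.
have wD x z : w (x + z) + Lam * N (x + z) <= (w x + Lam * N x) + (w z + Lam * N z).
  rewrite -lerBrDr; apply: w_le => y Sy; rewrite lerBrDr.
  apply: (@le_trans _ _ ((g y x + Lam * N x) + (g y z + Lam * N z))); last first.
    by rewrite lerD// lerD2r g_le.
  have gE u : g y u + Lam * N u = (G y + M + e / 2) * N u +
      C / c * (N u - c * enorm u) + C * `|dotv u y|.
    by rewrite /g /Lam; field; rewrite gt_eqF.
  rewrite !gE.
  have h1 : (G y + M + e / 2) * N (x + z) <= (G y + M + e / 2) * N x + (G y + M + e / 2) * N z.
    rewrite -mulrDr ler_wpM2l ?gaugeD//.
    by have /andP[h _] := Gb y Sy; rewrite addr_ge0 ?(ltW e20)// -lerBlDr sub0r.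
  have h2 : C / c * (N (x + z) - c * enorm (x + z)) <=
      C / c * (N x - c * enorm x) + C / c * (N z - c * enorm z).
    by rewrite -mulrDr ler_wpM2l// divr_ge0// ltW.
  have h3 : C * `|dotv (x + z) y| <= C * `|dotv x y| + C * `|dotv z y|.
    by rewrite -mulrDr ler_wpM2l// dotvDl ler_normD.
  apply: le_trans (lerD (lerD h1 h2) h3) _.
  by rewrite le_eqVlt; apply/orP; left; apply/eqP; ring.
exists w, Lam => //; split => //.
- have [Q Q0 hQ] := gauge_ub gN.
  pose h x := w x + Lam * N x.
  pose B := (M + e / 2 + Lam) * Q.
  have B0 : 0 < B by rewrite mulr_gt0// ltr_pwDl// addr_gt0.
  have hB x : h x <= B * enorm x.
    rewrite /h /B -mulrA; apply: (@le_trans _ _ ((M + e / 2 + Lam) * N x)).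
      by rewrite [leRHS]mulrDl lerD2r; apply: w_le => y; exact: g_ub.
    by rewrite ler_pM2l// ltr_pwDl// addr_gt0.
  have lip x y : `|h x - h y| <= B * enorm (x - y).
    have hh u v : h u - h v <= B * enorm (u - v).
      rewrite lerBlDr; apply: le_trans (lerD (hB _) (lexx _)).
      by have := wD (u - v) v; rewrite subrK.
    by rewrite ler_norml hh andbT lerNl opprB -[enorm (x - y)]enormN opprB hh.
  have ch : scont h by apply: scont_at => x _; exact: lipschitz_continuous B0 lip x.
  apply: (@eq_scont _ _ (fun x => h x + (- Lam) * N x)).
    by move=> x _; rewrite /h mulNr addrK.
  apply: scontD => //; apply: scontM; [exact: scont_cst|exact: gauge_scont].
- move=> x Sx; have Nx := gauge_gt0 gN (sphere_neq0 Sx).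
  apply/andP; split.
    apply: le_trans (g_le x x Sx).
    rewrite /g -sqr_enorm Sx expr1n normr1 subrr mulr0 addr0.
    by rewrite ler_pM2r// lerDl ltW.
  apply: w_le => y Sy; rewrite /g Sx.
  have /andP[l1 l2] := Gb y Sy; have /andP[l3 l4] := Gb x Sx.
  have CS1 : `|dotv x y| <= 1 by have := CS x y Sy; rewrite Sx.
  (* For unit vectors the squared distance from [y] to the nearer of [x] and [- x] is
     [2 (1 - |<x, y>|)], so the second case is that of distance less than [d]. *)
  have [far|near] := leP (d ^+ 2 / 2) (1 - `|dotv x y|).
    have h1 : C * (`|dotv x y| - 1) <= - (2 * M * P).
      have := ler_wpM2l C0 far.
      have -> : C * (d ^+ 2 / 2) = 2 * M * P by rewrite /C; field; rewrite gt_eqF.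
      move: (C) (`|dotv x y|) (2 * M * P) => p q r; lra.
    have h2 : (G y - G x) * N x <= 2 * M * P.
      apply: (@le_trans _ _ (2 * M * N x)); first by rewrite ler_pM2r//; lra.
      by rewrite ler_wpM2l ?hP// mulr_ge0// ltW.
    have h3 : 0 < e / 2 * N x by rewrite mulr_gt0.
    move: h1 h2 h3; rewrite mulrBl !mulrDl.
    move: (C * _) (G y * N x) (G x * N x) (N x) (2 * M * P) => p q r s t.
    by move=> *; lra.
  have h1 : C * (`|dotv x y| - 1) <= 0 by rewrite mulr_ge0_le0// subr_le0.
  have h2 : G y <= G x + e / 2.
    (* To be used with [z] the one of [x] and [- x] that is nearer to [y]; evenness of [G] makes the
       two interchangeable. *)
    have close z : S z -> G z = G x -> dotv z y = `|dotv x y| -> G y <= G x + e / 2.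
      move=> Sz <- zy; rewrite -lerBlDl.
      apply: le_trans (ler_norm _) _; rewrite distrC; apply: hd => //.
      rewrite -(@ltr_pXn2r _ 2) ?nnegrE ?enorm_ge0 ?(ltW d0)//.
      rewrite sqr_enorm !(dotvDl, dotvDr, dotvNl, dotvNr) (dotvC y z) -!sqr_enorm Sz Sy zy.
      move: near; move: (`|dotv x y|) (d ^+ 2) => p q; rewrite !expr1n; lra.
    have [xy|xy] := leP 0 (dotv x y); first by apply: (close x) => //; rewrite ger0_norm.
    apply: (close (- x)); first by rewrite /sphere/= enormN.
      exact: eG.
    by rewrite dotvNl ltr0_norm.
  have h3 : (G y + e / 2) * N x <= (G x + e) * N x by rewrite ler_pM2r//; lra.
  by move: h1 h3; move: (C * _) (_ * N x) (_ * N x) => p q r; lra.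
Qed.

End approximation.

(** * Scalar inequalities for the first-order expansions *)

Section inequalities.
Context {R : realType}.

Lemma bernoulli (x : R) d : 0 <= 1 + x -> 1 + d%:R * x <= (1 + x) ^+ d.
Proof.
move=> x1; elim: d => [|d IH]; first by rewrite mul0r addr0 expr0.
rewrite exprSr; apply: le_trans (ler_wpM2r x1 IH).
rewrite -natr1 -subr_ge0 (_ : _ - _ = d%:R * x ^+ 2); last by ring.
by rewrite mulr_ge0// sqr_ge0.
Qed.

(** Bernoulli's inequality for [1 - t / (1 + t)], followed by [t / (1 + t) <= t]. *)
Lemma inv_expr_ge (t : R) d : 0 <= t -> 1 - d%:R * t <= (1 + t)^-1 ^+ d.
Proof.
move=> t0; have t1 : 0 < 1 + t by rewrite ltr_pwDl.
have E : (1 + t)^-1 = 1 + - (t / (1 + t)) by field; rewrite gt_eqF.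
rewrite E; apply: le_trans (bernoulli _ _); last by rewrite -E invr_ge0 ltW.
rewrite lerD2l mulrN lerN2 ler_wpM2l// ler_pdivrMr// mulrDr mulr1.
by rewrite lerDl mulr_ge0.
Qed.

(** With [a = d t], Bernoulli bounds the left side by the inverse of [1 + a], and
    [(1 + a) (1 - a + a^2) = 1 + a^3 >= 1]. *)
Lemma inv_expr_le (t : R) d : 0 <= t ->
  (1 + t)^-1 ^+ d <= 1 - d%:R * t + (d%:R * t) ^+ 2.
Proof.
move=> t0; pose a := d%:R * t; have a0 : 0 <= a by rewrite mulr_ge0.
have a1 : 0 < 1 + a by rewrite ltr_pwDl.
have h : 1 + a <= (1 + t) ^+ d by apply: bernoulli; rewrite addr_ge0.
rewrite exprVn; apply: (@le_trans _ _ (1 + a)^-1).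
  by rewrite lef_pV2 ?posrE// (lt_le_trans a1).
rewrite -/a -div1r ler_pdivrMr// -subr_ge0 (_ : _ - _ = a ^+ 3); last by ring.
by rewrite exprn_ge0.
Qed.

(** The derivative of the [p]-th power at [V] turns a strict inequality between slopes into an
    inequality between values for all small [e]. Nonnegativity of [V - e A] is part of the
    conclusion because monotonicity of the power is used on nonnegative numbers. *)
Lemma powR_decrease (V A c p : R) : 0 < V -> 0 < A -> p * V `^ (p - 1) * A < c ->
  exists2 e0 : R, 0 < e0 & forall e, 0 < e < e0 ->
    0 <= V - e * A /\ V `^ p - c * e < (V - e * A) `^ p.
Proof.
move=> V0 A0; set l := p * V `^ (p - 1) => lA.
have [dV lV] := is_derive1_powR p V0.
(* Half of the available gap in slope, so that [(l + eta) A = (c + l A) / 2] is still below [c]. *)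
pose eta := (c - l * A) / (2 * A).
have eta0 : 0 < eta by rewrite divr_gt0 ?subr_gt0// mulr_gt0.
have : (fun h : R => h^-1 *: (((fun x : R => x `^ p) \o shift V) (h *: 1) - V `^ p)) @ 0^' --> l.
  by rewrite /l -lV; exact: dV.
move=> /cvgrPdist_le/(_ eta eta0); rewrite near_withinE => /nbhs_ballP[d /= d0 hd].
exists (Num.min (d / A) (V / A)); first by rewrite lt_min !divr_gt0.
move=> e; rewrite lt_min => /andP[e0 /andP[ed eV]].
have eA0 : 0 < e * A by rewrite mulr_gt0.
split; first by rewrite subr_ge0 -ler_pdivlMr// ltW.
have := hd (- (e * A)); rewrite /ball/= sub0r opprK gtr0_norm// -ltr_pdivlMr// => /(_ ed).
rewrite oppr_eq0 gt_eqF// => /(_ isT).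
have -> : - (e * A) *: 1 + V = V - e * A by rewrite -[_ *: 1]/(_ * 1) mulr1 addrC.
rewrite -[_^-1 *: _]/(_^-1 * _) ler_norml => /andP[h _].
move: h; set W := (V - e * A) `^ p; set Z := V `^ p => h.
have h2 : (Z - W) / (e * A) <= l + eta.
  move: h; rewrite (_ : (- (e * A))^-1 * (W - Z) = (Z - W) / (e * A)); first by lra.
  by field; rewrite !gt_eqF.
move: h2; rewrite ler_pdivrMr// => h2.
have h3 : (l + eta) * (e * A) < c * e.
  rewrite (_ : (l + eta) * (e * A) = e * ((c + l * A) / 2)); last first.
    by rewrite /eta; field; rewrite gt_eqF.
  by rewrite mulrC ltr_pM2r//; lra.
by rewrite ltrBlDr -ltrBlDl (le_lt_trans h2).
Qed.

End inequalities.

(** * Volumes and sections of unit balls of gauges *)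

Section sections_of_gauges.
Context {R : realType}.

Lemma vol_gauge n (M : 'rV[R]_n.+1 -> R) : gauge M ->
  vol [set x | M x <= 1] = (Sph (fun x => (M x)^-1 ^+ n.+1) / n.+1%:R)%:E.
Proof.
move=> gM; apply: vol_radial; [exact: gauge_gt0|exact: gaugeZ|exact: gauge_scont].
Qed.

Lemma scont_gauge_inv n (M : 'rV[R]_n.+1 -> R) k : gauge M ->
  scont (fun x => (M x)^-1 ^+ k).
Proof.
move=> gM; apply: scontX; apply: scontV; last exact: gauge_scont.
by move=> x /sphere_neq0/(gauge_gt0 gM)/lt0r_neq0.
Qed.

Lemma section_vol_gauge n (M : 'rV[R]_n.+2 -> R) xi (U : 'M[R]_(n.+1, n.+2)) :
  gauge M -> sphere n.+2 xi -> hyperplane_param xi U ->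
  @section_vol R n.+2 [set x | M x <= 1] U =
  (Rad (fun x => (M x)^-1 ^+ n.+1) xi / n.+1%:R)%:E.
Proof.
move=> gM S HU; have [UU _] := HU.
rewrite -(Rad_frame _ S HU); last exact: scont_gauge_inv.
apply: (@vol_radial _ _ (fun y => M (y *m U))).
- by move=> y y0; apply: gauge_gt0 => //; exact: mulmx_isometry_neq0.
- by move=> a y a0; rewrite -scalemxAl gaugeZ.
- by apply: scont_isometry => //; exact: gauge_scont.
Qed.

(* Young's inequality [t rho <= rho^d / d + t^d' / d'] integrated over the
   sphere, with the scale [t] that makes it sharp for balls. *)
Lemma Sph_inv_gauge_le n (M : 'rV[R]_n.+2 -> R) (p := n.+1%:R / n.+2%:R) :
  gauge M -> let v := Sph (fun x => (M x)^-1 ^+ n.+2) / n.+2%:R in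
  0 < v ->
  Sph (fun x => (M x)^-1) <= n.+2%:R * fine (vol (@eball R n.+2)) `^ p * v `^ (1 - p).
Proof.
move=> gM v v0; set b := fine (vol _); have b0 : 0 < b by exact: fine_vol_eball_gt0.
have d0 : 0 < n.+2%:R :> R by [].
have d'0 : 0 < n.+1%:R :> R by [].
have p0 : 0 < p by rewrite divr_gt0.
(* If [r] is the radius of the Euclidean ball of volume [v] and [d] the dimension, then
   [t = r^(d-1)], for which Young's inequality is an equality when the radial function is [r]. *)
pose t := (v / b) `^ p; have t0 : 0 < t by rewrite powR_gt0// divr_gt0.
have tq : t `^ p^-1 = v / b.
  by rewrite /t -powRrM mulfV ?gt_eqF// powRr1// divr_ge0// ltW.
have cM1 : scont (fun x => (M x)^-1).
  by have := @scont_gauge_inv n.+1 M 1%N gM; under eq_fun do rewrite expr1.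
have key : t * Sph (fun x => (M x)^-1) <= n.+2%:R * v.
  rewrite -SphZ//; apply: (@le_trans _ _ (Sph (fun x => n.+2%:R^-1 * (M x)^-1 ^+ n.+2 + v / b * p))).
    apply: le_Sph.
    - by apply: scontM => //; exact: scont_cst.
    - apply: scontD; last exact: scont_cst.
      by apply: scontM; [exact: scont_cst|exact: scont_gauge_inv].
    move=> x Sx; have Mx : 0 < (M x)^-1.
      by rewrite invr_gt0; apply: gauge_gt0 => //; exact: sphere_neq0.
    have := @conjugate_powR R (M x)^-1 t n.+2%:R p^-1 (ltW Mx) (ltW t0) d0.
    rewrite invr_gt0 invrK tq powR_mulrn ?(ltW Mx)// => /(_ p0) h.
    rewrite mulrC (le_trans (h _))//; last by rewrite [_ * (_ ^+ _)]mulrC.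
    by rewrite /p -{1}[n.+2%:R^-1]mul1r -mulrDl nat1r mulfV// pnatr_eq0.
  rewrite SphD; [|by apply: scontM; [exact: scont_cst|exact: scont_gauge_inv]|exact: scont_cst].
  rewrite (SphZ _ (@scont_gauge_inv n.+1 M n.+2 gM)).
  rewrite Sph_cst -/b mulrC -/v.
  rewrite (_ : v + _ = n.+2%:R * v)//.
  rewrite (_ : v / b * p * (n.+2%:R * b) = v * n.+1%:R); last first.
    have aux (x y z u : R) : y != 0 -> z != 0 -> x / y * (u / z) * (z * y) = x * u.
      by move=> y0 z0; field; rewrite z0 y0.
    by rewrite /p aux ?gt_eqF.
  by rewrite -{1}[v]mulr1 -mulrDr nat1r mulrC.
rewrite -(ler_pM2l t0); apply: le_trans key _.
rewrite /t powRM ?(ltW v0) ?invr_ge0 ?(ltW b0)//.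
rewrite (_ : _ * _ * (_ * _ * _) = n.+2%:R * ((b^-1 `^ p * b `^ p) * (v `^ p * v `^ (1 - p)))); last by ring.
rewrite -powRM ?invr_ge0 ?(ltW b0)// mulVf ?gt_eqF// powR1 mul1r.
rewrite -powRD; last by rewrite (gt_eqF v0) implybT.
by rewrite addrC subrK powRr1// ltW.
Qed.

(** [N + e w] is the combination of the subadditive functions [N] and [w + Lam N] with coefficients
    [1 - e Lam] and [e], both nonnegative. *)
Lemma perturbed_gauge n (N w : 'rV[R]_n.+1 -> R) (Lam e : R) : gauge N ->
  (forall a x, 0 <= a -> w (a *: x) = a * w x) ->
  (forall x, w (- x) = w x) ->
  (forall x y, w (x + y) + Lam * N (x + y) <= (w x + Lam * N x) + (w y + Lam * N y)) ->
  scont w -> (forall x, sphere n.+1 x -> 0 <= w x) ->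
  0 < e -> e * Lam <= 1 ->
  gauge (fun x => N x + e * w x).
Proof.
move=> gN wZ wN wD cw w0 e0 eL.
have wnrm x : x != 0 -> w x = enorm x * w (nrm x).
  move=> x0; rewrite -wZ ?enorm_ge0// /nrm scalerA mulfV ?scale1r//.
  by rewrite enorm_eq0.
have w00 : w 0 = 0 by rewrite -(scale0r (0 : 'rV[R]_n.+1)) wZ// mul0r.
have w_ge0 x : 0 <= w x.
  have [->|x0] := eqVneq x 0; first by rewrite w00.
  by rewrite wnrm// mulr_ge0 ?enorm_ge0// w0//; exact: sphere_normalize.
split.
- by move=> a x a0; rewrite gaugeZ// wZ//; ring.
- move=> x y; have h1 := wD x y; have h2 := gaugeD gN x y.
  have h3 : e * (w (x + y) + Lam * N (x + y)) <= e * ((w x + Lam * N x) + (w y + Lam * N y)).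
    by rewrite ler_pM2l.
  have h4 : (1 - e * Lam) * N (x + y) <= (1 - e * Lam) * (N x + N y).
    by rewrite ler_wpM2l// subr_ge0.
  rewrite (_ : N (x + y) + e * w (x + y) =
    (1 - e * Lam) * N (x + y) + e * (w (x + y) + Lam * N (x + y))); last by ring.
  rewrite (_ : N x + e * w x + (N y + e * w y) = (1 - e * Lam) * (N x + N y) +
    e * ((w x + Lam * N x) + (w y + Lam * N y))); last by ring.
  exact: lerD.
- by move=> x; rewrite gaugeN// wN.
- by move=> x x0; rewrite ltr_pwDl ?gauge_gt0// mulr_ge0// ltW.
- have [C C0 hC] := gauge_ub gN; have [M M0 hM] := scont_ubound cw.
  exists (C + e * M); first by rewrite addr_gt0// mulr_gt0.
  move=> x; rewrite mulrDl lerD// -mulrA ler_pM2l//.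
  have [->|x0] := eqVneq x 0; first by rewrite w00 enorm0 mulr0.
  by rewrite wnrm// mulrC ler_wpM2r ?enorm_ge0// hM//; exact: sphere_normalize.
Qed.

Lemma scont_opp n (f : 'rV[R]_n.+1 -> R) : scont f -> scont (fun x => f (- x)).
Proof.
move=> cf; have NN : (- 1%:M : 'M[R]_n.+1) *m (- 1%:M)^T = 1%:M.
  by rewrite linearN/= trmx1 mulNmx mulmxN opprK mulmx1.
by have := scont_isometry NN cf; apply: eq_scont => x _; rewrite mulmxN mulmx1.
Qed.

Lemma Sph_even_part n (f g : 'rV[R]_n.+1 -> R) : scont f -> scont g ->
  (forall x, sphere n.+1 x -> g (- x) = g x) ->
  Sph (fun x => g x * (2^-1 * (f x + f (- x)))) = Sph (fun x => g x * f x).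
Proof.
move=> cf cg eg.
have NN : (- 1%:M : 'M[R]_n.+1) *m (- 1%:M)^T = 1%:M.
  by rewrite linearN/= trmx1 mulNmx mulmxN opprK mulmx1.
have cgf : scont (fun x => g x * f x) by exact: scontM.
have cgf' : scont (fun x => g (- x) * f (- x)).
  exact: (scont_opp cgf).
have E : Sph (fun x => g (- x) * f (- x)) = Sph (fun x => g x * f x).
  rewrite -(Sph_rotation NN cgf); apply: eq_Sph => x _.
  by rewrite mulmxN mulmx1.
transitivity (2^-1 * (Sph (fun x => g x * f x) + Sph (fun x => g (- x) * f (- x)))).
  rewrite -SphD// -SphZ; last exact: scontD.
  by apply: eq_Sph => x Sx; rewrite (eg x Sx); ring.
by rewrite E; field.
Qed.

End sections_of_gauges.

Section perturbation.
Context {R : realType}.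

Lemma Sph_gt0 n (f : 'rV[R]_n.+1 -> R) : scont f ->
  (forall x, sphere n.+1 x -> 0 < f x) -> 0 < Sph f.
Proof.
move=> cf f0; have [m m0 hm] := scont_pos_lbound cf f0.
apply: (@lt_le_trans _ _ (Sph (fun _ : 'rV[R]_n.+1 => m))).
  by rewrite Sph_cst !mulr_gt0// fine_vol_eball_gt0.
by apply: le_Sph => //; exact: scont_cst.
Qed.

(* The witness is [1 + delta * fe] with [fe] the even part of [f0]: a small
   perturbation of the constant, so that it is positive. *)
Lemma positive_witness n (N f0 : 'rV[R]_n.+2 -> R) : gauge N -> scont f0 ->
  (forall xi, sphere n.+2 xi -> 0 <= Rad f0 xi) ->
  Sph (fun x => (N x)^-1 * f0 x) < 0 ->
  exists f : 'rV[R]_n.+2 -> R,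
    [/\ scont f, forall x, sphere n.+2 x -> f (- x) = f x,
        forall x, sphere n.+2 x -> 0 < f x,
        forall xi, sphere n.+2 xi ->
          n.+1%:R * fine (vol (@eball R n.+1)) <= Rad f xi &
        Sph (fun x => (N x)^-1 * f x) < Sph (fun x => (N x)^-1)].
Proof.
move=> gN cf0 R0 S0.
have cN1 : scont (fun x => (N x)^-1).
  by have := @scont_gauge_inv R n.+1 N 1%N gN; under eq_fun do rewrite expr1.
have cf0' : scont (fun x => f0 (- x)) by exact: scont_opp.
pose fe (x : 'rV[R]_n.+2) : R := 2^-1 * (f0 x + f0 (- x)).
have cfe : scont fe by apply: scontM; [exact: scont_cst|exact: scontD].
have Rfe xi : sphere n.+2 xi -> 0 <= Rad fe xi.
  move=> Sxi; rewrite /fe RadZ//; last exact: scontD.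
  by rewrite RadD// Rad_opp// mulr_ge0// addr_ge0// R0.
have Sfe : Sph (fun x => (N x)^-1 * fe x) < 0.
  by rewrite Sph_even_part// => x Sx; rewrite gaugeN.
have [M M0 hM] := scont_bounded cfe.
(* This keeps [1 + d * fe] at least 1/2 on the sphere. *)
pose d : R := (2 * M)^-1; have d0 : 0 < d by rewrite invr_gt0 mulr_gt0.
have cdfe : scont (fun x => d * fe x) by apply: scontM => //; exact: scont_cst.
exists (fun x => 1 + d * fe x); split.
- by apply: scontD => //; exact: scont_cst.
- by move=> x Sx; rewrite /fe opprK [f0 (- x) + _]addrC.
- move=> x Sx; have := hM x Sx; rewrite ler_norml => /andP[h _].
  have : d * - M <= d * fe x by rewrite ler_pM2l.
  rewrite (_ : d * - M = - 2^-1); last by rewrite /d; field; rewrite gt_eqF.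
  by lra.
- move=> xi Sxi; rewrite RadD//; last exact: scont_cst.
  rewrite Rad_cst mul1r lerDl RadZ//.
  by apply: mulr_ge0; [exact: ltW|exact: Rfe].
- have cNfe : scont (fun x => (N x)^-1 * fe x) by exact: scontM.
  rewrite (@eq_Sph _ _ _ (fun x => (N x)^-1 + d * ((N x)^-1 * fe x))); last first.
    by move=> x _; ring.
  rewrite SphD//; last by apply: scontM => //; exact: scont_cst.
  by rewrite SphZ// gtrDl pmulr_rlt0.
Qed.

(** The condition with [eta] is the first-order decrease of the sections with a margin uniform in
    [xi]; the last inequality bounds the first-order decrease of the volume strictly. *)
Lemma perturbation_direction n (N f : 'rV[R]_n.+2 -> R) (c : R)
    (om := n.+1%:R * fine (vol (@eball R n.+1))) :
  gauge N -> 0 < c ->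
  (forall x y, N (x + y) - c * enorm (x + y) <=
     (N x - c * enorm x) + (N y - c * enorm y)) ->
  scont f -> (forall x, sphere n.+2 x -> f (- x) = f x) ->
  (forall x, sphere n.+2 x -> 0 < f x) ->
  (forall xi, sphere n.+2 xi -> om <= Rad f xi) ->
  Sph (fun x => (N x)^-1 * f x) < Sph (fun x => (N x)^-1) ->
  exists w : 'rV[R]_n.+2 -> R, exists2 Lam : R, 0 <= Lam &
    [/\ forall a x, 0 <= a -> w (a *: x) = a * w x,
        forall x, w (- x) = w x,
        forall x y, w (x + y) + Lam * N (x + y) <=
          (w x + Lam * N x) + (w y + Lam * N y),
        scont w & forall x, sphere n.+2 x -> 0 < w x] /\
    (exists2 eta : R, 0 < eta & forall xi, sphere n.+2 xi ->
       1 + eta <= Rad (fun x => w x * (N x)^-1 ^+ n.+2) xi) /\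
    Sph (fun x => w x * (N x)^-1 ^+ n.+3) < Sph (fun x => (N x)^-1) / om.
Proof.
move=> gN c0 sN cf fE f0 Rf.
have om0 : 0 < om by rewrite mulr_gt0// fine_vol_eball_gt0.
clearbody om.
have N0 x : sphere n.+2 x -> 0 < N x by move=> /sphere_neq0/(gauge_gt0 gN).
have cN := gauge_scont gN.
have cN1 : scont (fun x => (N x)^-1).
  by have := @scont_gauge_inv R n.+1 N 1%N gN; under eq_fun do rewrite expr1.
set s1 := Sph (fun x => _ * _); set s := Sph _ => ss.
have s10 : 0 < s1.
  apply: Sph_gt0; first exact: scontM.
  by move=> x Sx; rewrite mulr_gt0 ?invr_gt0 ?N0 ?f0.
have s0 : 0 < s by rewrite (lt_trans s10).
pose v := Sph (fun x => (N x)^-1 ^+ n.+2).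
have v0 : 0 < v.
  apply: Sph_gt0; first exact: scont_gauge_inv.
  by move=> x Sx; rewrite exprn_gt0// invr_gt0 N0.
(* The gap [s - s1] is shared out: enlarging [f / om] by the factor [1 + tau] costs less than half
   of [(s - s1) / om], and the approximation error [e1] costs a quarter of it, as
   [e1 * v = (s - s1) / (4 om)]. *)
pose tau := (s - s1) / (2 * s).
have tau0 : 0 < tau by rewrite divr_gt0 ?subr_gt0// mulr_gt0.
pose e1 := (s - s1) / (4 * om * v).
have e10 : 0 < e1 by rewrite divr_gt0 ?subr_gt0// mulr_gt0// mulr_gt0.
pose k := (1 + tau) / om.
have k0 : 0 < k by rewrite divr_gt0// addr_gt0.
(* The exponent is one less than the dimension because the approximation returns [w] between [G * N]
   and [(G + e1) * N]; thus [w] divided by the power [n.+2] of [N] dominates [k f]. *)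
pose G x := k * f x * N x ^+ n.+1.
have cG : scont G.
  by apply: scontM; [apply: scontM => //; exact: scont_cst|exact: scontX].
have GE x : sphere n.+2 x -> G (- x) = G x.
  by move=> Sx; rewrite /G fE// gaugeN.
have [w [Lam L0 [wZ wN wD cw wG]]] := upper_approximation gN c0 sN cG GE e10.
have w0 x : sphere n.+2 x -> 0 < w x.
  move=> Sx; have /andP[h _] := wG x Sx; apply: lt_le_trans h.
  apply: mulr_gt0; last exact: N0.
  apply: mulr_gt0; last by rewrite exprn_gt0// N0.
  by apply: mulr_gt0 => //; exact: f0.
exists w, Lam => //; split; [by split|split].
  exists tau => // xi Sxi.
  apply: (@le_trans _ _ (Rad (fun x => k * f x) xi)).
    rewrite RadZ//; apply: le_trans (_ : k * om <= _); last by rewrite ler_pM2l// Rf.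
    by rewrite /k divfK ?gt_eqF.
  apply: le_Rad => //.
  - by apply: scontM => //; exact: scont_cst.
  - by apply: scontM => //; exact: scont_gauge_inv.
  move=> x Sx; have Nx := N0 x Sx; have /andP[h _] := wG x Sx.
  rewrite exprVn ler_pdivlMr ?exprn_gt0//; apply: le_trans h.
  by rewrite /G -mulrA -exprSr mulrA.
apply: (@le_lt_trans _ _ (k * s1 + e1 * v)); last first.
  have kE : k = (3 * s - s1) / (2 * s * om) by rewrite /k /tau; field; rewrite !gt_eqF.
  have h : 0 < s / om - (k * s1 + e1 * v); last by rewrite -subr_gt0.
  rewrite (_ : _ - _ = (s - s1) * (3 * s - 2 * s1) / (4 * s * om)); last first.
    by rewrite kE /e1; field; rewrite !gt_eqF.
  have h3 : 0 < 3 * s - 2 * s1 by move: (s) (s1) ss s10 => a b; lra.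
  apply: divr_gt0; first by apply: mulr_gt0 => //; rewrite subr_gt0.
  by apply: mulr_gt0 => //; apply: mulr_gt0.
have cNf : scont (fun x => (N x)^-1 * f x) by exact: scontM.
have cNd := @scont_gauge_inv R n.+1 N n.+2 gN.
have c1 : scont (fun x => k * ((N x)^-1 * f x)) by apply: scontM => //; exact: scont_cst.
have c2 : scont (fun x => e1 * (N x)^-1 ^+ n.+2) by apply: scontM => //; exact: scont_cst.
rewrite /s1 /v -(SphZ k cNf) -(SphZ e1 cNd) -SphD//.
apply: le_Sph; [by apply: scontM => //; exact: scont_gauge_inv|exact: scontD|].
move=> x Sx; have Nx := N0 x Sx; have /andP[_ h] := wG x Sx.
rewrite exprVn ler_pdivrMr ?exprn_gt0//; apply: le_trans h _.
rewrite /G le_eqVlt; apply/orP; left; apply/eqP.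
rewrite exprVn mulrDl [in RHS]mulrDl; congr (_ + _).
  rewrite -mulrA -exprSr -!(mulrA k); congr (_ * _).
  by rewrite [N x ^+ n.+3]exprS -[RHS]mulrA [f x * (N x * _)]mulrCA mulKf ?gt_eqF.
by rewrite [N x ^+ n.+3]exprSr -!(mulrA e1) mulKf// gt_eqF// exprn_gt0.
Qed.

Lemma scont_perturbed_inv n (N w : 'rV[R]_n.+1 -> R) e k : gauge N -> scont w ->
  (forall x, sphere n.+1 x -> 0 < w x) -> 0 < e ->
  scont (fun x => (N x + e * w x)^-1 ^+ k).
Proof.
move=> gN cw w0 e0; apply: scontX; apply: scontV.
  move=> x Sx; apply: lt0r_neq0; rewrite addr_gt0 ?mulr_gt0 ?w0//.
  exact: (gauge_gt0 gN (sphere_neq0 Sx)).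
apply: scontD; first exact: gauge_scont.
by apply: scontM => //; exact: scont_cst.
Qed.

Lemma perturbed_invE (a b e : R) k : 0 < a ->
  (a + e * b)^-1 ^+ k = a^-1 ^+ k * (1 + e * (b / a))^-1 ^+ k.
Proof.
move=> a0; rewrite -exprMn -invfM; congr (_^-1 ^+ _).
by field; rewrite gt_eqF.
Qed.

(** Bernoulli gives the first-order expansion as a one-sided bound without remainder, valid for
    every [e > 0]. *)
Lemma Sph_perturbed_ge n (N w : 'rV[R]_n.+1 -> R) e k : gauge N -> scont w ->
  (forall x, sphere n.+1 x -> 0 < w x) -> 0 < e ->
  Sph (fun x => (N x)^-1 ^+ k) - k%:R * e * Sph (fun x => w x * (N x)^-1 ^+ k.+1) <=
  Sph (fun x => (N x + e * w x)^-1 ^+ k).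
Proof.
move=> gN cw w0 e0; have cNk := @scont_gauge_inv R n N k gN.
have cwN : scont (fun x => w x * (N x)^-1 ^+ k.+1).
  by apply: scontM => //; exact: scont_gauge_inv.
have ck : scont (fun x => - (k%:R * e) * (w x * (N x)^-1 ^+ k.+1)).
  by apply: scontM => //; exact: scont_cst.
rewrite -mulNr -(SphZ _ cwN) -SphD//; apply: le_Sph.
- exact: scontD.
- exact: scont_perturbed_inv.
move=> x Sx; have Nx : 0 < N x by exact: (gauge_gt0 gN (sphere_neq0 Sx)).
have wx := w0 x Sx; rewrite perturbed_invE//.
have t0 : 0 <= e * (w x / N x) by rewrite mulr_ge0 ?divr_ge0// ltW.
have := ler_wpM2l (exprn_ge0 k (ltW (_ : 0 < (N x)^-1))) (inv_expr_ge k t0).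
rewrite invr_gt0 => /(_ Nx); apply: le_trans.
by rewrite le_eqVlt exprSr; apply/orP; left; apply/eqP; ring.
Qed.

(** In this direction there is a second-order remainder [e^2 q], bounded on the whole sphere by
    [e^2 Q]. For [e Q om < m eta] the margin [eta] absorbs it for all [xi] simultaneously. *)
Lemma Rad_perturbed_le n (N w : 'rV[R]_n.+2 -> R) (eta : R) : gauge N -> scont w ->
  (forall x, sphere n.+2 x -> 0 < w x) -> 0 < eta ->
  (forall xi, sphere n.+2 xi -> 1 + eta <= Rad (fun x => w x * (N x)^-1 ^+ n.+2) xi) ->
  exists2 e1 : R, 0 < e1 & forall e, 0 < e < e1 -> forall xi, sphere n.+2 xi ->
    Rad (fun x => (N x + e * w x)^-1 ^+ n.+1) xi / n.+1%:R <=
    Rad (fun x => (N x)^-1 ^+ n.+1) xi / n.+1%:R - e.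
Proof.
move=> gN cw w0 eta0 Rw.
pose m : R := n.+1%:R; have m0 : 0 < m by [].
pose om : R := m * fine (vol (@eball R n.+1)).
have om0 : 0 < om by rewrite mulr_gt0// fine_vol_eball_gt0.
have cNm := @scont_gauge_inv R n.+1 N n.+1 gN.
have cwN : scont (fun x => w x * (N x)^-1 ^+ n.+2).
  by apply: scontM => //; exact: scont_gauge_inv.
pose q x := (m * w x) ^+ 2 * (N x)^-1 ^+ n.+3.
have cq : scont q.
  apply: scontM; last exact: scont_gauge_inv.
  by apply: scontX; apply: scontM => //; exact: scont_cst.
have [Q Q0 hQ] := scont_ubound cq.
have Qom0 : 0 < Q * om by exact: mulr_gt0.
exists (m * eta / (Q * om)); first by apply: divr_gt0 => //; exact: mulr_gt0.
move=> e /andP[e0]; rewrite ltr_pdivlMr// => eQ xi Sxi.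
have c1 : scont (fun x => - (m * e) * (w x * (N x)^-1 ^+ n.+2)).
  by apply: scontM => //; exact: scont_cst.
have c2 : scont (fun _ : 'rV[R]_n.+2 => e ^+ 2 * Q) by exact: scont_cst.
have h : Rad (fun x => (N x + e * w x)^-1 ^+ n.+1) xi <=
    Rad (fun x => (N x)^-1 ^+ n.+1) xi +
    (- (m * e) * Rad (fun x => w x * (N x)^-1 ^+ n.+2) xi + e ^+ 2 * Q * om).
  rewrite -(RadZ Sxi _ cwN) -(Rad_cst xi (e ^+ 2 * Q)) -RadD// -RadD//; last exact: scontD.
  apply: le_Rad => //; [exact: scont_perturbed_inv|by do 2 apply: scontD => //|].
  move=> x Sx; have Nx : 0 < N x by exact: (gauge_gt0 gN (sphere_neq0 Sx)).
  have wx := w0 x Sx; rewrite perturbed_invE//.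
  have t0 : 0 <= e * (w x / N x) by rewrite mulr_ge0 ?divr_ge0// ltW.
  have := ler_wpM2l (exprn_ge0 n.+1 (ltW (_ : 0 < (N x)^-1))) (inv_expr_le n.+1 t0).
  rewrite invr_gt0 => /(_ Nx) h; apply: le_trans h _.
  have : e ^+ 2 * q x <= e ^+ 2 * Q by rewrite ler_pM2l ?exprn_gt0// hQ.
  rewrite /q -/m !(exprS _ n.+2) !(exprS _ n.+1).
  move: (N x)^-1 => b; move: (b ^+ n.+1) => a h.
  have -> : a * (1 - m * (e * (w x * b)) + (m * (e * (w x * b))) ^+ 2) =
    a + (- (m * e) * (w x * (b * a)) + e ^+ 2 * ((m * w x) ^+ 2 * (b * (b * a)))) by ring.
  by rewrite 2!lerD2l.
rewrite ler_pdivrMr// mulrBl divfK ?gt_eqF//; apply: le_trans h _.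
rewrite lerD2l; have h1 := Rw xi Sxi.
have h2 : m * e * (1 + eta) <= m * e * Rad (fun x => w x * (N x)^-1 ^+ n.+2) xi.
  by rewrite ler_pM2l// mulr_gt0.
have h3 : e * (e * (Q * om)) <= e * (m * eta) by rewrite ler_pM2l// ltW.
rewrite -/m.
have -> : e ^+ 2 * Q * om = e * (e * (Q * om)) by ring.
by move: h2 h3; rewrite mulNr mulrDr; lra.
Qed.

End perturbation.

(** * The derivative of the volume power and the constant [c_n1] *)

Section slope.
Context {R : realType}.

(** After inserting [Sph_inv_gauge_le], the powers of [V] cancel, and so do [n.+1] and [n.+2]
    against [p]. What remains is the volume of the unit ball to the power [p] divided by the volume
    of the unit ball one dimension lower, which is [c_n1]. *)
Lemma volume_slope_lt n (N w : 'rV[R]_n.+2 -> R) (p := n.+1%:R / n.+2%:R : R)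
    (V := Sph (fun x => (N x)^-1 ^+ n.+2) / n.+2%:R) :
  gauge N -> 0 < V ->
  Sph (fun x => w x * (N x)^-1 ^+ n.+3) <
    Sph (fun x => (N x)^-1) / (n.+1%:R * fine (vol (@eball R n.+1))) ->
  p * V `^ (p - 1) * Sph (fun x => w x * (N x)^-1 ^+ n.+3) < c_n1 n.+2.
Proof.
move=> gN V0 hA; have b'0 := @fine_vol_eball_gt0 R n.
have d0 : 0 < n.+2%:R :> R by [].
have m0 : 0 < n.+1%:R :> R by [].
have p0 : 0 < p by exact: divr_gt0.
have pV0 : 0 < p * V `^ (p - 1) by rewrite mulr_gt0// powR_gt0.
have := Sph_inv_gauge_le gN V0; rewrite -/p -/V => hY.
apply: (@lt_le_trans _ _ (p * V `^ (p - 1) *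
    (Sph (fun x => (N x)^-1) / (n.+1%:R * fine (vol (@eball R n.+1)))))).
  by rewrite ltr_pM2l.
have hom : 0 < n.+1%:R * fine (vol (@eball R n.+1)) by exact: mulr_gt0.
apply: (@le_trans _ _ (p * V `^ (p - 1) *
    (n.+2%:R * fine (vol (@eball R n.+2)) `^ p * V `^ (1 - p) /
     (n.+1%:R * fine (vol (@eball R n.+1)))))).
  by rewrite ler_pM2l// ler_pM2r// invr_gt0.
have VV : V `^ (p - 1) * V `^ (1 - p) = 1.
  by rewrite -powRD ?(gt_eqF V0) ?implybT// addrC subrKA subrr powRr0.
have aux (a b g h d m : R) : a * b = 1 -> 0 < h -> 0 < d -> 0 < m ->
    m / d * a * (d * g * b / (m * h)) = g / h.
  move=> ab h0 e0 k0; transitivity (a * b * (g / h)); last by rewrite ab mul1r.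
  by field; rewrite !gt_eqF.
by rewrite /p aux// lexx.
Qed.

End slope.

Theorem theorem6 (R : realType) (n : nat) (L : set 'rV[R]_n) :
  (2 <= n)%N ->
  convex_body L -> origin_symmetric L ->
  infinitely_smooth L -> strictly_positive_curvature L ->
  ~ intersection_body L ->
  exists eps0 : R, 0 < eps0 /\
    forall eps : R, 0 < eps < eps0 ->
      exists K : set 'rV[R]_n,
        [/\ convex_body K, origin_symmetric K, K `<=` L,
            (forall (xi : 'rV[R]_n) (U : 'M[R]_(n.-1, n)),
               sphere n xi -> hyperplane_param xi U ->
               (section_vol K U <= section_vol L U - eps%:E)%E) &
            powR (fine (vol K)) (n.-1%:R / n%:R) >
            powR (fine (vol L)) (n.-1%:R / n%:R) - c_n1 n * eps].
Proof.
case: n L => [|[|n]] L // _ cL sL smL curvL notL.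
pose N := mink L; have gN : gauge N by exact: mink_gauge.
have LE : L = [set x | N x <= 1] by exact: mink_body.
have [c c0 [_ sN]] := gauge_strongly_convex gN smL curvL.
have [f0 [cf0 Rf0 Sf0]] := not_intersection_body (gauge_scont gN)
  (fun x Sx => gauge_gt0 gN (sphere_neq0 Sx)) notL.
have [f [cf fE fpos Rf Sf]] := positive_witness gN cf0 Rf0 Sf0.
have [w [Lam L0 [[wZ wN wD cw wpos] [[eta eta0 Rw] Sw]]]] :=
  perturbation_direction gN c0 sN cf fE fpos Rf Sf.
pose V := Sph (fun x => (N x)^-1 ^+ n.+2) / n.+2%:R.
have V0 : 0 < V.
  apply: divr_gt0 => //; apply: Sph_gt0; first exact: scont_gauge_inv.
  by move=> x Sx; rewrite exprn_gt0// invr_gt0 (gauge_gt0 gN (sphere_neq0 Sx)).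
pose A := Sph (fun x => w x * (N x)^-1 ^+ n.+3).
have A0 : 0 < A.
  apply: Sph_gt0; first by apply: scontM => //; exact: scont_gauge_inv.
  move=> x Sx; apply: mulr_gt0; first exact: wpos.
  by rewrite exprn_gt0// invr_gt0 (gauge_gt0 gN (sphere_neq0 Sx)).
have [e2 e20 he2] := powR_decrease V0 A0 (volume_slope_lt gN V0 Sw).
have [e1 e10 he1] := Rad_perturbed_le gN cw wpos eta0 Rw.
have L10 : 0 < (Lam + 1)^-1 by rewrite invr_gt0 ltr_wpDl.
(* The three bounds ensure in turn that [N + e w] is a gauge, that the sections decrease enough, and
   that the volume decreases little. The added 1 allows for [Lam = 0]. *)
exists (Num.min (Lam + 1)^-1 (Num.min e1 e2)).
split; first by rewrite !lt_min L10 e10.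
move=> e; rewrite !lt_min => /andP[e0 /and3P[eL ee1 ee2]].
have eLam : e * Lam <= 1.
  have := ltW eL; rewrite -[_^-1]div1r ler_pdivlMr ?ltr_wpDl//.
  by apply: le_trans; rewrite ler_pM2l// lerDl.
have gK : gauge (fun x => N x + e * w x).
  by apply: perturbed_gauge eLam => // x Sx; rewrite ltW// wpos.
have [cK sK] := gauge_body gK.
exists [set x | N x + e * w x <= 1]; split => //.
- rewrite LE => x /=; apply: le_trans; rewrite lerDl mulr_ge0 ?(ltW e0)//.
  have [->|x0] := eqVneq x 0; first by rewrite -(scale0r (0 : 'rV[R]_n.+2)) wZ// mul0r.
  have {1}-> : x = enorm x *: ((enorm x)^-1 *: x).
    by rewrite scalerA mulfV ?scale1r// enorm_eq0.
  by rewrite wZ ?enorm_ge0// mulr_ge0 ?enorm_ge0// ltW// wpos//; exact: sphere_normalize.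
- move=> xi U Sxi HU; rewrite [in leRHS]LE.
  rewrite (section_vol_gauge gK Sxi HU) (section_vol_gauge gN Sxi HU).
  by rewrite -EFinB lee_fin he1// e0.
have e02 : 0 < e < e2 by rewrite e0.
have [Ve hV] := he2 e e02.
rewrite [in ltLHS]LE vol_gauge// vol_gauge//=; apply: lt_le_trans hV _.
apply: ge0_ler_powR; rewrite ?nnegrE//.
  by rewrite divr_ge0//; apply/ltW/Sph_gt0; [exact: scont_gauge_inv|] => x Sx;
    rewrite exprn_gt0// invr_gt0 (gauge_gt0 gK (sphere_neq0 Sx)).
rewrite ler_pdivlMr// mulrBl /V divfK ?pnatr_eq0//.
by rewrite [e * A * _]mulrC mulrA; exact: Sph_perturbed_ge.
Qed.
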